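(* Let $(X,\sigma)$ be a finitely irreducible countable sofic shift. Let $\mathcal F=\{\log f_n\}_{n=1}^\infty$ be a Bowen sequence on $X$ which is subadditive up to a constant, finitely quasi-multiplicative, and satisfies $Z_1(\mathcal F)=\sum_{i\in\mathbb N}\sup\{f_1(x):x\in[i]\}<\infty$. Then there is a unique invariant ergodic Gibbs measure $\mu$ for $\mathcal F$. Moreover, if in addition $$\sum_{i\in\mathbb N}\sup\{\log f_1(x):x\in[i]\}\,\sup\{f_1(x):x\in[i]\}>-\infty,$$ then $\mu$ is the unique equilibrium measure for $\mathcal F$ on $X$.
   Context: Shifts. $\mathbb N=\{1,2,\dots\}$; $\mathbb N^{\mathbb N}$ carries the left shift $\sigma$ and the cylinder topology. A subshift is a closed $X\subset\mathbb N^{\mathbb N}$ with $\sigma(X)\subseteq X$; it is a subshift on a countable alphabet if it is not contained in a full shift on a finite alphabet (its alphabet is identified with $\mathbb N$). $B_n(X)$ is the set of allowable words of length $n$ (initial words of length $n$ of points of $X$), $B_0(X)=\{\varepsilon\}$, $B(X)=\bigcup_{n\ge0}B_n(X)$, $[w]=\{x\in X:x\text{ begins with }w\}$. $X$ is irreducible if for all $u,v\in B(X)$ there is $w\in B(X)$ with $uwv\in B(X)$; it is finitely irreducible if there are $p\in\mathbb N$ and a finite $W_1\subset\bigcup_{n=0}^pB_n(X)$ such that for all $u,v\in B(X)$ there is $w\in W_1$ with $uwv\in B(X)$. A countable Markov shift is $\{x\in\mathbb N^{\mathbb N}:t_{x_nx_{n+1}}=1\ \forall n\}$ for a $0$-$1$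 matrix with no zero row or column. A one-block factor map $\pi:\bar X\to X$ is a continuous surjection commuting with the shifts of the form $(\pi(x))_i=\pi(x_i)$ for a map $\pi$ on symbols. A finitely irreducible countable sofic shift is a finitely irreducible subshift on a countable alphabet which is the image of an irreducible countable Markov shift under a one-block factor map $\pi$ with $|\pi^{-1}(i)|<\infty$ for each symbol $i$. Sequences. $\mathcal F=\{\log f_n\}_{n\ge1}$ with $f_n:X\to(0,\infty)$ continuous. It is a Bowen sequence if there is $M\in(0,\infty)$ with $f_n(x)/f_n(y)\le M$ for all $n$ and all $x,y\in X$ with $x_i=y_i$, $1\le i\le n$. It is subadditive up to a constant if there is $C\ge0$ with $f_{n+m}(x)\le e^Cf_n(x)f_m(\sigma^nx)$ for all $n,m,x$. It is finitely quasi-multiplicative if there exist $p\in\mathbb N$, $D>0$ and a finite set $W\subset\bigcup_{k=0}^pB_k(X)$ such that for all $n,m\in\mathbb N$, $u\in B_n(X)$, $v\in B_m(X)$ there is $w\in W$ with $uwv\in B(X)$ and $\sup_{x\in[uwv]}f_{n+m+|w|}(x)\ge D\sup_{x\in[u]}f_n(x)\sup_{x\in[v]}f_m(x)$. Measures. $M(X,\sigma)$ is the set of $\sigma$-invariant Borel probability measures. $P(\mathcal F)=\limsup_{n\to\infty}\frac1n\log\sum_{w\in B_n(X)}\sup_{x\in[w]}f_n(x)$. $\mu\in M(X,\sigma)$ is an equilibrium measure for $\mathcal F$ if $P(\mathcal F)=h_\mu(\sigma)+\lim_{n\to\infty}\frac1n\int\log f_n\,d\mu$. $\mu\in M(X,\sigma)$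 is Gibbs for $\mathcal F$ if there are constants $C_0>0$ and $P\in\mathbb R$ such that $\frac1{C_0}\le\frac{\mu([i_1\dots i_n])}{e^{-nP}f_n(x)}\le C_0$ for every $n\in\mathbb N$, every $i_1\dots i_n\in B_n(X)$ and every $x\in[i_1\dots i_n]$. *)

(* Defs.v *)
From HB Require Import structures.
From mathcomp Require Import all_boot all_order all_algebra.
From mathcomp Require Import all_classical all_reals all_analysis.
Import Order.TTheory GRing.Theory Num.Theory.
Import numFieldNormedType.Exports.

Set Implicit Arguments.
Unset Strict Implicit.
Unset Printing Implicit Defensive.

Local Open Scope classical_set_scope.
Local Open Scope ring_scope.

(* The countably infinite alphabet is nat, and coordinates are numbered
   from 0: [x i] is the symbol written x_{i+1} when coordinates start at 1.
   The topology is the product of the discrete ones, the sigma-algebra is the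
   Borel one. *)
Definition sequences : Type := prod_topology (fun _ : nat => nat).

HB.instance Definition _ := Pointed.on sequences.
HB.instance Definition _ := Nbhs.on sequences.
HB.instance Definition _ := Topological.on sequences.
HB.instance Definition _ :=
  Measurable.copy sequences (g_sigma_algebraType (@open sequences)).

Definition left_shift (x : sequences) : sequences := fun i => x i.+1.

Section Subshifts.
Implicit Types (X Y : set sequences) (u v w : seq nat).

Definition subshift X := closed X /\ left_shift @` X `<=` X.

Definition countable_alphabet X :=
  forall A : set nat, finite_set A -> ~ X `<=` [set x | range x `<=` A].

Definition words_of_size X (n : nat) : set (seq nat) :=
  [set mkseq x n | x in X].

Definition words X : set (seq nat) := \bigcup_n words_of_size X n.

Definition cylinder X w : set sequences :=
  [set x | X x /\ mkseq x (size w) = w].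

Definition alphabet X : set nat := [set i | cylinder X [:: i] !=set0].

Definition irreducible X :=
  forall u v, words X u -> words X v ->
    exists2 w, words X w & words X (u ++ w ++ v).

Definition finitely_irreducible X :=
  exists (p : nat) (W : set (seq nat)),
    [/\ (0 < p)%N, finite_set W,
        W `<=` \bigcup_(n in [set n | (n <= p)%N]) words_of_size X n &
        forall u v, words X u -> words X v ->
          exists2 w, W w & words X (u ++ w ++ v)].

Definition transition_matrix (t : nat -> nat -> bool) :=
  (forall i, exists j, t i j) /\ (forall j, exists i, t i j).

Definition markov_shift (t : nat -> nat -> bool) : set sequences :=
  [set x | forall n, t (x n) (x n.+1)].

Definition one_block_factor_map Y X (Pi : sequences -> sequences)
    (pi : nat -> nat) :=
  [/\ {within Y, continuous Pi}, Pi @` Y = X,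
      forall x, Y x -> Pi (left_shift x) = left_shift (Pi x) &
      forall x, Y x -> forall i, Pi x i = pi (x i)].

Definition finitely_irreducible_countable_sofic X :=
  [/\ subshift X, countable_alphabet X, finitely_irreducible X &
      exists (t : nat -> nat -> bool) (Pi : sequences -> sequences)
             (pi : nat -> nat),
        [/\ transition_matrix t, irreducible (markov_shift t),
            one_block_factor_map (markov_shift t) X Pi pi &
            forall i, finite_set (pi @^-1` [set i])]].

End Subshifts.

(* A sequence (log f_n)_{n >= 1} on X is given by [f : nat -> sequences -> R];
   only the values of [f n] on X for n >= 1 matter. *)
Section PotentialSequences.
Context {R : realType}.
Implicit Types (X : set sequences) (f : nat -> sequences -> R).

Definition positive_continuous X f :=
  forall n, (0 < n)%N ->
    {within X, continuous (f n)} /\ forall x, X x -> 0 < f n x.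

Definition bowen X f :=
  exists2 M : R, 0 < M &
    forall n x y, (0 < n)%N -> X x -> X y ->
      (forall i, (i < n)%N -> x i = y i) -> f n x / f n y <= M.

Definition subadditive_upto_constant X f :=
  exists2 C : R, 0 <= C &
    forall n m x, (0 < n)%N -> (0 < m)%N -> X x ->
      f (n + m)%N x <= expR C * f n x * f m (iter n left_shift x).

Definition sup_cyl X f (n : nat) (w : seq nat) : \bar R :=
  ereal_sup [set (f n x)%:E | x in cylinder X w].

Definition finitely_quasi_multiplicative X f :=
  exists (p : nat) (D : R) (W : set (seq nat)),
    [/\ (0 < p)%N, 0 < D, finite_set W,
        W `<=` \bigcup_(k in [set k | (k <= p)%N]) words_of_size X k &
        forall n m u v, (0 < n)%N -> (0 < m)%N ->
          words_of_size X n u -> words_of_size X m v ->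
          exists w, [/\ W w, words X (u ++ w ++ v) &
            (D%:E * sup_cyl X f n u * sup_cyl X f m v <=
             sup_cyl X f (n + m + size w) (u ++ w ++ v))%E]].

Definition Z1 X f : \bar R :=
  (\sum_(i <oo | i \in alphabet X) sup_cyl X f 1 [:: i])%E.

Definition pressure X f : \bar R :=
  limn_esup (fun n => (n%:R^-1)%:E *
    lne (\esum_(w in words_of_size X n) sup_cyl X f n w))%E.

End PotentialSequences.

(* Kolmogorov-Sinai entropy. A finite measurable partition is encoded by its
   labelling map [xi : T -> 'I_k]; the cells of the join of its pullbacks by
   S^0, ..., S^(n-1) are indexed by [{ffun 'I_n -> 'I_k}]. Empty cells do not
   contribute, since [ln 0 = 0]. *)
Section Entropy.
Context {d : measure_display} {T : measurableType d} {R : realType}.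
Variables (mu : probability T R) (S : T -> T).

Definition join_cell (k : nat) (xi : T -> 'I_k) (n : nat)
    (w : {ffun 'I_n -> 'I_k}) : set T :=
  [set x | forall i : 'I_n, xi (iter i S x) = w i].

Definition join_entropy (k : nat) (xi : T -> 'I_k) (n : nat) : R :=
  - \sum_(w : {ffun 'I_n -> 'I_k})
      fine (mu (join_cell xi w)) * ln (fine (mu (join_cell xi w))).

Definition partition_entropy (k : nat) (xi : T -> 'I_k) : R :=
  limn (fun n => n%:R^-1 * join_entropy xi n).

Definition measurable_labelling (k : nat) (xi : T -> 'I_k) :=
  forall i, measurable (xi @^-1` [set i]).

Definition entropy : \bar R :=
  ereal_sup [set h | exists (k : nat) (xi : T -> 'I_k),
    measurable_labelling xi /\ h = (partition_entropy xi)%:E].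

End Entropy.

Section Measures.
Context {R : realType}.
Implicit Types (X : set sequences) (f : nat -> sequences -> R).
Implicit Types mu : probability sequences R.

(* Borel probability measures on the closed set X are identified with those
   on [sequences] giving full measure to X. *)
Definition invariant_measure X mu :=
  mu X = 1%E /\ forall A, measurable A -> mu (left_shift @^-1` A) = mu A.

Definition ergodic X mu :=
  forall A, measurable A -> A `<=` X -> X `&` left_shift @^-1` A = A ->
    mu A = 0%E \/ mu A = 1%E.

Definition gibbs X f mu :=
  invariant_measure X mu /\
  exists C0 P : R, 0 < C0 /\
    forall n w x, (0 < n)%N -> words_of_size X n w -> cylinder X w x ->
      C0^-1 <= fine (mu (cylinder X w)) / (expR (- (n%:R * P)) * f n x) <= C0.

(* The side condition [+?] excludes the undefined sum of opposite
   infinities. *)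
Definition equilibrium X f mu :=
  invariant_measure X mu /\
  exists l : \bar R,
    [/\ (fun n => (n%:R^-1)%:E * \int[mu]_(x in X) (ln (f n x))%:E)%E
          @ \oo --> l,
        adde_def (entropy mu left_shift) l &
        pressure X f = (entropy mu left_shift + l)%E].

End Measures.

(* Main.v *)
(** Let g w be the supremum of f_n over the cylinder of a word w of length n. By
    subadditivity and quasi-multiplicativity the sum of g over words of length n is
    comparable with exp(n P). Draw a word of length N with probability proportional
    to g: the probability of seeing u at position k is comparable with
    exp(-|u| P) g u. Banach limits, first in N and then in k, turn these
    probabilities into shift-invariant weights of words, the condition Z1 < oo
    preventing any loss of mass; these are the cylinder masses of a Gibbs measure mu.

    For a Gibbs measure, quasi-multiplicativity bounds c mu[u] mu(B) by a finite sum
    over w of mu([u] & sigma^-(|u|+|w|) B). Taking an invariant B, this compares two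
    measures on cylinders, hence on all Borel sets, and gives ergodicity. Two Gibbs
    measures are absolutely continuous with respect to each other, hence equal.

    For equilibrium, the alphabet is truncated by x |-> min x K. If E depends on the
    first n truncated coordinates, Gibbs' inequality bounds
    H_nu(n truncated coordinates) + L nu(E) by
    n P - int ln f_n dnu + ln C + mu(E) exp(L) for every nu and L >= 0. With L = 0
    this is the variational inequality. If nu is an equilibrium, then L nu(E) stays
    bounded as long as mu(E) <= exp(-L), so nu << mu and nu = mu. The summability of
    f_1 log f_1 bounds the entropies of the truncations under mu, which makes the
    variational inequality an equality at mu in the limit K -> oo. *)

Require Import Defs.
From HB Require Import structures.
From mathcomp Require Import all_boot all_order all_algebra.
From mathcomp Require Import all_classical all_reals all_analysis.
From mathcomp Require Import measurable_realfun zify ring lra.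
Import Order.TTheory GRing.Theory Num.Theory.
Import numFieldNormedType.Exports.

Set Implicit Arguments.
Unset Strict Implicit.
Unset Printing Implicit Defensive.

Local Open Scope classical_set_scope.
Local Open Scope ring_scope.

(** * Banach limits *)

Section BanachLimits.
Context {R : realType}.
Implicit Types a b : nat -> R.

(** The sequence space is not compact and a Banach limit is only finitely additive. Domination by
    the weights of single letters restores countable additivity whenever a word is extended by one
    letter, and a coding of [0, 1[ by nested intervals turns the resulting consistent weights into a
    Borel measure.

    The gap word supplied by quasi-multiplicativity varies with u and v. Summing over the finite set
    W removes the choice, so that the inequality can be summed over words; the price is a change of
    position by |w|, invisible to a shift-invariant limit.

    Inequalities between measures do not pass to complements, so a comparison on cylinders reaches
    Borel sets by approximation in measure rather than by a monotone class. The approximating sets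
    depend on finitely many truncated coordinates, hence are unions of cells of a finite partition.
    The same partitions carry the entropy, which is a supremum over finite partitions, whereas the
    partition by the first letter is infinite. *)

Definition bounded_seq a := exists B, forall n, `|a n| <= B.

(** [L] is a total function on real sequences; the laws are imposed on bounded ones, and its other
    values are arbitrary. *)
Definition banach_limit (L : (nat -> R) -> R) :=
  [/\ forall a b, bounded_seq a -> bounded_seq b ->
        L (fun n => a n + b n) = L a + L b,
      forall c a, bounded_seq a -> L (fun n => c * a n) = c * L a,
      forall a b, bounded_seq a -> bounded_seq b ->
        (forall n, a n <= b n) -> L a <= L b,
      forall c, L (fun=> c) = c &
      forall a, bounded_seq a -> L (fun n => a n.+1) = L a].

Let mean a n : R := n.+1%:R^-1 * \sum_(k < n.+1) a k.

Let mean_bound a B : (forall n, `|a n| <= B) -> forall n, `|mean a n| <= B.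
Proof.
move=> aB n; rewrite normrM ger0_norm ?invr_ge0 ?ler0n//.
rewrite mulrC ler_pdivrMr ?ltr0Sn//.
apply: (le_trans (ler_norm_sum _ _ _)).
apply: (le_trans (ler_sum _ (fun (k : 'I_n.+1) _ => aB k))).
by rewrite sumr_const card_ord -[leLHS]mulr_natr.
Qed.

(** Cesaro means of a bounded sequence stay in a compact interval, hence converge along an
    ultrafilter finer than [\oo]. Averaging gives shift invariance: the means of a sequence and of
    its shift differ by [(a n.+1 - a 0) / n.+1]. *)
Lemma banach_limit_exists : exists L, banach_limit L.
Proof.
have [U [UU ooU]] := @ultraFilterLemma nat \oo _.
have cvgm a : bounded_seq a -> cvg (mean a @ U).
  move=> [B aB].
  have cmp : compact `[- B, B]%classic by exact: segment_compact.
  apply/cvg_ex; have [p [_ ?]] : `[- B, B]%classic `&` [set p | mean a @ U --> p] !=set0.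
    move: cmp; rewrite compact_ultra; apply => //.
      split; first exact: fmap_proper_filter.
      move=> G PG sG; apply/seteqP; split => // A GA.
      have [//|nA] := in_ultra_setVsetC (mean a @^-1` A) UU.
      have : G (A `&` ~` A) by apply: filterI => //; exact: sG.
      by rewrite setICr => /filter_not_empty.
    apply: ooU; near=> n; rewrite /= in_itv/= -ler_norml.
    exact: mean_bound.
  by exists p.
have UPF : ProperFilter U by exact: ultra_proper.
exists (fun a => lim (mean a @ U)); split.
- move=> a b ba bb; apply/cvg_lim => //.
  rewrite (_ : mean _ = mean a \+ mean b); first exact: cvgD (cvgm _ ba) (cvgm _ bb).
  by apply/funext => n; rewrite /mean big_split/= mulrDr.
- move=> c a ba; apply/cvg_lim => //.
  rewrite (_ : mean _ = (fun n => c * mean a n)); first exact: cvgMr (cvgm _ ba).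
  by apply/funext => n; rewrite /mean -mulr_sumr mulrCA.
- move=> a b ba bb ab; apply: (ler_lim (cvgm _ ba) (cvgm _ bb)).
  near=> n; rewrite /mean ler_wpM2l ?invr_ge0//.
  exact: ler_sum.
- move=> c; apply/cvg_lim => //.
  rewrite (_ : mean _ = (fun=> c)); first exact: cvg_cst.
  apply/funext => n; rewrite /mean sumr_const card_ord -[c *+ _]mulr_natl.
  by rewrite mulrA mulVf ?mul1r// pnatr_eq0.
- move=> a ba; apply/cvg_lim => //.
  rewrite (_ : mean _ = (fun n => mean a n + n.+1%:R^-1 * (a n.+1 - a 0%N))); last first.
    apply/funext => n; rewrite /mean -mulrDr; congr (_ * _).
    rewrite addrA (_ : \sum_(k < n.+1) a k + _ = \sum_(k < n.+2) a k); last first.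
      by rewrite [RHS]big_ord_recr.
    by rewrite [in RHS]big_ord_recl/= addrAC subrr add0r; apply: eq_bigr.
  rewrite -[X in _ --> X]addr0; apply: cvgD; first exact: cvgm.
  have [B aB] := ba.
  suff : (fun n => n.+1%:R^-1 * (a n.+1 - a 0%N)) @ \oo --> (0 : R).
    by move=> h A /h; exact: ooU.
  apply/norm_cvg0P.
  apply: (@squeeze_cvgr _ _ _ _ (fun=> 0) (fun n => (B + B) * n.+1%:R^-1)).
  + near=> n; rewrite normr_ge0/= normrM [leLHS]mulrC (ger0_norm (_ : 0 <= n.+1%:R^-1)) ?invr_ge0//.
    by rewrite ler_wpM2r ?invr_ge0// (le_trans (ler_normB _ _))// lerD.
  + exact: cvg_cst.
  + rewrite -(mulr0 (B + B)); apply: cvgMr; exact: cvg_harmonic.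
Unshelve. all: by end_near. Qed.

(** Shift invariance discards the first [N] terms. *)
Lemma banach_limit_le_near L a b : banach_limit L ->
  bounded_seq a -> bounded_seq b ->
  (exists N, forall n, (N <= n)%N -> a n <= b n) -> L a <= L b.
Proof.
move=> [_ _ Lle _ Lsh] ba bb [N ab].
have shift c : bounded_seq c -> L c = L (fun n => c (n + N)%N).
  move=> [B cB]; elim: N {ab} => [|N ->].
    by congr L; apply/funext => n; rewrite addn0.
  rewrite -Lsh; last by exists B.
  by congr L; apply/funext => n; rewrite addnS addSn.
rewrite (shift a)// (shift b)//; apply: Lle.
- by case: ba => B aB; exists B.
- by case: bb => B bB; exists B.
- by move=> n; apply: ab; rewrite leq_addl.
Qed.

Lemma banach_limit_shift L a m : banach_limit L -> bounded_seq a ->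
  L (fun n => a (n + m)%N) = L a.
Proof.
move=> [_ _ _ _ Lsh] [B aB]; elim: m => [|m IH].
  by congr L; apply/funext => n; rewrite addn0.
rewrite -IH -[RHS]Lsh; last by exists B.
by congr L; apply/funext => n; rewrite addnS addSn.
Qed.

Lemma bounded_seq_sum (I : Type) (s : seq I) (a : I -> nat -> R) :
  (forall i, bounded_seq (a i)) -> bounded_seq (fun n => \sum_(i <- s) a i n).
Proof.
move=> ba; elim: s => [|i s [B sB]].
  by exists 0 => n; rewrite big_nil normr0.
have [C iC] := ba i; exists (C + B) => n; rewrite big_cons.
by rewrite (le_trans (ler_normD _ _))// lerD.
Qed.

Lemma banach_limit_sum L (I : Type) (s : seq I) (a : I -> nat -> R) :
  banach_limit L -> (forall i, bounded_seq (a i)) ->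
  L (fun n => \sum_(i <- s) a i n) = \sum_(i <- s) L (a i).
Proof.
move=> BL ba; have [LD _ _ Lc _] := BL.
elim: s => [|i s IH].
  by rewrite big_nil -(Lc 0); congr L; apply/funext => n; rewrite big_nil.
rewrite big_cons -IH -LD//; last exact: bounded_seq_sum.
by congr L; apply/funext => n; rewrite big_cons.
Qed.

Lemma banach_limit_bounds L a x y : banach_limit L ->
  (forall n, x <= a n <= y) -> x <= L a <= y.
Proof.
move=> BL axy; have [_ _ Lle Lc _] := BL.
have ba : bounded_seq a.
  exists (`|x| + `|y|) => n; have /andP[] := axy n.
  have := ler_norm y; have := ler_norm (- x); rewrite normrN ler_norml.
  by have := normr_ge0 x; have := normr_ge0 y; lra.
have bc c : bounded_seq (fun=> c : R) by exists `|c|.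
by rewrite -{1}(Lc x) -(Lc y); apply/andP; split; apply: Lle => // n;
  case/andP: (axy n).
Qed.

(** A dominated convergence theorem: [L] commutes with finite sums, and the tails of the summable
    bound [b] control the remainder uniformly in [n]. The row sums are prescribed only from some [N]
    on, since a word at a given position must first fit. *)
Lemma banach_limit_nneseries L (a : nat -> nat -> R) (s b : nat -> R) :
  banach_limit L -> (forall n i, 0 <= a n i <= b i) ->
  (\sum_(i <oo) (b i)%:E < +oo)%E -> bounded_seq s ->
  (exists N, forall n, (N <= n)%N -> (s n)%:E = \sum_(i <oo) (a n i)%:E)%E ->
  (\sum_(i <oo) (L (a^~ i))%:E = (L s)%:E)%E.
Proof.
move=> BL ab boo bs [N sE]; have [LD _ _ Lc _] := BL.
have a0 n i : 0 <= a n i by case/andP: (ab n i).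
have b0 i : 0 <= b i by case/andP: (ab 0%N i) => ? ?; lra.
have ba i : bounded_seq (a^~ i).
  by exists (b i) => n; rewrite ger0_norm//; case/andP: (ab n i).
have La0 i : 0 <= L (a^~ i).
  by have /andP[] : 0 <= L (a^~ i) <= b i by apply: banach_limit_bounds.
have bc c : bounded_seq (fun=> c : R) by exists `|c|.
have sumL m : \sum_(0 <= i < m) L (a^~ i) = L (fun n => \sum_(0 <= i < m) a n i).
  by rewrite (@banach_limit_sum L _ (index_iota 0 m) (fun i n => a n i)).
apply/eqP; rewrite eq_le; apply/andP; split.
  apply: lime_le; first by apply: is_cvg_nneseries => i _ _; rewrite lee_fin.
  apply: nearW => m; rewrite sumEFin lee_fin sumL.
  apply: banach_limit_le_near => //; first exact: bounded_seq_sum.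
  exists N => n Nn; rewrite -lee_fin sE// -sumEFin.
  by apply: nneseries_lim_ge => i _ _; rewrite lee_fin.
have tail m : (\sum_(m <= i <oo) (b i)%:E)%E \is a fin_num.
  rewrite ge0_fin_numE; last by apply: nneseries_ge0 => i _ _; rewrite lee_fin.
  apply: le_lt_trans boo; rewrite [leRHS](nneseries_split 0 m).
    by rewrite add0n leeDr// sume_ge0// => i _; rewrite lee_fin.
  by move=> k _; rewrite lee_fin.
have key m : ((L s)%:E <= \sum_(i <oo) (L (a^~ i))%:E + \sum_(m <= i <oo) (b i)%:E)%E.
  apply: (@le_trans _ _ (\sum_(0 <= i < m) (L (a^~ i))%:E + \sum_(m <= i <oo) (b i)%:E)%E).
    rewrite -(fineK (tail m)) sumEFin -EFinD lee_fin sumL -(Lc (fine _)) -LD//; last first.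
      exact: bounded_seq_sum.
    apply: banach_limit_le_near => //.
      have [B bB] : bounded_seq (fun n => \sum_(0 <= i < m) a n i) by exact: bounded_seq_sum.
      exists (B + `|fine (\sum_(m <= i <oo) (b i)%:E)%E|) => n.
      by rewrite (le_trans (ler_normD _ _))// lerD.
    exists N => n Nn; rewrite -lee_fin sE// EFinD (fineK (tail m)) -sumEFin.
    rewrite (nneseries_split 0 m); last by move=> k _; rewrite lee_fin.
    rewrite add0n leeD2l//; apply: lee_nneseries => i _; first by rewrite lee_fin.
    by rewrite lee_fin; case/andP: (ab n i).
  by rewrite leeD2r//; apply: nneseries_lim_ge => i _ _; rewrite lee_fin.
have cvt : (\sum_(m <= i <oo) (b i)%:E)%E @[m --> \oo] --> 0%E.
  by apply: (@nneseries_tail_cvg R _ xpredT) => // k _; rewrite lee_fin.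
have cvs : (\sum_(i <oo) (L (a^~ i))%:E + \sum_(m <= i <oo) (b i)%:E)%E
    @[m --> \oo] --> (\sum_(i <oo) (L (a^~ i))%:E + 0)%E.
  by apply: cvgeD => //; [rewrite fin_num_adde_defl|exact: cvg_cst].
by rewrite -[leRHS]adde0; apply: cvge_ge cvs; apply: nearW => m; exact: key.
Qed.

End BanachLimits.

(** * Sums over words *)

Section WordSums.
Context {R : realType}.
Implicit Types (F G : seq nat -> \bar R) (n m : nat).

(** Summing letter by letter makes cutting a word into two a plain induction; [wsumE] identifies the
    result with the unordered sum over words of length [n]. *)
Fixpoint wsum n F : \bar R :=
  if n is m.+1 then (\sum_(i <oo) wsum m (fun w => F (i :: w)))%E else F [::].

Lemma eq_wsum n F G : (forall w, size w = n -> F w = G w) -> wsum n F = wsum n G.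
Proof.
elim: n F G => [|n IH] F G FG /=; first exact: FG.
by apply: eq_eseriesr => i _; apply: IH => w sw; apply: FG; rewrite /= sw.
Qed.

Lemma wsum_ge0 n F : (forall w, (0 <= F w)%E) -> (0 <= wsum n F)%E.
Proof.
elim: n F => [|n IH] F F0 /=; first exact: F0.
by apply: nneseries_ge0 => i _ _; exact: IH.
Qed.

Lemma le_wsum n F G : (forall w, (0 <= F w)%E) ->
  (forall w, size w = n -> (F w <= G w)%E) -> (wsum n F <= wsum n G)%E.
Proof.
elim: n F G => [|n IH] F G F0 FG /=; first exact: FG.
apply: lee_nneseries => i _; first by move=> _; exact: wsum_ge0.
by apply: IH => // w sw; apply: FG; rewrite /= sw.
Qed.

Lemma wsum_cat n m F :
  wsum (n + m) F = wsum n (fun u => wsum m (fun v => F (u ++ v))).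
Proof.
by elim: n F => [|n IH] F//=; apply: eq_eseriesr => i _; rewrite IH.
Qed.

Lemma wsum_nneseries n (F : nat -> seq nat -> \bar R) :
  (forall i w, (0 <= F i w)%E) ->
  (\sum_(i <oo) wsum n (F i) = wsum n (fun w => \sum_(i <oo) F i w))%E.
Proof.
elim: n F => [|n IH] F F0 //=.
rewrite nneseries_interchange; last by move=> i j; exact: wsum_ge0.
by apply: eq_eseriesr => i _; exact: IH.
Qed.

Lemma wsum_exchange n m (F : seq nat -> seq nat -> \bar R) :
  (forall u v, (0 <= F u v)%E) ->
  wsum n (fun u => wsum m (F u)) = wsum m (fun v => wsum n (fun u => F u v)).
Proof.
elim: n F => [|n IH] F F0 //=.
rewrite -wsum_nneseries; last by move=> i w; exact: wsum_ge0.
by apply: eq_eseriesr => i _; rewrite IH.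
Qed.

Lemma wsumZl n F (c : R) : (forall w, (0 <= F w)%E) ->
  wsum n (fun w => c%:E * F w)%E = (c%:E * wsum n F)%E.
Proof.
elim: n F => [|n IH] F F0 //=.
rewrite -nneseriesZl; last by move=> i _; exact: wsum_ge0.
by apply: eq_eseriesr => i _; rewrite IH.
Qed.

Lemma wsum_sum (I : Type) (s : seq I) n (F : I -> seq nat -> \bar R) :
  (forall i w, (0 <= F i w)%E) ->
  wsum n (fun w => \sum_(i <- s) F i w)%E = (\sum_(i <- s) wsum n (F i))%E.
Proof.
elim: n F => [|n IH] F F0 //=.
rewrite -nneseries_sum; last by move=> i j _; exact: wsum_ge0.
by apply: eq_eseriesr => i _; rewrite IH.
Qed.

Lemma wsumE n F : (forall w, (0 <= F w)%E) ->
  wsum n F = (\esum_(w in [set w | size w = n]) F w)%E.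
Proof.
elim: n F => [|n IH] F F0 /=.
  rewrite (_ : [set w | size w = 0%N] = [set [::]]) ?esum_set1//.
  by apply/seteqP; split => w /=; [move/size0nil|move=> ->].
rewrite nneseries_esumT; last by move=> i; exact: wsum_ge0.
under eq_esum do rewrite IH//.
rewrite (esum_esum (J := fun=> [set w | size w = n])
  (a := fun i w => F (i :: w)))//.
rewrite (@reindex_esum _ _ _ ([set: nat] `*`` fun=> [set w | size w = n])
  _ (fun k => k.1 :: k.2))//; split.
- by move=> [i w] [_ /= ->].
- by move=> [i w] [j v] _ _ [-> ->].
- by move=> [|i w]//= [sw]; exists (i, w).
Qed.

Lemma wsum_prefix (w : seq nat) m F : (forall w, (0 <= F w)%E) ->
  (wsum m (fun v => F (w ++ v)) <= wsum (size w + m) F)%E.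
Proof.
elim: w F => [|i w IH] F F0 //=.
apply: (le_trans (IH (fun v => F (i :: v)) _)) => //.
have := @nneseries_lim_ge R (fun j => wsum (size w + m) (fun v => F (j :: v)))
  (pred1 i) 0 i.+1 (fun j _ _ => wsum_ge0 (size w + m) (fun v => F0 (j :: v))).
rewrite big_mkord (big_pred1 ord_max)//= => /le_trans; apply.
by apply: subset_lee_nneseries => // j _; exact: wsum_ge0.
Qed.

Lemma wsum_suffix (w : seq nat) n F : (forall w, (0 <= F w)%E) ->
  (wsum n (fun u => F (u ++ w)) <= wsum (n + size w) F)%E.
Proof.
move=> F0; rewrite wsum_cat; apply: le_wsum => // u _.
have := @wsum_prefix w 0 (fun v => F (u ++ v)) (fun v => F0 _).
by rewrite /= cats0 addn0.
Qed.

End WordSums.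

(** [ln (c * z n)] is superadditive and [ln (K * z n)] is subadditive. As [c <= K], every average of
    the first lies below every average of the second, and [P] is the supremum of the first
    averages. *)
Lemma quasimultiplicative_rate {R : realType} (z : nat -> R) (K c : R) :
  z 0%N = 1 -> (forall n, 0 < z n) -> 0 < c -> c <= 1 -> 1 <= K ->
  (forall n m, c * (z n * z m) <= z (n + m)%N) ->
  (forall n m, z (n + m)%N <= K * (z n * z m)) ->
  exists P, forall n, c * z n <= expR (n%:R * P) /\ expR (n%:R * P) <= K * z n.
Proof.
move=> z0 zp c0 c1 K1 zl zu.
have K0 : 0 < K by lra.
have cz n : 0 < c * z n by rewrite mulr_gt0.
have Kz n : 0 < K * z n by rewrite mulr_gt0.
have pl n m : m.+1%:R * ln (c * z n) <= ln (c * z (n * m.+1)%N).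
  elim: m => [|m IH]; first by rewrite muln1 mul1r.
  rewrite -natr1 mulrDl mul1r (le_trans (lerD IH (lexx _)))//.
  rewrite -lnM ?posrE// ler_ln ?posrE ?mulr_gt0//.
  by rewrite (mulnS n m.+1) addnC -!mulrA ler_pM2l// mulrCA zl.
have pu n m : ln (K * z (n * m.+1)%N) <= m.+1%:R * ln (K * z n).
  elim: m => [|m IH]; first by rewrite muln1 mul1r.
  rewrite -[m.+2%:R]natr1 mulrDl mul1r (le_trans _ (lerD IH (lexx _)))//.
  rewrite -lnM ?posrE// ler_ln ?posrE ?mulr_gt0//.
  by rewrite (mulnS n m.+1) addnC -!mulrA ler_pM2l// mulrCA zu.
(* The two averages are compared at the common length [n.+1 * m.+1]. *)
have lu n m : n.+1%:R^-1 * ln (c * z n.+1) <= m.+1%:R^-1 * ln (K * z m.+1).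
  rewrite ler_pdivrMl ?ltr0Sn// mulrCA ler_pdivlMl ?ltr0Sn//.
  rewrite (le_trans (pl _ _))// (le_trans _ (pu _ _))// mulnC.
  by rewrite ler_ln ?posrE// ler_pM2r//; lra.
pose A := [set r | exists n, r = n.+1%:R^-1 * ln (c * z n.+1)].
have Aub m : ubound A (m.+1%:R^-1 * ln (K * z m.+1)).
  by move=> _ [n ->]; exact: lu.
have A0 : A !=set0 by exists (1%:R^-1 * ln (c * z 1%N)); exists 0%N.
exists (sup A) => -[|n].
  by rewrite mul0r expR0 z0 !mulr1.
split.
- rewrite -[leLHS]lnK ?posrE// ler_expR -ler_pdivrMl ?ltr0Sn//.
  apply: ub_le_sup; last by exists n.
  by exists (1%:R^-1 * ln (K * z 1%N)); exact: Aub.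
- rewrite -[leRHS]lnK ?posrE// ler_expR -ler_pdivlMl ?ltr0Sn//.
  by apply: ge_sup => //; exact: Aub.
Qed.

(** * Gibbs weights of words *)

Section GibbsWeights.
Context {R : realType}.
Variables (g : seq nat -> R) (K D : R) (W : seq (seq nat)).
Hypothesis g_nil : g [::] = 1.
Hypothesis g_ge0 : forall w, 0 <= g w.
Hypothesis K_ge1 : 1 <= K.
Hypothesis g_submul : forall u v, g (u ++ v) <= K * (g u * g v).
Hypothesis D_gt0 : 0 < D.
Hypothesis g_quasimul : forall u v, u != [::] -> v != [::] ->
  D * (g u * g v) <= \sum_(w <- W) g (u ++ w ++ v).
Hypothesis g_summable : (\sum_(i <oo) (g [:: i])%:E < +oo)%E.
Hypothesis g_nontrivial : exists i, 0 < g [:: i].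

Let G (w : seq nat) : \bar R := (g w)%:E.
Let z n := fine (wsum n G).

Let K_gt0 : 0 < K. Proof. by move: K_ge1; lra. Qed.

Let G_ge0 w : (0 <= G w)%E. Proof. by rewrite lee_fin. Qed.
Hint Resolve G_ge0 : core.

Let K_ge0 : 0 <= K. Proof. exact: ltW. Qed.
Let D_ge0 : 0 <= D. Proof. exact: ltW. Qed.
Hint Resolve K_ge0 D_ge0 : core.

Let wsum_fin n : wsum n G \is a fin_num.
Proof.
rewrite ge0_fin_numE ?wsum_ge0//; elim: n => [|n IH]; first by rewrite ltry.
have f1 : wsum 1 G \is a fin_num by rewrite ge0_fin_numE ?wsum_ge0.
have fn : wsum n G \is a fin_num by rewrite ge0_fin_numE ?wsum_ge0.
rewrite -add1n wsum_cat.
apply: (@le_lt_trans _ _ (wsum 1 (fun u => wsum n (fun v => (K * g u)%:E * G v)%E))).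
  apply: le_wsum => [w|u _]; first exact: wsum_ge0.
  by apply: le_wsum => // v _; rewrite lee_fin -mulrA.
rewrite (eq_wsum (G := fun u => (K * fine (wsum n G))%:E * G u)%E); last first.
  by move=> u _; rewrite wsumZl// -(fineK fn) -!EFinM mulrAC.
by rewrite wsumZl// -(fineK f1) -EFinM ltry.
Qed.

Let zE n : wsum n G = (z n)%:E. Proof. by rewrite /z fineK. Qed.

Let z_ge0 n : 0 <= z n. Proof. by rewrite fine_ge0// wsum_ge0. Qed.
Hint Resolve z_ge0 : core.

Let z_z (c : R) n m :
  wsum n (fun u => wsum m (fun v => (c * (g u * g v))%:E)) = (c * (z n * z m))%:E.
Proof.
rewrite (eq_wsum (G := fun u => (c * z m)%:E * G u)%E) => [|u _].
  by rewrite wsumZl// zE -EFinM mulrAC mulrA.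
rewrite -EFinM mulrAC EFinM -zE -wsumZl//.
by apply: eq_wsum => v _; rewrite mulrA EFinM.
Qed.

Let z0 : z 0%N = 1. Proof. by rewrite /z /= /G g_nil. Qed.

Let z_submul n m : z (n + m)%N <= K * (z n * z m).
Proof.
rewrite -lee_fin -z_z -zE wsum_cat.
apply: le_wsum => [w|u _]; first exact: wsum_ge0.
by apply: le_wsum => // v _; rewrite lee_fin.
Qed.

Let z1_gt0 : 0 < z 1%N.
Proof.
have [i gi] := g_nontrivial.
rewrite (lt_le_trans gi)// -lee_fin -zE.
exact: (@wsum_prefix R [:: i] 0 G G_ge0).
Qed.

Let q := \sum_(w <- W) z (size w).

(** The hypothesis is summed over [u] and [v]; letting each gap word range over all words of its
    length only enlarges the right side, and submultiplicativity then splits off the factor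
    [z (size w)]. *)
Let z_quasimul n m : (0 < n)%N -> (0 < m)%N ->
  D * (z n * z m) <= K * K * q * z (n + m)%N.
Proof.
move=> n0 m0.
apply: (@le_trans _ _ (\sum_(w <- W) z (n + (size w + m))%N)); last first.
  rewrite /q mulr_sumr mulr_suml; apply: ler_sum => w _.
  rewrite addnCA -mulrA (le_trans (z_submul _ _))// -mulrA ler_wpM2l//.
  by rewrite ler_peMl// mulr_ge0.
rewrite -lee_fin -z_z -sumEFin.
rewrite (eq_bigr (fun w : seq nat => wsum n (fun u => wsum m (fun v =>
   wsum (size w) (fun t => G (u ++ t ++ v)))))); last first.
  move=> w _; rewrite -zE wsum_cat; apply: eq_wsum => u _.
  by rewrite wsum_cat wsum_exchange.
rewrite -wsum_sum; last by move=> i w; do 2 (apply: wsum_ge0 => ?).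
apply: le_wsum => [w|u su].
  by apply: wsum_ge0 => v; rewrite lee_fin !mulr_ge0.
rewrite -wsum_sum; last by move=> i w; apply: wsum_ge0.
apply: le_wsum => [w|v sv]; first by rewrite lee_fin !mulr_ge0.
apply: (@le_trans _ _ (\sum_(w <- W) g (u ++ w ++ v))%:E).
  by rewrite lee_fin g_quasimul// -size_eq0 ?su ?sv -lt0n.
rewrite -sumEFin; apply: lee_sum => w _.
have := @wsum_prefix R w 0 (fun t => G (u ++ t ++ v)) (fun=> G_ge0 _).
by rewrite /= cats0 addn0.
Qed.

Let q_gt0 : 0 < K * K * q.
Proof.
have q0 : 0 <= K * K * q by rewrite !mulr_ge0// sumr_ge0.
rewrite lt_neqAle q0 andbT eq_sym; apply/eqP => q0'.
have := z_quasimul (ltn0Sn 0) (ltn0Sn 0); rewrite q0' mul0r.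
by apply/negP; rewrite -ltNge !mulr_gt0.
Qed.

(** The minimum with 1 covers the lengths [n = 0] and [m = 0], which quasi-multiplicativity does not
    reach. *)
Let c := Num.min 1 (D / (K * K * q)).

Let c_gt0 : 0 < c.
Proof. by rewrite lt_min ltr01 divr_gt0. Qed.

Let c_le1 : c <= 1.
Proof. by rewrite ge_min lexx. Qed.

Let z_supmul n m : c * (z n * z m) <= z (n + m)%N.
Proof.
case: n => [|n]; first by rewrite z0 mul1r add0n ler_piMl.
case: m => [|m]; first by rewrite z0 mulr1 addn0 ler_piMl.
apply: (@le_trans _ _ (D / (K * K * q) * (z n.+1 * z m.+1))).
  by rewrite ler_wpM2r ?mulr_ge0// ge_min lexx orbT.
by rewrite mulrAC ler_pdivrMr// [leRHS]mulrC z_quasimul.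
Qed.

Let z_gt0 n : 0 < z n.
Proof.
elim: n => [|n IH]; first by rewrite z0.
by rewrite -add1n (lt_le_trans _ (z_supmul _ _))// !mulr_gt0.
Qed.

Section Rate.
Variable P : R.
Hypothesis Pz : forall n, c * z n <= expR (n%:R * P) /\ expR (n%:R * P) <= K * z n.

(* The weight of the words of length N in which u occurs at position k. *)
Let A N k u := wsum k (fun a => wsum (N - k - size u) (fun b => G (a ++ u ++ b))).

Let A_ge0 N k u : (0 <= A N k u)%E.
Proof. by do 2 (apply: wsum_ge0 => ?). Qed.

Let A_ub N k u : (A N k u <= (K * K * g u * (z k * z (N - k - size u)%N))%:E)%E.
Proof.
rewrite -z_z; apply: le_wsum => [w|a _]; first exact: wsum_ge0.
apply: le_wsum => // b _; rewrite lee_fin (le_trans (g_submul _ _))//.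
rewrite [leRHS](_ : _ = K * (g a * (K * (g u * g b)))); last by ring.
by rewrite !ler_wpM2l.
Qed.

Let A_fin N k u : A N k u \is a fin_num.
Proof. by rewrite ge0_fin_numE// (le_lt_trans (A_ub _ _ _))// ltry. Qed.

(** The probability of seeing [u] at position [k] in a random word of length [N]. The default 0
    occurs only for [N < k + size u], which the limit in [N] ignores. *)
Let alpha N k u := if (k + size u <= N)%N then fine (A N k u) / z N else 0.

(** [K * K] pays for detaching [u] from both of its neighbours, [K / (c * c)] for replacing the sums
    [z] by exponentials. *)
Let c1 := K * K * K / (c * c).

Let c1_gt0 : 0 < c1. Proof. by rewrite divr_gt0// !mulr_gt0. Qed.

Let ub u := c1 * (expR (- ((size u)%:R * P)) * g u).

Let ub_ge0 u : 0 <= ub u.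
Proof. by apply: mulr_ge0; [exact: ltW c1_gt0|rewrite mulr_ge0 ?expR_ge0]. Qed.

Let alpha_bounds N k u : 0 <= alpha N k u <= ub u.
Proof.
rewrite /alpha; case: ifPn => [kuN|_]; last by rewrite lexx ub_ge0.
apply/andP; split; first exact: divr_ge0 (fine_ge0 (A_ge0 _ _ _)) (z_ge0 _).
rewrite ler_pdivrMr; last exact: z_gt0.
rewrite -lee_fin fineK// (le_trans (A_ub _ _ _))// lee_fin.
set m := (N - k - size u)%N.
have NE : N = (k + size u + m)%N by move: kuN; rewrite /m; clear; lia.
have [cz _] := Pz k; have [cm _] := Pz m; have [_ Kz] := Pz N.
have e0 : 0 < expR (- ((size u)%:R * P)) by exact: expR_gt0.
have eN : expR (k%:R * P) * expR (m%:R * P) =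
    expR (N%:R * P) * expR (- ((size u)%:R * P)).
  by rewrite -!expRD NE !natrD; congr expR; ring.
have h : c * z k * (c * z m) <= K * z N * expR (- ((size u)%:R * P)).
  apply: (@le_trans _ _ (expR (k%:R * P) * expR (m%:R * P))).
    by rewrite ler_pM// mulr_ge0// ltW.
  by rewrite eN ler_wpM2r// ltW.
rewrite /ub /c1.
rewrite [leLHS](_ : _ = (K * K * g u) / (c * c) * (c * z k * (c * z m))); last first.
  by field; rewrite gt_eqF.
rewrite [leRHS](_ : _ = (K * K * g u) / (c * c) * (K * z N * expR (- ((size u)%:R * P)))); last first.
  by field; rewrite gt_eqF.
by rewrite ler_wpM2l// !mulr_ge0// invr_ge0 mulr_ge0 ?(ltW c_gt0).
Qed.

Let alphaE N k u : (k + size u <= N)%N ->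
  (alpha N k u)%:E = ((z N)^-1%:E * A N k u)%E.
Proof. by move=> kuN; rewrite /alpha kuN mulrC EFinM fineK. Qed.

Let alpha_nil N k : (k <= N)%N -> alpha N k [::] = 1.
Proof.
move=> kN; apply: EFin_inj; rewrite alphaE ?addn0// /A /= subn0.
rewrite -(wsum_cat k (N - k) G) subnKC// zE -EFinM mulVf//.
by rewrite gt_eqF// z_gt0.
Qed.

Let alpha_rcons N k u : (k + size u < N)%N ->
  (alpha N k u)%:E = (\sum_(i <oo) (alpha N k (rcons u i))%:E)%E.
Proof.
move=> kuN; rewrite alphaE ?(ltnW kuN)//.
rewrite (eq_eseriesr (g := fun i => (z N)^-1%:E * A N k (rcons u i))%E); last first.
  by move=> i _; rewrite alphaE// size_rcons addnS.
rewrite nneseriesZl//; congr (_ * _)%E.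
rewrite wsum_nneseries; last by move=> i w; exact: wsum_ge0.
apply: eq_wsum => a _; rewrite (_ : N - k - size u = (N - k - (size u).+1).+1)%N; last by move: kuN; clear; lia.
by apply: eq_eseriesr => i _; rewrite size_rcons; apply: eq_wsum => b _; rewrite cat_rcons.
Qed.

Let alpha_cons N k u : (k.+1 + size u <= N)%N ->
  (alpha N k.+1 u)%:E = (\sum_(i <oo) (alpha N k (i :: u))%:E)%E.
Proof.
move=> kuN; rewrite alphaE//.
rewrite (eq_eseriesr (g := fun i => (z N)^-1%:E * A N k (i :: u))%E); last first.
  by move=> i _; rewrite alphaE//= addnS.
rewrite nneseriesZl//; congr (_ * _)%E.
rewrite wsum_nneseries; last by move=> i w; exact: wsum_ge0.
rewrite /A -[k.+1]addn1 wsum_cat/=.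
apply: eq_wsum => a _; apply: eq_eseriesr => i _.
rewrite (_ : N - k - (size u).+1 = N - (k + 1) - size u)%N; last by clear; lia.
by apply: eq_wsum => b _; rewrite -catA.
Qed.

Let Q := \sum_(w1 <- W) \sum_(w2 <- W) K * z (size w1 + size w2)%N.

Let Q_ge0 : 0 <= Q.
Proof. by do 2 (apply: sumr_ge0 => ? _); exact: mulr_ge0. Qed.

(** Joining [a], [u] and [b] by gap words [w1] and [w2] puts [u] at position [k + size w1] in a word
    longer than [N] by [size w1 + size w2]. Cutting that many letters off the right end restores the
    length [N] and costs at most the factor [Q]. *)
Let A_lb N k u : u != [::] -> (0 < k)%N ->
  (forall w, w \in W -> (k + size w + size u < N)%N) ->
  (D * D * g u * (z k * z (N - k - size u)%N) <=
   (size W)%:R * Q * \sum_(w <- W) fine (A N (k + size w) u)).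
Proof.
move=> u0 k0 WN; set l := (N - k - size u)%N.
pose H w1 w2 a b := G (a ++ w1 ++ u ++ w2 ++ b).
have wH_ge0 w1 w2 a : (0 <= wsum l (H w1 w2 a))%E.
  by apply: wsum_ge0 => b; exact: G_ge0.
(* A member of [W] gives [0 < l] through [WN]; an empty [W] makes quasi-multiplicativity say
   [g u = 0]. *)
have [W0|[w0 w0W]] : W = [::] \/ exists w0, w0 \in W.
- by case: (W) => [|w0 s]; [left|right; exists w0; rewrite mem_head].
- have := g_quasimul u0 u0; rewrite W0 big_nil => h.
  have /eqP -> : g u == 0.
    rewrite -sqrf_eq0 expr2 eq_le mulr_ge0// andbT.
    by rewrite -(pmulr_rle0 _ D_gt0).
  by rewrite mulr0 mul0r !mulr_ge0// sumr_ge0// => w _; rewrite fine_ge0.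
have l0 : (0 < l)%N by move: (WN _ w0W); rewrite /l; clear; lia.
have W_le w1 w2 : w1 \in W -> w2 \in W -> K * z (size w1 + size w2)%N <= Q.
  move=> w1W w2W; rewrite /Q (big_rem w1)//= (big_rem w2 w2W)/= -addrA ler_wpDr//.
  by rewrite addr_ge0//; do ?(apply: sumr_ge0 => ? _); rewrite ?mulr_ge0.
have step1 : ((D * D * g u * (z k * z l))%:E <=
    \sum_(w1 <- W) \sum_(w2 <- W) wsum k (fun a => wsum l (H w1 w2 a)))%E.
  rewrite (eq_bigr (fun w1 => wsum k (fun a => \sum_(w2 <- W) wsum l (H w1 w2 a)))%E); last first.
    by move=> w1 _; rewrite -wsum_sum// => i w; exact: wH_ge0.
  rewrite -wsum_sum; last by move=> i w; apply: sume_ge0 => ? _; exact: wH_ge0.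
  rewrite -z_z; apply: le_wsum => [a|a sa].
    by apply: wsum_ge0 => b; rewrite lee_fin !mulr_ge0.
  rewrite (eq_bigr (fun w1 => wsum l (fun b => \sum_(w2 <- W) H w1 w2 a b))%E); last first.
    by move=> w1 _; rewrite -wsum_sum// => ? ?; exact: G_ge0.
  rewrite -wsum_sum; last by move=> i w; apply: sume_ge0 => ? _; exact: G_ge0.
  apply: le_wsum => [b|b sb]; first by rewrite lee_fin !mulr_ge0.
  under eq_bigr do rewrite sumEFin.
  rewrite sumEFin lee_fin.
  have a0 : a != [::] by rewrite -size_eq0 sa -lt0n.
  have b0 : b != [::] by rewrite -size_eq0 sb -lt0n.
  apply: (@le_trans _ _ (D * (\sum_(w1 <- W) g (a ++ w1 ++ u)) * g b)).
    rewrite [leLHS](_ : _ = D * (D * (g a * g u)) * g b); last by ring.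
    by rewrite ler_wpM2r// ler_wpM2l// g_quasimul.
  rewrite mulr_sumr mulr_suml; apply: ler_sum => w1 _.
  have a1 : a ++ w1 ++ u != [::] by case: (a) a0.
  rewrite -mulrA (le_trans (g_quasimul a1 b0))//.
  by apply: ler_sum => w2 _; rewrite -!catA.
have step2 w1 w2 : w1 \in W -> w2 \in W ->
    (wsum k (fun a => wsum l (H w1 w2 a)) <= Q%:E * A N (k + size w1) u)%E.
  move=> w1W w2W; have lt1 := WN _ w1W.
  set m := (N - (k + size w1) - size u)%N.
  apply: (@le_trans _ _ (wsum k (fun a => wsum (size w2 + l)
      (fun b => G (a ++ w1 ++ u ++ b))))).
    apply: le_wsum => [a|a _]; first exact: wH_ge0.
    exact: (@wsum_prefix R w2 l (fun b => G (a ++ w1 ++ u ++ b))).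
  rewrite (_ : size w2 + l = m + (size w1 + size w2))%N; last by move: lt1; rewrite /m /l; clear; lia.
  apply: (@le_trans _ _ (wsum k (fun a => wsum m (fun b => Q%:E * G (a ++ w1 ++ u ++ b))))%E).
    apply: le_wsum => [a|a _]; first by apply: wsum_ge0 => ?; exact: G_ge0.
    rewrite wsum_cat; apply: le_wsum => [b|b _]; first exact: wsum_ge0.
    apply: (@le_trans _ _ ((K * g (a ++ w1 ++ u ++ b))%:E * wsum (size w1 + size w2) G)%E).
      rewrite -wsumZl//; apply: le_wsum => // v _.
      by rewrite lee_fin -mulrA (le_trans _ (g_submul _ _))// !catA.
    by rewrite zE lee_fin mulrAC ler_wpM2r// W_le.
  rewrite (eq_wsum (G := fun a => Q%:E * wsum m (fun b => G (a ++ w1 ++ u ++ b)))%E); last first.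
    by move=> a _; rewrite wsumZl.
  rewrite wsumZl; last by move=> a; exact: wsum_ge0.
  rewrite lee_wpmul2l ?lee_fin//.
  have := @wsum_suffix R w1 k (fun a => wsum m (fun b => G (a ++ u ++ b)))
    (fun=> wsum_ge0 _ (fun=> G_ge0 _)).
  by apply: le_trans; rewrite le_eqVlt (_ : _ == _)//; apply/eqP/eq_wsum => a _;
    apply: eq_wsum => b _; rewrite -catA.
rewrite -lee_fin (le_trans step1)// EFinM -sumEFin.
rewrite [in leRHS](eq_bigr (fun w => A N (k + size w) u)); last by move=> w _; rewrite fineK.
rewrite ge0_sume_distrr//; rewrite big_seq [leRHS]big_seq; apply: lee_sum => w1 w1W.
rewrite (@le_trans _ _ (\sum_(w2 <- W) Q%:E * A N (k + size w1) u)%E)//.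
  by rewrite big_seq [leRHS]big_seq; apply: lee_sum => w2 w2W; exact: step2.
rewrite -(fineK (A_fin N (k + size w1) u)) -EFinM sumEFin -EFinM lee_fin.
by rewrite big_const_seq count_predT iter_addr addr0 -[leLHS]mulr_natl mulrA.
Qed.

(** [D * D] comes from the two gaps around [u], [c] and [K * K] from replacing [z] by exponentials;
    the [+ 1] keeps the denominator positive. *)
Let c2 := D * D * c / (K * K * ((size W)%:R * Q + 1)).

Let Q1_gt0 : 0 < (size W)%:R * Q + 1.
Proof. by rewrite ltr_wpDl// mulr_ge0. Qed.

Let c2_gt0 : 0 < c2.
Proof. by apply: divr_gt0; rewrite mulr_gt0// mulr_gt0. Qed.

Let alpha_lb N k u : u != [::] -> (0 < k)%N ->
  (forall w, w \in W -> (k + size w + size u < N)%N) -> (k + size u <= N)%N ->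
  c2 * (expR (- ((size u)%:R * P)) * g u) <= \sum_(w <- W) alpha N (k + size w) u.
Proof.
move=> u0 k0 WN kuN; have := A_lb u0 k0 WN.
set m := (N - k - size u)%N => h.
have NE : N = (k + size u + m)%N by move: kuN; rewrite /m; clear; lia.
have [_ cz] := Pz k; have [_ cm] := Pz m; have [Kz _] := Pz N.
have e0 : 0 <= expR (- ((size u)%:R * P)) by exact: expR_ge0.
have eN : expR (k%:R * P) * expR (m%:R * P) =
    expR (N%:R * P) * expR (- ((size u)%:R * P)).
  by rewrite -!expRD NE !natrD; congr expR; ring.
have h1 : c * z N * expR (- ((size u)%:R * P)) <= K * z k * (K * z m).
  apply: (@le_trans _ _ (expR (k%:R * P) * expR (m%:R * P))).
    by rewrite eN ler_wpM2r.
  by rewrite ler_pM// expR_ge0.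
set S := \sum_(w <- W) fine (A N (k + size w) u) in h.
have S_ge0 : 0 <= S by apply: sumr_ge0 => w _; exact: fine_ge0.
have -> : \sum_(w <- W) alpha N (k + size w) u = S / z N.
  rewrite /S mulr_suml big_seq [RHS]big_seq; apply: eq_bigr => w wW.
  by rewrite /alpha (ltnW (WN _ wW)).
rewrite ler_pdivlMr//.
have h2 : D * D * g u * (c * z N * expR (- ((size u)%:R * P))) <=
    K * K * (((size W)%:R * Q + 1) * S).
  apply: (@le_trans _ _ (D * D * g u * (K * z k * (K * z m)))).
    by rewrite ler_wpM2l// !mulr_ge0.
  rewrite [leLHS](_ : _ = K * K * (D * D * g u * (z k * z m))); last by ring.
  rewrite ler_wpM2l ?mulr_ge0// (le_trans h)// mulrDl lerDl mul1r.
  exact: S_ge0.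
rewrite /c2 [leLHS](_ : _ = D * D * g u * (c * z N * expR (- ((size u)%:R * P))) /
   (K * K * ((size W)%:R * Q + 1))); last by field; rewrite !gt_eqF.
rewrite ler_pdivrMr ?mulr_gt0// (le_trans h2)//.
by rewrite [leRHS]mulrC -[leRHS]mulrA.
Qed.

Variable L : (nat -> R) -> R.
Hypothesis BL : banach_limit L.

Let alpha_bnd k u : bounded_seq (fun N => alpha N k u).
Proof.
exists (ub u) => N; have /andP[h0 h1] := alpha_bounds N k u.
by rewrite ger0_norm.
Qed.

Let B k u := L (fun N => alpha N k u).

Let B_bounds k u : 0 <= B k u <= ub u.
Proof. by apply: banach_limit_bounds => // N; exact: alpha_bounds. Qed.

Let B_bnd u : bounded_seq (B^~ u).
Proof.
by exists (ub u) => N; have /andP[h0 h1] := B_bounds N u; rewrite ger0_norm.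
Qed.

(** Up to a constant depending on [u], the bound for an extended word is the weight of the new
    letter. This is the domination required to exchange [L] with the sum over extensions, on either
    side of [u]. *)
Let ub_summable (e : nat -> seq nat) u : (forall i, size (e i) = (size u).+1) ->
  (forall i, g (e i) <= K * (g u * g [:: i])) ->
  (\sum_(i <oo) (ub (e i))%:E < +oo)%E.
Proof.
move=> se ge.
set C := c1 * (expR (- ((size u).+1%:R * P)) * (K * g u)).
have C0 : 0 <= C.
  by rewrite mulr_ge0 ?(ltW c1_gt0)// mulr_ge0 ?expR_ge0// mulr_ge0.
apply: (@le_lt_trans _ _ (C%:E * \sum_(i <oo) (g [:: i])%:E)%E).
  rewrite -nneseriesZl; last by move=> i _; rewrite lee_fin.
  apply: lee_nneseries => i _; first by rewrite lee_fin ub_ge0.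
  rewrite -EFinM lee_fin /ub /C se [leRHS](_ : _ =
    c1 * (expR (- ((size u).+1%:R * P)) * (K * (g u * g [:: i])))); last by ring.
  by apply: ler_wpM2l; [exact: ltW c1_gt0|apply: ler_wpM2l; rewrite ?expR_ge0].
have : (\sum_(i <oo) (g [:: i])%:E)%E \is a fin_num.
  by rewrite ge0_fin_numE// nneseries_ge0// => i _ _; rewrite lee_fin.
by move=> /fineK <-; rewrite -EFinM ltry.
Qed.

Let ub_rcons u : (\sum_(i <oo) (ub (rcons u i))%:E < +oo)%E.
Proof.
apply: (ub_summable (u := u)) => i; first by rewrite size_rcons.
by rewrite -cats1.
Qed.

Let ub_cons u : (\sum_(i <oo) (ub (i :: u))%:E < +oo)%E.
Proof.
apply: (ub_summable (u := u)) => i //.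
by rewrite -cat1s (le_trans (g_submul _ _))// (mulrC (g u)).
Qed.

Let B_nil k : B k [::] = 1.
Proof.
have [_ _ _ Lc _] := BL; rewrite /B -(Lc 1).
have b1 : bounded_seq (fun=> 1 : R) by exists `|1|.
by apply: le_anti; apply/andP; split; apply: (banach_limit_le_near BL) => //;
  exists k => N kN; rewrite alpha_nil.
Qed.

Let B_rcons k u : (\sum_(i <oo) (B k (rcons u i))%:E = (B k u)%:E)%E.
Proof.
apply: (banach_limit_nneseries BL (b := fun i => ub (rcons u i))
  (a := fun N i => alpha N k (rcons u i)) (s := fun N => alpha N k u)) => //.
by exists (k + size u).+1 => N kuN; exact: alpha_rcons.
Qed.

Let B_cons k u : (\sum_(i <oo) (B k (i :: u))%:E = (B k.+1 u)%:E)%E.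
Proof.
apply: (banach_limit_nneseries BL (b := fun i => ub (i :: u))
  (a := fun N i => alpha N k (i :: u)) (s := fun N => alpha N k.+1 u)) => //.
by exists (k.+1 + size u)%N => N kuN; exact: alpha_cons.
Qed.

Let B_lb k u : u != [::] -> (0 < k)%N ->
  c2 * (expR (- ((size u)%:R * P)) * g u) <= \sum_(w <- W) B (k + size w) u.
Proof.
move=> u0 k0; have [_ _ _ Lc _] := BL; rewrite -[leLHS]Lc.
rewrite -(banach_limit_sum (a := fun w N => alpha N (k + size w) u) _ BL); last first.
  by move=> w; exact: alpha_bnd.
apply: (banach_limit_le_near BL).
- by exists `|c2 * (expR (- ((size u)%:R * P)) * g u)|.
- by apply: bounded_seq_sum => w; exact: alpha_bnd.
(* From this length on, every shifted copy of [u] fits strictly inside. *)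
exists (k + size u + \sum_(w <- W) size w).+1 => N hN; apply: alpha_lb => // [w wW|].
  by move: hN; rewrite (big_rem w wW)/=; set t := (\sum_(w <- _) _)%N; clear; lia.
by move: hN; set t := (\sum_(w <- _) _)%N; clear; lia.
Qed.

(* The limit in N makes B k additive under extension on either side of u; the one
   in k absorbs the change of position caused by extension on the left. *)
Let p u := L (B^~ u).

Lemma gibbs_weights_limit :
  [/\ p [::] = 1,
      forall u, (\sum_(i <oo) (p (rcons u i))%:E = (p u)%:E)%E,
      forall u, (\sum_(i <oo) (p (i :: u))%:E = (p u)%:E)%E &
      exists2 C, 0 < C & forall u,
        C^-1 * (expR (- ((size u)%:R * P)) * g u) <= p u <=
        C * (expR (- ((size u)%:R * P)) * g u)].
Proof.
have [_ _ _ Lc Lsh] := BL.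
have p1 : p [::] = 1.
  by rewrite /p -(Lc 1); congr L; apply/funext => k; rewrite B_nil.
split => // [u|u|].
- apply: (banach_limit_nneseries BL (b := fun i => ub (rcons u i))
    (a := fun k i => B k (rcons u i)) (s := fun k => B k u)) => //.
  by exists 0%N => k _; rewrite B_rcons.
- rewrite /p -(Lsh (B^~ u))//.
  apply: (banach_limit_nneseries BL (b := fun i => ub (i :: u))
    (a := fun k i => B k (i :: u)) (s := fun k => B k.+1 u)) => //.
    by have [b bb] := B_bnd u; exists b.
  by exists 0%N => k _; rewrite B_cons.
have W1 : 0 < ((size W)%:R + 1 : R) by rewrite ltr_wpDl.
have i0 : 0 < ((size W)%:R + 1) / c2 by exact: divr_gt0.
(* The term 1 serves the empty word, [c1] the upper bound, and the last term is the inverse of the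
   constant in the lower bound. *)
exists (1 + c1 + ((size W)%:R + 1) / c2) => [|u].
  by rewrite !addr_gt0.
set e := expR (- ((size u)%:R * P)) * g u.
have e0 : 0 <= e by rewrite mulr_ge0 ?expR_ge0.
apply/andP; split; last first.
  have /andP[_ pu] : 0 <= p u <= ub u by apply: banach_limit_bounds.
  rewrite (le_trans pu)// /ub ler_wpM2r//; first by move: i0; lra.
have [u0|u0] := eqVneq u [::].
  by rewrite /e u0 p1 /= mul0r oppr0 expR0 g_nil !mulr1 invf_le1; move: i0 c1_gt0; lra.
apply: (@le_trans _ _ (c2 / ((size W)%:R + 1) * e)).
  by rewrite ler_wpM2r// -(invf_div _ c2) lef_pV2 ?posrE; move: i0 c1_gt0; lra.
rewrite mulrAC ler_pdivrMr//.
apply: (@le_trans _ _ ((size W)%:R * p u)); last first.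
  have /andP[pu _] : 0 <= p u <= ub u by apply: banach_limit_bounds.
  by rewrite mulrDr mulr1 mulrC lerDl.
(* Shift invariance in [k] replaces every position [k + (size w).+1] by [k]; the extra 1 is there
   because [B_lb] asks for a positive position. *)
have -> : (size W)%:R * p u = \sum_(w <- W) L (fun k => B (k + (size w).+1)%N u).
  rewrite (eq_bigr (fun=> p u)) => [|w _]; last first.
    by rewrite /p (banach_limit_shift (a := B^~ u)).
  by rewrite big_const_seq count_predT iter_addr addr0 -[RHS]mulr_natl.
rewrite -(banach_limit_sum (a := fun w k => B (k + (size w).+1)%N u) _ BL); last first.
  by move=> w; have [b bb] := B_bnd u; exists b.
have [_ _ Lle _ _] := BL; rewrite -(Lc (c2 * e)); apply: Lle.
- by exists `|c2 * e|.
- by apply: bounded_seq_sum => w; have [b bb] := B_bnd u; exists b.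
move=> k; rewrite (le_trans (B_lb u0 (ltn0Sn k)))//.
by apply: ler_sum => w _; rewrite addSnnS.
Qed.

End Rate.

Lemma gibbs_weights_exist : exists (P : R) (p : seq nat -> R),
  [/\ p [::] = 1,
      forall u, (\sum_(i <oo) (p (rcons u i))%:E = (p u)%:E)%E,
      forall u, (\sum_(i <oo) (p (i :: u))%:E = (p u)%:E)%E &
      exists2 C, 0 < C & forall u,
        C^-1 * (expR (- ((size u)%:R * P)) * g u) <= p u <=
        C * (expR (- ((size u)%:R * P)) * g u)].
Proof.
have [P Pz] := quasimultiplicative_rate z0 z_gt0 c_gt0 c_le1 K_ge1 z_supmul z_submul.
have [L BL] := @banach_limit_exists R.
by exists P; eexists; exact: (gibbs_weights_limit Pz BL).
Qed.

End GibbsWeights.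

(** * Borel measures on sequences *)

(** Cylinders of the whole sequence space: measures live there and merely give full mass to [X]. *)
Definition cyl (w : seq nat) : set sequences := [set x | mkseq x (size w) = w].

Section CylinderTopology.

Lemma cylP (w : seq nat) (x : sequences) :
  cyl w x <-> forall i, (i < size w)%N -> x i = nth 0%N w i.
Proof.
split => [xw i iw|xw]; first by rewrite -[in RHS]xw nth_mkseq.
apply: (@eq_from_nth _ 0%N); first by rewrite size_mkseq.
by move=> i; rewrite size_mkseq => iw; rewrite nth_mkseq// xw.
Qed.

Lemma cyl_mkseq (x : sequences) n : cyl (mkseq x n) x.
Proof. by rewrite /cyl /= size_mkseq. Qed.

Lemma cyl_nil : cyl [::] = setT.
Proof. by apply/seteqP; split. Qed.

Lemma cyl_catE (u v : seq nat) (x : sequences) :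
  cyl (u ++ v) x <-> cyl u x /\ cyl v (iter (size u) left_shift x).
Proof.
have it n i : iter n left_shift x i = x (n + i)%N.
  elim: n i => [//|n IH] i.
  by rewrite iterS /left_shift IH addnS.
split=> [/cylP uv|[/cylP xu /cylP xv]].
  split; apply/cylP => i iu.
    by rewrite uv ?nth_cat ?iu// size_cat ltn_addr.
  by rewrite it uv ?nth_cat ?size_cat ?ltn_add2l// ltnNge leq_addr/= addKn.
apply/cylP => i; rewrite size_cat nth_cat => iuv.
case: ltnP => ui; first exact: xu.
by rewrite -{1}(subnKC ui) -it xv// ltn_subLR.
Qed.

Lemma open_coordinate i j : open [set x : sequences | x i = j].
Proof.
have -> : [set x : sequences | x i = j] = (@proj nat (fun=> nat) i) @^-1` [set j].
  by apply/seteqP; split.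
apply: open_comp; last exact: discrete_open.
by move=> x _; exact: proj_continuous.
Qed.

Lemma open_cyl w : open (cyl w).
Proof.
have -> : cyl w = \bigcap_(i in [set i | (i < size w)%N]) [set x | x i = nth 0%N w i].
  by apply/seteqP; split => x; [move/cylP|move=> h; apply/cylP].
elim: (size w) => [|n IH].
  rewrite (_ : [set i | _] = set0); last by apply/seteqP; split.
  by rewrite bigcap_set0; exact: openT.
have -> : [set i | (i < n.+1)%N] = [set i | (i < n)%N] `|` [set n].
  by apply/seteqP; split => i /=; lia.
rewrite bigcap_setU bigcap_set1; apply: openI => //.
exact: open_coordinate.
Qed.

Lemma open_cylP (U : set sequences) x : open U -> U x ->
  exists n, cyl (mkseq x n) `<=` U.
Proof.
move=> oU Ux.
pose F := filter_from [set: nat] (fun n => cyl (mkseq x n)).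
have FF : Filter F.
  apply: filter_from_filter; first by exists 0%N.
  move=> n m _ _; exists (maxn n m) => // y /cylP h; split; apply/cylP => i;
    rewrite size_mkseq => im; rewrite h ?nth_mkseq ?size_mkseq ?leq_max ?im ?orbT//.
have cF : F --> x.
  apply/cvg_sup => i V [B] [[W] oW <-] Wx WV.
  exists i.+1 => // y /cylP yx; apply: WV => /=.
  by move: Wx => /=; rewrite yx ?size_mkseq// nth_mkseq.
have [n _ ?] : F U by apply: cF; exact: open_nbhs_nbhs.
by exists n.
Qed.

Lemma open_bigcup_cyl (U : set sequences) : open U ->
  U = \bigcup_(w in [set w | cyl w `<=` U]) cyl w.
Proof.
move=> oU; apply/seteqP; split => [x Ux|x [w wU xw]]; last exact: wU.
by have [n nU] := open_cylP oU Ux; exists (mkseq x n) => //; exact: cyl_mkseq.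
Qed.

Lemma measurable_open (U : set sequences) : open U -> measurable U.
Proof. by move=> oU; apply: sub_sigma_algebra. Qed.

Lemma measurable_closed (A : set sequences) : closed A -> measurable A.
Proof.
move=> cA; rewrite -[A]setCK; apply: measurableC; apply: measurable_open.
exact: closed_openC.
Qed.

Lemma measurable_cyl w : measurable (cyl w).
Proof. by apply: measurable_open; exact: open_cyl. Qed.

(** There are countably many words, so every open set is a countable union of cylinders. *)
Lemma sigma_algebra_cyl :
  (@measurable _ sequences) = <<s range cyl >>.
Proof.
apply/seteqP; split; last first.
  apply: smallest_sub; first exact: sigma_algebra_measurable.
  by move=> _ [w _ <-]; exact: measurable_cyl.
apply: smallest_sub; first exact: smallest_sigma_algebra.
move=> U oU; rewrite (open_bigcup_cyl oU) bigcup_mkcond.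
have [s0 sC sU] := smallest_sigma_algebra [set: sequences] (range cyl).
pose F n := if @unpickle (seq nat) n is Some w then
  (if w \in [set w | cyl w `<=` U] then cyl w else set0) else set0.
have -> : \bigcup_i (if i \in [set w | cyl w `<=` U] then cyl i else set0) =
    \bigcup_n F n.
  apply/seteqP; split => x [w _ xw].
    by exists (pickle w) => //; rewrite /F pickleK.
  by move: xw; rewrite /F; case: unpickle => // v xv; exists v.
apply: sU => n; rewrite /F; case: unpickle => // w; case: ifPn => // _.
by apply: sub_gen_smallest; exists w.
Qed.

Lemma measurable_coordinates d (T : measurableType d) (D : set T)
    (h : T -> sequences) :
  (forall w, measurable (D `&` h @^-1` cyl w)) -> measurable_fun D h.
Proof.
move=> mh; apply: (measurability (range cyl)); first exact: sigma_algebra_cyl.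
by move=> _ [_ [w _ <-] <-].
Qed.

Lemma measurable_shift : measurable_fun [set: sequences] left_shift.
Proof.
apply: measurable_coordinates => w; rewrite setTI.
suff -> : left_shift @^-1` cyl w = \bigcup_i cyl (i :: w).
  by apply: bigcupT_measurable => i; exact: measurable_cyl.
apply/seteqP; split => [x /= xw|x [i _]].
  exists (x 0%N) => //; rewrite -cat1s; apply/cyl_catE; split => //.
by rewrite -cat1s => /cyl_catE [].
Qed.

Lemma measurable_iter_shift n : measurable_fun [set: sequences] (iter n left_shift).
Proof.
elim: n => [|n IH]; first exact: measurable_id.
rewrite (_ : iter n.+1 left_shift = left_shift \o iter n left_shift)//.
exact: measurableT_comp measurable_shift IH.
Qed.

End CylinderTopology.

(** * Approximation of Borel sets and comparison of measures *)

Section MeasuresOnSequences.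
Context {R : realType}.
Implicit Types (m : {measure set sequences -> \bar R}) (E A B : set sequences).

Lemma measure_pushforward d d' (T1 : measurableType d) (T2 : measurableType d')
    (m : {measure set T1 -> \bar R}) (h : T1 -> T2) : measurable_fun setT h ->
  exists m' : {measure set T2 -> \bar R}, forall S, m' S = m (h @^-1` S).
Proof.
by move=> mh; exists (measure_function_pushforward__canonical__measure_function_Measure m mh).
Qed.

Lemma measure_restr d (T : measurableType d) (m : {measure set T -> \bar R}) D :
  measurable D ->
  exists m' : {measure set T -> \bar R}, forall S, m' S = m (S `&` D).
Proof. by move=> mD; exists (mrestr m mD). Qed.

Definition prefix_determined n E :=
  forall x y : sequences, (forall i, (i < n)%N -> x i = y i) -> E x -> E y.

Lemma prefix_determined_measurable n E : prefix_determined n E -> measurable E.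
Proof.
move=> dE; apply: measurable_open; rewrite openE => x Ex.
apply: (@filterS _ _ _ (cyl (mkseq x n))).
  move=> y /cylP yx; apply: dE Ex => i ni.
  by rewrite yx ?size_mkseq// nth_mkseq.
by apply: open_nbhs_nbhs; split; [exact: open_cyl|exact: cyl_mkseq].
Qed.

Lemma measure_rcons m E w : measurable E ->
  (\sum_(i <oo) m (E `&` cyl (rcons w i)) = m (E `&` cyl w))%E.
Proof.
move=> mE; rewrite [X in _ = m X](_ : _ = \bigcup_i (E `&` cyl (rcons w i))).
  rewrite measure_bigcup//=.
  - by apply: eq_eseriesl => i; rewrite in_setT.
  - by move=> i _; apply: measurableI => //; exact: measurable_cyl.
  apply/trivIsetP => i j _ _ ij; apply/seteqP; split => // x [[_ +] [_ +]].
  rewrite -!cats1 => /cyl_catE [_ /cylP h1] /cyl_catE [_ /cylP h2].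
  by have := h1 0%N erefl; rewrite h2//= => ji; rewrite ji eqxx in ij.
apply/seteqP; split => [x [Ex xw]|x [i _ [Ex]]].
  exists (iter (size w) left_shift x 0%N) => //; split => //.
  by rewrite -cats1; apply/cyl_catE; split => //.
by rewrite -cats1 => /cyl_catE [].
Qed.

Lemma measure_wsum m n E : measurable E ->
  m E = wsum n (fun w => m (E `&` cyl w)).
Proof.
move=> mE; elim: n => [|n IH]; first by rewrite /= cyl_nil setIT.
rewrite -addn1 wsum_cat IH; apply: eq_wsum => w _ /=.
by rewrite -measure_rcons//; apply: eq_eseriesr => i _; rewrite cats1.
Qed.

Lemma le_measure_prefix_determined m1 m2 n E :
  (forall w, (m1 (cyl w) <= m2 (cyl w))%E) -> prefix_determined n E ->
  (m1 E <= m2 E)%E.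
Proof.
move=> m12 dE; have mE := prefix_determined_measurable dE.
rewrite (measure_wsum m1 n mE) (measure_wsum m2 n mE).
apply: le_wsum => // w sw.
have [[x [Ex xw]]|nE] := pselect ((E `&` cyl w) !=set0).
  rewrite (_ : E `&` cyl w = cyl w)//; apply/setIidPr => y yw.
  by apply: dE Ex => i; rewrite -sw => iw; move/cylP : xw => ->//; move/cylP : yw => ->.
by rewrite (_ : E `&` cyl w = set0) ?measure0//; apply/seteqP; split => // x Ex; apply: nE; exists x.
Qed.

(** Such a set is a union of cells of a finite partition: only [K.+1] values of each of the first
    [r] coordinates are distinguished. *)
Definition truncation_determined r K E := forall x y : sequences,
  (forall i, (i < r)%N -> minn (x i) K = minn (y i) K) -> E x -> E y.

Lemma truncation_determined_prefix r K E :
  truncation_determined r K E -> prefix_determined r E.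
Proof. by move=> dE x y xy; apply: dE => i ir; rewrite xy. Qed.

Lemma truncation_determinedW r r' K K' E : (r <= r')%N -> (K <= K')%N ->
  truncation_determined r K E -> truncation_determined r' K' E.
Proof.
move=> rr KK dE x y xy; apply: dE => i ir.
have := xy i (leq_trans ir rr); lia.
Qed.

Definition symdiff A B := (A `\` B) `|` (B `\` A).

Lemma measurable_symdiff A B : measurable A -> measurable B ->
  measurable (symdiff A B).
Proof. by move=> mA mB; apply: measurableU; exact: measurableD. Qed.

Let approx m E := forall e : R, 0 < e -> exists r K E',
  truncation_determined r K E' /\ (m (symdiff E E') < e%:E)%E.

Let approxC m E : approx m E -> approx m (~` E).
Proof.
move=> aE e e0; have [r [K [E' [dE' mE']]]] := aE e e0.
exists r, K, (~` E'); split.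
  by move=> x y xy nE' Ey; apply: nE'; apply: dE' Ey => i ir; rewrite xy.
rewrite (_ : symdiff _ _ = symdiff E E')//.
apply/seteqP; split => x; rewrite /symdiff /setD/=;
  case: (pselect (E x)); case: (pselect (E' x)); tauto.
Qed.

Let approxU m A B : measurable A -> measurable B ->
  approx m A -> approx m B -> approx m (A `|` B).
Proof.
move=> mA mB aA aB e e0.
have e20 : 0 < e / 2 by lra.
have [r [K [A' [dA mAA]]]] := aA _ e20.
have [s [L [B' [dB mBB]]]] := aB _ e20.
have {}dA : truncation_determined (maxn r s) (maxn K L) A'.
  by apply: truncation_determinedW dA; rewrite leq_maxl.
have {}dB : truncation_determined (maxn r s) (maxn K L) B'.
  by apply: truncation_determinedW dB; rewrite leq_maxr.
have mA' := prefix_determined_measurable (truncation_determined_prefix dA).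
have mB' := prefix_determined_measurable (truncation_determined_prefix dB).
exists (maxn r s), (maxn K L), (A' `|` B'); split.
  by move=> x y xy [/(dA _ _ xy)|/(dB _ _ xy)]; [left|right].
apply: (@le_lt_trans _ _ (m (symdiff A A' `|` symdiff B B'))).
  apply: le_measure; rewrite ?inE.
  - by apply: measurable_symdiff; exact: measurableU.
  - by apply: measurableU; exact: measurable_symdiff.
  - move=> x; rewrite /symdiff /setD/=.
    by case: (pselect (A x)); case: (pselect (B x)); case: (pselect (A' x));
      case: (pselect (B' x)); tauto.
apply: (@le_lt_trans _ _ (m (symdiff A A') + m (symdiff B B'))%E).
  by apply: measureU2; exact: measurable_symdiff.
by rewrite (splitr e) EFinD; exact: lteD.
Qed.

(** The approximable sets form a sigma-algebra containing the cylinders. Countable unions reduce to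
    finite ones by continuity from below, where finiteness of [m] is used. *)
Lemma truncation_determined_approx m E : (m setT < +oo)%E -> measurable E ->
  forall e : R, 0 < e -> exists r K E',
    truncation_determined r K E' /\ (m (symdiff E E') < e%:E)%E.
Proof.
move=> mT mE; suff [] : measurable E /\ approx m E by [].
have app0 : approx m set0.
  move=> e e0; exists 0%N, 0%N, set0; split => //.
  by rewrite /symdiff setD0 setU0 measure0 lte_fin.
suff h : <<s range cyl >> `<=` [set E | measurable E /\ approx m E].
  by apply: h; rewrite -sigma_algebra_cyl.
apply: smallest_sub; last first.
  move=> _ [w _ <-]; split; first exact: measurable_cyl.
  (* A truncation level above all letters of [w] loses nothing about belonging to the cylinder of
     [w]. *)
  move=> e e0; exists (size w), (\max_(i <- w) i).+1, (cyl w); split; last first.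
    by rewrite /symdiff setDv setU0 measure0 lte_fin.
  move=> x y xy /cylP xw; apply/cylP => i iw; rewrite -xw//.
  have := xy i iw; rewrite xw//.
  have : (nth 0%N w i <= \max_(i <- w) i)%N.
    by apply: leq_bigmax_seq => //; exact: mem_nth.
  lia.
split => [|A|F mF].
- by split.
- rewrite setTD => -[mA aA]; split; first exact: measurableC.
  exact: approxC.
have mF' i : measurable (F i) by case: (mF i).
split; first exact: bigcupT_measurable.
pose G n := \big[setU/set0]_(i < n) F i.
have mG n : measurable (G n) by exact: bigsetU_measurable.
have aG n : approx m (G n).
  elim: n => [|n IH]; first by rewrite /G big_ord0.
  by rewrite /G big_ord_recr/= -/(G n); apply: approxU => //; case: (mF n).
have FG : \bigcup_i F i = \bigcup_n G n.
  apply/seteqP; split => [x [i _ Fi]|x [n _]].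
    by exists i.+1 => //; rewrite /G big_ord_recr; right.
  by rewrite /G -bigcup_mkord => -[i _ Fi]; exists i.
have cG : (m \o G) n @[n --> \oo] --> m (\bigcup_n G n).
  apply: nondecreasing_cvg_mu => //; first exact: bigcupT_measurable.
  by apply/nondecreasing_seqP => n; apply/subsetPset; rewrite /G big_ord_recr/=; exact: subsetUl.
have fin B : measurable B -> m B \is a fin_num.
  move=> mB; rewrite ge0_fin_numE// (le_lt_trans _ mT)//.
  by apply: le_measure; rewrite ?inE.
move=> e e0; have e20 : 0 < e / 2 by lra.
have mU : measurable (\bigcup_n G n) by exact: bigcupT_measurable.
have [n nG] : exists n, (m (\bigcup_n G n `\` G n) < (e / 2)%:E)%E.
  have : \forall n \near \oo, (m (\bigcup_n G n) - (e / 2)%:E < m (G n))%E.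
    have : (m (\bigcup_n G n) - (e / 2)%:E < m (\bigcup_n G n))%E.
      by rewrite lteBlDr// lteDl ?fin// lte_fin.
    by move=> /open_ereal_gt' /cG.
  move=> [n _ /(_ n (leqnn n))]/= hn; exists n.
  rewrite measureD//; last by rewrite ltey_eq fin.
  rewrite (_ : _ `&` G n = G n); last by apply/setIidPr; exact: bigcup_sup.
  by rewrite lteBlDr ?fin// addeC -lteBlDr.
have [r [K [E' [dE' mE']]]] := aG n _ e20.
exists r, K, E'; split => //; rewrite FG.
have mE'' := prefix_determined_measurable (truncation_determined_prefix dE').
apply: (@le_lt_trans _ _ (m ((\bigcup_n G n `\` G n) `|` symdiff (G n) E'))).
  apply: le_measure; rewrite ?inE.
  - exact: measurable_symdiff.
  - by apply: measurableU; [exact: measurableD|exact: measurable_symdiff].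
  - move=> x; rewrite /symdiff /setD/=.
    have : G n x -> (\bigcup_n G n) x by exists n.
    case: (pselect (G n x)); tauto.
apply: (@le_lt_trans _ _ (m (\bigcup_n G n `\` G n) + m (symdiff (G n) E'))%E).
  by apply: measureU2; [exact: measurableD|exact: measurable_symdiff].
by rewrite (splitr e) EFinD; exact: lteD.
Qed.

(** [E] is approximated for [m1 + m2], so with a single set [E'] for both measures; on [E'],
    determined by a prefix, the inequality is a sum over cylinders. *)
Lemma le_measure_cyl m1 m2 : (m1 setT < +oo)%E -> (m2 setT < +oo)%E ->
  (forall w, (m1 (cyl w) <= m2 (cyl w))%E) ->
  forall E, measurable E -> (m1 E <= m2 E)%E.
Proof.
move=> m1T m2T m12 E mE; apply/lee_addgt0Pr => e e0.
have e20 : 0 < e / 2 by lra.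
have mT : (measure_add m1 m2 setT < +oo)%E by rewrite measure_addE lte_add_pinfty.
have [r [K [E' [dE' mEE']]]] := truncation_determined_approx mT mE e20.
have mE' := prefix_determined_measurable (truncation_determined_prefix dE').
have {}mEE' : (m1 (symdiff E E') + m2 (symdiff E E') < (e / 2)%:E)%E.
  by rewrite -measure_addE.
have m1E : (m1 E <= m1 E' + m1 (symdiff E E'))%E.
  apply: (@le_trans _ _ (m1 (E' `|` symdiff E E'))).
    apply: le_measure; rewrite ?inE//.
      by apply: measurableU => //; exact: measurable_symdiff.
    by move=> x; rewrite /symdiff /setD/=; case: (pselect (E x)); case: (pselect (E' x)); tauto.
  by apply: measureU2 => //; exact: measurable_symdiff.
have m2E : (m2 E' <= m2 E + m2 (symdiff E E'))%E.
  apply: (@le_trans _ _ (m2 (E `|` symdiff E E'))).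
    apply: le_measure; rewrite ?inE//.
      by apply: measurableU => //; exact: measurable_symdiff.
    by move=> x; rewrite /symdiff /setD/=; case: (pselect (E x)); case: (pselect (E' x)); tauto.
  by apply: measureU2 => //; exact: measurable_symdiff.
apply: (le_trans m1E); apply: (@le_trans _ _ (m2 E' + m1 (symdiff E E'))%E).
  by rewrite leeD2r// (le_measure_prefix_determined m12 (truncation_determined_prefix dE')).
apply: (@le_trans _ _ (m2 E + m2 (symdiff E E') + m1 (symdiff E E'))%E).
  by rewrite leeD2r.
rewrite -addeA leeD2l// addeC (le_trans (ltW mEE'))// lee_fin; lra.
Qed.

End MeasuresOnSequences.

(** * A measure with prescribed cylinder masses *)

Section MeasureFromWeights.
Context {R : realType}.
Variable p : seq nat -> R.
Hypothesis p_ge0 : forall w, 0 <= p w.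
Hypothesis p_nil : p [::] = 1.
Hypothesis p_rcons : forall w, (\sum_(i <oo) (p (rcons w i))%:E = (p w)%:E)%E.

Let s w n := \sum_(0 <= j < n) p (rcons w j).

(* [0, 1[ is cut into consecutive intervals J w of lengths p w, refined letter by
   letter; lor computes left endpoints of words read backwards. The measure is the
   law of the sequence coding a uniform point. *)
Let Fixpoint lor (v : seq nat) : R :=
  if v is i :: v' then lor v' + s (rev v') i else 0.

Let lo w := lor (rev w).

Let lo_rcons w i : lo (rcons w i) = lo w + s w i.
Proof. by rewrite /lo rev_rcons /= revK. Qed.

Let J w : set R := `[lo w, lo w + p w[%classic.

Let JE w x : J w x <-> lo w <= x < lo w + p w.
Proof. by rewrite /J /= in_itv. Qed.

Let sS w n : s w n.+1 = s w n + p (rcons w n).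
Proof. by rewrite /s big_nat_recr. Qed.

Let s_le w n m : (n <= m)%N -> s w n <= s w m.
Proof.
move=> nm; rewrite /s [leRHS](big_cat_nat (n := n))//= lerDl.
exact: sumr_ge0.
Qed.

Let s_le_p w n : s w n <= p w.
Proof.
rewrite -lee_fin -p_rcons /s -sumEFin.
by apply: nneseries_lim_ge => i _ _; rewrite lee_fin.
Qed.

Let J_rcons w i : J (rcons w i) `<=` J w.
Proof.
move=> x /JE; rewrite lo_rcons => /andP[h1 h2]; apply/JE.
have s0 : 0 <= s w i by apply: sumr_ge0.
have := s_le_p w i.+1; rewrite sS => h3; apply/andP; split; lra.
Qed.

Let J_rcons_inj w i j x : J (rcons w i) x -> J (rcons w j) x -> i = j.
Proof.
wlog ij : i j / (i < j)%N.
  by move=> H h1 h2; have [h|h|//] := ltngtP i j; [|apply/esym]; exact: H.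
move=> /JE /andP[_ h1] /JE /andP[h2 _].
move: h1 h2; rewrite !lo_rcons => h1 h2.
by have := s_le w ij; rewrite sS => h; exfalso; lra.
Qed.

(** The right endpoints of the subintervals tend to that of [J w], because the weights of the
    extensions add up to [p w]; the first endpoint beyond [x] designates the letter. *)
Let J_rcons_ex w x : J w x -> exists i, J (rcons w i) x.
Proof.
move=> /JE /andP[h1 h2].
have exn : exists n, x < lo w + s w n.
  apply/not_existsP => H.
  suff : ((p w)%:E <= (x - lo w)%:E)%E by rewrite lee_fin; lra.
  rewrite -p_rcons; apply: lime_le.
    by apply: is_cvg_nneseries => i _ _; rewrite lee_fin.
  apply: nearW => n; rewrite sumEFin lee_fin -/(s w n).
  by have /negP := H n; rewrite -leNgt; lra.
case: (ex_minnP exn) => -[|n] hn hmin.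
  by move: hn; rewrite /s big_nil; lra.
exists n; apply/JE; rewrite lo_rcons -addrA -sS hn andbT leNgt.
by apply/negP => /hmin; rewrite ltnn.
Qed.

Let Fixpoint codew (x : R) n : seq nat :=
  if n is m.+1 then
    rcons (codew x m) (xget 0%N [set i | J (rcons (codew x m) i) x])
  else [::].

(** The constant default outside [0, 1[ only makes the map total: Lebesgue measure gets restricted
    to [0, 1[ before being pushed forward. *)
Let code (x : R) : sequences := if 0 <= x < 1 then
  (fun n => xget 0%N [set i | J (rcons (codew x n) i) x]) else (fun=> 0%N).

Let codeE x n : 0 <= x < 1 -> mkseq (code x) n = codew x n.
Proof.
move=> x01; elim: n => [//|n IH]; rewrite mkseqS IH /=.
by rewrite /code x01.
Qed.

Let J_codew x n : 0 <= x < 1 -> J (codew x n) x.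
Proof.
move=> x01; elim: n => [|n IH]; first by apply/JE; rewrite /lo/= p_nil add0r.
by rewrite /=; case: xgetP => // H; have [i /H] := J_rcons_ex IH.
Qed.

Let codewE x w : 0 <= x < 1 -> (codew x (size w) = w) <-> J w x.
Proof.
move=> x01; split => [<-|]; first exact: J_codew.
elim/last_ind: w => [//|w i IH]; rewrite size_rcons /= => Jx.
rewrite IH; last exact: J_rcons Jx.
congr rcons; case: xgetP => [j _ /J_rcons_inj|/(_ i)//]; exact.
Qed.

Let J01 w x : J w x -> 0 <= x < 1.
Proof.
elim/last_ind: w => [|w i IH]; last by move=> /J_rcons.
by move/JE; rewrite /lo/= p_nil add0r.
Qed.

Let code_cyl w : code @^-1` cyl w =
  J w `|` (if pselect (cyl w (fun=> 0%N)) then ~` `[0, 1[%classic else set0).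
Proof.
have in01 x : `[0, 1[%classic x <-> 0 <= x < 1 by rewrite /= in_itv.
apply/seteqP; split => x.
  rewrite /cyl /=; have [x01|x01] := boolP (0 <= x < 1).
    by rewrite codeE// => /codewE h; left; exact: h.
  rewrite /code (negbTE x01) => h; right; case: pselect => //= ?.
  by rewrite in_itv/=; exact/negP.
case=> [Jx|]; first by have x01 := J01 Jx; rewrite /cyl/= codeE//; exact/codewE.
case: pselect => //= c0; rewrite in_itv/= => /negP x01.
by rewrite /code (negbTE x01).
Qed.

Let measurable_code : measurable_fun [set: measurableTypeR R] code.
Proof.
apply: measurable_coordinates => w; rewrite setTI code_cyl.
apply: measurableU; first exact: measurable_itv.
case: pselect => ? /=; last exact: measurable0.
by apply: measurableC; exact: measurable_itv.
Qed.

Lemma measure_from_weights :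
  exists mu : probability sequences R, forall w, mu (cyl w) = (p w)%:E.
Proof.
have mI : @measurable _ (measurableTypeR R) `[0, 1[%classic by exact: measurable_itv.
have [m0 m0E] := measure_restr (@lebesgue_measure R) mI.
have [m mE] := measure_pushforward m0 measurable_code.
have mcyl w : m (cyl w) = (p w)%:E.
  rewrite mE m0E code_cyl setIUl (_ : _ `&` _ = J w); last first.
    by apply/setIidPl => x /J01; rewrite /= in_itv.
  rewrite (_ : (if _ then _ else _) `&` _ = set0); last first.
    by case: pselect => ? /=; rewrite ?setICl ?set0I.
  rewrite setU0; apply: (etrans (lebesgue_measure_itv `[lo w, lo w + p w[)).
  rewrite /= lte_fin ltrDl.
  case: ltP => [_|p0]; first by rewrite -EFinB addrAC subrr add0r.
  by congr EFin; apply/esym/le_anti; rewrite p0 p_ge0.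
have mT : m setT = 1%E by rewrite -cyl_nil mcyl p_nil.
(* The mass of [m] is already 1; normalization serves to package it as a probability. *)
exists (mnormalize m (dirac point)) => w.
rewrite -mcyl.
suff : mnormalize m (dirac point) (cyl w) = m (cyl w) by [].
by rewrite /mnormalize mT/= onee_eq0/= invr1 mule1.
Qed.

End MeasureFromWeights.

(** * Entropy *)

Section EntropyFunction.
Context {R : realType}.
Implicit Types a b t : R.

Definition nxln t : R := - (t * ln t).

Lemma nxln0 : nxln 0 = 0. Proof. by rewrite /nxln mul0r oppr0. Qed.
Lemma nxln1 : nxln 1 = 0. Proof. by rewrite /nxln ln1 mulr0 oppr0. Qed.

Lemma nxln_ge0 t : 0 <= t -> t <= 1 -> 0 <= nxln t.
Proof. by move=> t0 t1; rewrite /nxln -mulrN mulr_ge0// oppr_ge0 ln_le0. Qed.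

Lemma ln_le_subr1 t : 0 < t -> ln t <= t - 1.
Proof.
move=> t0; have -> : ln t = ln (1 + (t - 1)) by congr ln; ring.
by apply: le_ln1Dx; lra.
Qed.

Lemma mul_ln_div_le a b : 0 < a -> 0 < b -> a * (ln b - ln a) <= b - a.
Proof.
move=> a0 b0; rewrite -ln_div ?posrE//.
have : a * ln (b / a) <= a * (b / a - 1).
  by rewrite ler_pM2l// ln_le_subr1// divr_gt0.
by rewrite mulrBr mulrCA divff ?gt_eqF// !mulr1.
Qed.

Lemma nxln_sub_le a b : 0 <= a -> a <= b -> b <= 1 -> nxln a - nxln b <= b - a.
Proof.
move=> a0 ab b1; have [a_gt0|a_le0] := ltP 0 a; last first.
  have -> : a = 0 by lra.
  by rewrite nxln0 sub0r subr0; have := nxln_ge0 (le_trans a0 ab) b1; lra.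
have b_gt0 : 0 < b by lra.
have := mul_ln_div_le a_gt0 b_gt0.
have : (b - a) * ln b <= 0 by rewrite mulr_ge0_le0 ?subr_ge0// ln_le0.
by rewrite /nxln; lra.
Qed.

Lemma nxln_add_le a b : 0 <= a -> 0 <= b -> nxln (a + b) <= nxln a + nxln b.
Proof.
move=> a0 b0; have [a_gt0|a_le0] := ltP 0 a; last first.
  have -> : a = 0 by lra.
  by rewrite nxln0 !add0r.
have [b_gt0|b_le0] := ltP 0 b; last first.
  have -> : b = 0 by lra.
  by rewrite nxln0 !addr0.
have h1 : a * ln a <= a * ln (a + b).
  by rewrite ler_pM2l// ler_ln ?posrE ?addr_gt0// lerDl.
have h2 : b * ln b <= b * ln (a + b).
  by rewrite ler_pM2l// ler_ln ?posrE ?addr_gt0// lerDr.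
by rewrite /nxln mulrDl; lra.
Qed.

Lemma nxln_sum_le (I : Type) (s : seq I) (F : I -> R) : (forall i, 0 <= F i) ->
  nxln (\sum_(i <- s) F i) <= \sum_(i <- s) nxln (F i).
Proof.
move=> F0; elim: s => [|i s IH]; first by rewrite !big_nil nxln0.
by rewrite !big_cons (le_trans (nxln_add_le _ _))// ?sumr_ge0// lerD2l.
Qed.

(** With [s] the square root of [t], [nxln t = 2 * s * nxln s], and [nxln s <= 1 - s <= 1]. *)
Lemma nxln_le_sqrt t : 0 <= t -> t <= 1 -> nxln t <= 2 * Num.sqrt t.
Proof.
move=> t0 t1; have [t_gt0|t_le0] := ltP 0 t; last first.
  by have -> : t = 0 by [lra]; rewrite nxln0 sqrtr0 mulr0.
set s := Num.sqrt t; have s0 : 0 < s by rewrite sqrtr_gt0.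
have ts : t = s * s by rewrite -expr2 sqr_sqrtr.
have := @mul_ln_div_le s 1 s0 ltr01; rewrite ln1 sub0r => h.
have s1 : s <= 1 by rewrite -sqrtr1 ler_wsqrtr.
have h' : s * (s * - ln s) <= s * (1 - s) by rewrite ler_pM2l.
have h2 : 0 <= s * s by rewrite mulr_ge0// ltW.
rewrite /nxln ts lnM ?posrE//; lra.
Qed.

(** Mutual information is nonnegative: [f] is compared with the product of its marginals divided by
    the total mass. The mass is left arbitrary, so that the inequality applies inside each cell of a
    third variable. *)
Lemma nxln_marginals (A B : finType) (f : A -> B -> R) : (forall x y, 0 <= f x y) ->
  \sum_x \sum_y nxln (f x y) + nxln (\sum_x \sum_y f x y) <=
  \sum_x nxln (\sum_y f x y) + \sum_y nxln (\sum_x f x y).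
Proof.
move=> f0; pose c := \sum_x \sum_y f x y.
pose a x := \sum_y f x y; pose b y := \sum_x f x y.
have ca : c = \sum_x a x by [].
have cb : c = \sum_y b y by rewrite /c exchange_big.
have a0 x : 0 <= a x by exact: sumr_ge0.
have b0 y : 0 <= b y by exact: sumr_ge0.
have c0 : 0 <= c by rewrite ca sumr_ge0.
have fa x y : f x y <= a x by rewrite /a (bigD1 y)//= lerDl sumr_ge0.
have fb x y : f x y <= b y by rewrite /b (bigD1 x)//= lerDl sumr_ge0.
have ac x : a x <= c by rewrite ca (bigD1 x)//= lerDl sumr_ge0.
have key x y : f x y * (ln (a x) + ln (b y) - ln c - ln (f x y)) <=
    a x * b y / c - f x y.
  have [f_gt0|f_le0] := ltP 0 (f x y); last first.
    have -> : f x y = 0 by have := f0 x y; lra.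
    by rewrite mul0r subr0 divr_ge0// mulr_ge0.
  have a_gt0 : 0 < a x by exact: lt_le_trans (fa x y).
  have b_gt0 : 0 < b y by exact: lt_le_trans (fb x y).
  have c_gt0 : 0 < c by exact: lt_le_trans (ac x).
  have abc : 0 < a x * b y / c by rewrite divr_gt0// mulr_gt0.
  have := mul_ln_div_le f_gt0 abc.
  by rewrite ln_div ?posrE ?mulr_gt0// lnM ?posrE.
have tot : \sum_x \sum_y (a x * b y / c - f x y) <= 0.
  under eq_bigr do rewrite sumrB -mulr_suml -mulr_sumr -cb.
  rewrite sumrB -mulr_suml -mulr_suml -ca -/c.
  have [c_gt0|c_le0] := ltP 0 c; first by rewrite mulfK ?gt_eqF// subrr.
  have -> : c = 0 by lra.
  by rewrite !mul0r subrr.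
have sum_a : \sum_x nxln (a x) = - \sum_x \sum_y f x y * ln (a x).
  rewrite -sumrN; apply: eq_bigr => x _.
  by rewrite /nxln -mulr_suml.
have sum_b : \sum_y nxln (b y) = - \sum_x \sum_y f x y * ln (b y).
  rewrite exchange_big -sumrN; apply: eq_bigr => y _.
  by rewrite /nxln -mulr_suml.
have sum_c : nxln c = - \sum_x \sum_y f x y * ln c.
  rewrite /nxln {1}/c; congr (- _); rewrite mulr_suml; apply: eq_bigr => x _.
  by rewrite mulr_suml.
have sum_f : \sum_x \sum_y nxln (f x y) = - \sum_x \sum_y f x y * ln (f x y).
  by rewrite -sumrN; apply: eq_bigr => x _; rewrite -sumrN.
rewrite -/c sum_a sum_b sum_c sum_f.
have : \sum_x \sum_y f x y * (ln (a x) + ln (b y) - ln c - ln (f x y)) <= 0.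
  by apply: le_trans tot; apply: ler_sum => x _; apply: ler_sum.
under eq_bigr do under eq_bigr do rewrite !mulrBr mulrDr.
under eq_bigr do rewrite !sumrB big_split.
by rewrite !sumrB big_split/=; lra.
Qed.

End EntropyFunction.

Lemma cvg_natr_inv {R : realType} : (n%:R^-1 : R) @[n --> \oo] --> 0.
Proof. by rewrite -cvg_shiftS; exact: cvg_harmonic. Qed.

Lemma fekete {R : realType} (a : nat -> R) (c : R) :
  (forall n m, a (n + m)%N <= a n + a m) ->
  (forall n, - (n%:R * c) <= a n) ->
  exists2 l, (n%:R^-1 * a n) @[n --> \oo] --> l &
    forall n, (0 < n)%N -> l <= n%:R^-1 * a n.
Proof.
move=> asub alb.
pose A := [set r | exists2 n, (0 < n)%N & r = n%:R^-1 * a n].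
have A0 : A !=set0 by exists (1%:R^-1 * a 1%N); exists 1%N.
have lbA : lbound A (- c).
  move=> _ [n n0 ->]; rewrite ler_pdivlMl ?ltr0n//.
  by rewrite mulrN.
have hA : has_inf A by split => //; exists (- c).
have infle n : (0 < n)%N -> inf A <= n%:R^-1 * a n.
  by move=> n0; apply: ge_inf; [exists (- c)|exists n].
exists (inf A) => //.
apply/cvgrPdist_le => e e0.
have e20 : 0 < e / 2 by lra.
have [_ [m m0 ->] hm] := inf_adherent e20 hA.
(* Euclidean division of [n] by [m] leaves three errors: a fraction of [a m], the value [a 0] from
   an empty quotient, and [a r] at the remainder. *)
pose B := `|a m| + (`|a 0%N| + \sum_(r < m) `|a r|).
have B0 : 0 <= B by rewrite addr_ge0// addr_ge0// sumr_ge0.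
have mul q : a (q * m)%N <= q%:R * a m + `|a 0%N|.
  elim: q => [|q IH]; first by rewrite mul0n mul0r add0r ler_norm.
  rewrite mulSn (le_trans (asub _ _))// -natr1 mulrDl mul1r -addrA [leRHS]addrCA.
  by rewrite lerD2l.
have upper n : a n <= n%:R * (m%:R^-1 * a m) + B.
  have mR : 0 < m%:R :> R by rewrite ltr0n.
  pose q := (n %/ m)%N; pose r := (n %% m)%N.
  have rm : (r < m)%N by rewrite ltn_mod.
  have nE : n = (q * m + r)%N by exact: divn_eq.
  have ar : `|a r| <= \sum_(r < m) `|a r|.
    by rewrite (bigD1 (Ordinal rm))//= lerDl sumr_ge0.
  have h1 : a n <= q%:R * a m + `|a 0%N| + `|a r|.
    by rewrite {1}nE (le_trans (asub _ _))// lerD// ler_norm.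
  have h2 : q%:R * a m <= n%:R * (m%:R^-1 * a m) + `|a m|.
    have -> : n%:R * (m%:R^-1 * a m) = q%:R * a m + (r%:R / m%:R) * a m.
      by rewrite nE natrD natrM; field; rewrite gt_eqF.
    rewrite -addrA lerDl.
    have r0 : 0 <= r%:R / m%:R :> R by rewrite divr_ge0.
    have r1 : r%:R / m%:R <= 1 :> R by rewrite ler_pdivrMr// mul1r ler_nat ltnW.
    have : `|r%:R / m%:R * a m| <= `|a m|.
      by rewrite normrM ger0_norm// ler_piMl.
    by rewrite ler_norml => /andP[h _]; lra.
  by rewrite /B; lra.
near=> n.
have n0 : (0 < n)%N by near: n; exists 1%N.
have nR : 0 < n%:R :> R by rewrite ltr0n.
have nB : B / (e / 2) <= n%:R by near: n; exact: nbhs_infty_ger.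
have h1 := infle n n0.
have h2 : n%:R^-1 * a n <= m%:R^-1 * a m + e / 2.
  rewrite ler_pdivrMl// mulrDr (le_trans (upper n))// lerD2l.
  by rewrite -ler_pdivrMr.
by rewrite ler_norml; apply/andP; split; lra.
Unshelve. all: by end_near. Qed.

(** * Shannon entropy of finite-valued variables *)

Section FiniteVariables.
Context d (T : measurableType d) (R : realType) (mu : probability T R).

Definition pr (E : set T) : R := fine (mu E).

Lemma prE E : measurable E -> (pr E)%:E = mu E.
Proof.
move=> mE; rewrite /pr fineK// ge0_fin_numE// (le_lt_trans (probability_le1 _ _))//.
exact: ltry.
Qed.

Lemma pr_ge0 E : 0 <= pr E. Proof. exact: fine_ge0. Qed.

Lemma pr_le1 E : measurable E -> pr E <= 1.
Proof. by move=> mE; rewrite -lee_fin prE// probability_le1. Qed.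

Lemma pr_set0 : pr set0 = 0. Proof. by rewrite /pr measure0. Qed.

Lemma pr_le E F : measurable E -> measurable F -> E `<=` F -> pr E <= pr F.
Proof. by move=> mE mF EF; rewrite -lee_fin !prE// le_measure ?inE. Qed.

Definition labelling (A : finType) (X : T -> A) := forall a, measurable (X @^-1` [set a]).

Definition fin_entropy (A : finType) (X : T -> A) : R :=
  \sum_(a : A) nxln (pr (X @^-1` [set a])).

Definition joint (A B : finType) (X : T -> A) (Y : T -> B) t := (X t, Y t).

Lemma joint_preimage (A B : finType) (X : T -> A) (Y : T -> B) a b :
  joint X Y @^-1` [set (a, b)] = X @^-1` [set a] `&` Y @^-1` [set b].
Proof.
by apply/seteqP; split => t; rewrite /joint /= => -[-> ->].
Qed.

Lemma labelling_joint (A B : finType) (X : T -> A) (Y : T -> B) :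
  labelling X -> labelling Y -> labelling (joint X Y).
Proof. by move=> mX mY [a b]; rewrite joint_preimage; exact: measurableI. Qed.

Lemma measurable_label_mem (A : finType) (Y : T -> A) (P : pred A) :
  labelling Y -> measurable [set t | P (Y t)].
Proof.
move=> mY; rewrite (_ : [set t | _] = \bigcup_(b in [set b | P b]) Y @^-1` [set b]).
  by apply: fin_bigcup_measurable.
by apply/seteqP; split => [t Pt|t [b Pb /= ->]//]; exists (Y t).
Qed.

Lemma pr_marginal (A : finType) (Y : T -> A) E : measurable E -> labelling Y ->
  pr E = \sum_(b : A) pr (E `&` Y @^-1` [set b]).
Proof.
move=> mE mY; apply: EFin_inj; rewrite prE// -sumEFin.
rewrite (eq_bigr (fun b => mu (E `&` Y @^-1` [set b]))); last first.
  by move=> b _; rewrite prE//; exact: measurableI.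
have -> : E = E `&` [set t | Y t \in index_enum A].
  by apply/seteqP; split => [t Et|t []//]; split => //=; exact: mem_index_enum.
rewrite (eq_bigr (fun b => mu (E `&` Y @^-1` [set b]))); last first.
  move=> b _; congr (mu _); apply/seteqP; split => [t [[Et _] Yt]|t [Et Yt]] //.
  by split => //; split => //=; exact: mem_index_enum.
elim: (index_enum A) (index_enum_uniq A) => [_|b s IH /= /andP[bs us]].
  rewrite big_nil (_ : _ `&` _ = set0) ?measure0//.
  by apply/seteqP; split => // t [].
rewrite big_cons -IH// -measureU.
- congr (mu _); apply/seteqP; split => t /=.
    rewrite in_cons => -[Et /orP[/eqP Yt|Yt]]; [left|right] => //.
  by case=> -[Et]; rewrite in_cons => Yt; split => //; rewrite ?Yt ?eqxx ?orbT.
- by apply: measurableI => //; exact: mY.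
- by apply: measurableI => //; exact: (@measurable_label_mem _ _ (mem s)).
- by apply/seteqP; split => // t [[_ /= Yb] [_ /=]]; rewrite Yb (negbTE bs).
Qed.

Lemma pr_labelling_sum (A : finType) (Y : T -> A) : labelling Y ->
  \sum_(b : A) pr (Y @^-1` [set b]) = 1.
Proof.
move=> mY; have := pr_marginal measurableT mY; rewrite {1}/pr probability_setT/= => ->.
by apply: eq_bigr => b _; rewrite setTI.
Qed.

Lemma fin_entropy_jointE (A B : finType) (X : T -> A) (Y : T -> B) :
  fin_entropy (joint X Y) =
  \sum_a \sum_b nxln (pr (X @^-1` [set a] `&` Y @^-1` [set b])).
Proof.
by rewrite pair_bigA /=; apply: eq_bigr => -[a b] _ /=; rewrite joint_preimage.
Qed.

Lemma fin_entropy_joint_le (A B : finType) (X : T -> A) (Y : T -> B) :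
  labelling X -> labelling Y -> fin_entropy X <= fin_entropy (joint X Y).
Proof.
move=> mX mY; rewrite fin_entropy_jointE.
apply: ler_sum => a _; rewrite (pr_marginal (mX a) mY).
by apply: nxln_sum_le => b; exact: pr_ge0.
Qed.

Lemma fin_entropy_joint_function (A B : finType) (X : T -> A) (Y : T -> B) :
  (forall s t, Y s = Y t -> X s = X t) ->
  fin_entropy (joint X Y) <= fin_entropy Y.
Proof.
move=> XY; rewrite fin_entropy_jointE exchange_big/=; apply: ler_sum => b _.
have [[t Yt]|nY] := pselect (exists t, Y t = b).
  rewrite (bigD1 (X t))//= big1 ?addr0; last first.
    move=> a aX; rewrite (_ : _ `&` _ = set0) ?pr_set0 ?nxln0//.
    apply/seteqP; split => // s [/= Xs Ys].
    by move: aX; rewrite -Xs (XY s t) ?Ys// eqxx.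
  rewrite (_ : _ `&` _ = Y @^-1` [set b])//.
  by apply/setIidPr => s /= Ys; apply: XY; rewrite Ys.
rewrite big1 => [|a _]; last first.
  rewrite (_ : _ `&` _ = set0) ?pr_set0 ?nxln0//.
  by apply/seteqP; split => // s [/= _ Ys]; apply: nY; exists s.
rewrite (_ : _ @^-1` _ = set0) ?pr_set0 ?nxln0//.
by apply/seteqP; split => // s /= Ys; apply: nY; exists s.
Qed.

Lemma fin_entropy_function (A B : finType) (X : T -> A) (Y : T -> B) :
  labelling X -> labelling Y -> (forall s t, Y s = Y t -> X s = X t) ->
  fin_entropy X <= fin_entropy Y.
Proof.
move=> mX mY XY; apply: le_trans (fin_entropy_joint_le mX mY) _.
exact: fin_entropy_joint_function.
Qed.

(** Strong subadditivity, obtained by applying [nxln_marginals] to the joint law of [X] and [Y] on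
    each cell of [Z] and summing over the cells. *)
Lemma fin_entropy_ssa (A B C : finType) (X : T -> A) (Y : T -> B) (Z : T -> C) :
  labelling X -> labelling Y -> labelling Z ->
  fin_entropy (joint (joint X Y) Z) + fin_entropy Z <=
  fin_entropy (joint X Z) + fin_entropy (joint Y Z).
Proof.
move=> mX mY mZ.
pose f c a b := pr ((X @^-1` [set a] `&` Y @^-1` [set b]) `&` Z @^-1` [set c]).
have mXZ a c : measurable (X @^-1` [set a] `&` Z @^-1` [set c]) by exact: measurableI.
have mYZ a c : measurable (Y @^-1` [set a] `&` Z @^-1` [set c]) by exact: measurableI.
have e1 : fin_entropy (joint (joint X Y) Z) = \sum_c \sum_a \sum_b nxln (f c a b).
  rewrite fin_entropy_jointE exchange_big; apply: eq_bigr => c _.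
  by rewrite pair_bigA; apply: eq_bigr => -[a b] _; rewrite joint_preimage.
have fa a c : \sum_b f c a b = pr (X @^-1` [set a] `&` Z @^-1` [set c]).
  rewrite (pr_marginal (mXZ a c) mY); apply: eq_bigr => b _.
  by rewrite /f setIAC.
have fb b c : \sum_a f c a b = pr (Y @^-1` [set b] `&` Z @^-1` [set c]).
  rewrite (pr_marginal (mYZ b c) mX); apply: eq_bigr => a _.
  by rewrite /f -setIA [in LHS]setIC.
have e2 : fin_entropy Z = \sum_c nxln (\sum_a \sum_b f c a b).
  apply: eq_bigr => c _; rewrite (pr_marginal (mZ c) mX); congr nxln.
  by apply: eq_bigr => a _; rewrite fa setIC.
have e3 : fin_entropy (joint X Z) = \sum_c \sum_a nxln (\sum_b f c a b).
  rewrite fin_entropy_jointE exchange_big.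
  by apply: eq_bigr => c _; apply: eq_bigr => a _; rewrite fa.
have e4 : fin_entropy (joint Y Z) = \sum_c \sum_b nxln (\sum_a f c a b).
  rewrite fin_entropy_jointE exchange_big.
  by apply: eq_bigr => c _; apply: eq_bigr => b _; rewrite fb.
rewrite e1 e2 e3 e4 -!big_split/=; apply: ler_sum => c _.
by apply: nxln_marginals => a b; exact: pr_ge0.
Qed.

Lemma fin_entropy_cond_le (A B C : finType) (X : T -> A) (Y : T -> B) (Z : T -> C) :
  labelling X -> labelling Y -> labelling Z -> (forall s t, Y s = Y t -> Z s = Z t) ->
  fin_entropy (joint X Y) - fin_entropy Y <= fin_entropy (joint X Z) - fin_entropy Z.
Proof.
move=> mX mY mZ YZ; have := fin_entropy_ssa mX mY mZ.
have : fin_entropy (joint X Y) <= fin_entropy (joint (joint X Y) Z).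
  by apply: fin_entropy_joint_le => //; exact: labelling_joint.
have : fin_entropy (joint Y Z) <= fin_entropy Y.
  apply: fin_entropy_function => //; first exact: labelling_joint.
  by move=> s t st; rewrite /joint st (YZ _ _ st).
by lra.
Qed.

Lemma fin_entropy_cst (A : finType) (X : T -> A) : (forall s t, X s = X t) ->
  fin_entropy X = 0.
Proof.
move=> X0; rewrite /fin_entropy big1// => a _.
have [[t Xt]|nX] := pselect (exists t, X t = a).
  rewrite (_ : _ @^-1` _ = setT); first by rewrite /pr probability_setT nxln1.
  by apply/seteqP; split => // s _ /=; rewrite (X0 s t).
rewrite (_ : _ @^-1` _ = set0) ?pr_set0 ?nxln0//.
by apply/seteqP; split => // s Xs; apply: nX; exists s.
Qed.

Lemma labelling_cst (A : finType) (X : T -> A) : (forall s t, X s = X t) -> labelling X.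
Proof.
move=> X0 a; have [[t Xt]|nX] := pselect (exists t, X t = a).
  rewrite (_ : _ @^-1` _ = setT)//.
  by apply/seteqP; split => // s _ /=; rewrite (X0 s t).
rewrite (_ : _ @^-1` _ = set0)//.
by apply/seteqP; split => // s Xs; apply: nX; exists s.
Qed.

Lemma fin_entropy_joint_subadd (A B : finType) (X : T -> A) (Y : T -> B) :
  labelling X -> labelling Y ->
  fin_entropy (joint X Y) <= fin_entropy X + fin_entropy Y.
Proof.
move=> mX mY; have mZ : labelling (fun=> tt) by exact: labelling_cst.
have := fin_entropy_cond_le mX mY mZ (fun _ _ _ => erefl).
rewrite (@fin_entropy_cst _ (fun=> tt))// subr0.
have : fin_entropy (joint X (fun=> tt)) <= fin_entropy X.
  by apply: fin_entropy_function => // [|s t st]; [exact: labelling_joint|rewrite /joint st].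
by lra.
Qed.

End FiniteVariables.

(** * Entropy of partitions under a measure-preserving map *)

Section MeasurePreserving.
Context d (T : measurableType d) (R : realType) (mu : probability T R) (S : T -> T).
Hypothesis mS : measurable_fun setT S.
Hypothesis muS : forall A, measurable A -> mu (S @^-1` A) = mu A.

Lemma measurable_preimage_iter n A : measurable A -> measurable (iter n S @^-1` A).
Proof.
move=> mA; elim: n => [//|n IH].
rewrite (_ : _ @^-1` A = S @^-1` (iter n S @^-1` A)); last first.
  by apply/seteqP; split => t; rewrite /preimage /= -iterSr.
by rewrite -[X in measurable X]setTI; exact: mS.
Qed.

Lemma mu_preimage_iter n A : measurable A -> mu (iter n S @^-1` A) = mu A.
Proof.
move=> mA; elim: n => [//|n IH].
rewrite (_ : _ @^-1` A = S @^-1` (iter n S @^-1` A)); last first.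
  by apply/seteqP; split => t; rewrite /preimage /= -iterSr.
by rewrite muS//; exact: measurable_preimage_iter.
Qed.

Definition itinerary (A : finType) (X : T -> A) n (t : T) : {ffun 'I_n -> A} :=
  [ffun i : 'I_n => X (iter i S t)].

Lemma itineraryP (A : finType) (X : T -> A) n s t :
  itinerary X n s = itinerary X n t <->
  forall i, (i < n)%N -> X (iter i S s) = X (iter i S t).
Proof.
split => [/ffunP st i ni|st].
  by have := st (Ordinal ni); rewrite !ffunE.
by apply/ffunP => i; rewrite !ffunE; exact: st.
Qed.

Lemma labelling_iter (A : finType) (X : T -> A) n :
  labelling X -> labelling (X \o iter n S).
Proof.
move=> mX a; rewrite (_ : _ @^-1` _ = iter n S @^-1` (X @^-1` [set a]))//.
exact: measurable_preimage_iter.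
Qed.

Lemma fin_entropy_iter (A : finType) (X : T -> A) n : labelling X ->
  fin_entropy mu (X \o iter n S) = fin_entropy mu X.
Proof.
move=> mX; apply: eq_bigr => a _; congr nxln; rewrite /pr.
rewrite (_ : _ @^-1` _ = iter n S @^-1` (X @^-1` [set a]))//.
by rewrite mu_preimage_iter.
Qed.

Lemma labelling_itinerary (A : finType) (X : T -> A) n :
  labelling X -> labelling (itinerary X n).
Proof.
move=> mX a; rewrite (_ : _ @^-1` _ = \bigcap_(i in [set: 'I_n])
    (X \o iter i S) @^-1` [set a i]).
  apply: fin_bigcap_measurable => // i _; exact: labelling_iter.
apply/seteqP; split => t /=; first by move=> <- i _; rewrite /= ffunE.
by move=> h; apply/ffunP => i; rewrite ffunE; exact: h.
Qed.

Lemma fin_entropy_itineraryD (A : finType) (X : T -> A) n m : labelling X ->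
  fin_entropy mu (itinerary X (n + m)) <=
  fin_entropy mu (itinerary X n) + fin_entropy mu (itinerary X m).
Proof.
move=> mX; have mI := labelling_itinerary.
rewrite -(fin_entropy_iter n (mI _ X m mX)).
apply: le_trans (fin_entropy_joint_subadd _ _ _) => //; last 2 first.
- exact: mI.
- by apply: labelling_iter; exact: mI.
apply: fin_entropy_function; first exact: mI.
  by apply: labelling_joint; [exact: mI|apply: labelling_iter; exact: mI].
move=> s t [/itineraryP h1 /itineraryP h2]; apply/itineraryP => i inm.
have [ni|ni] := ltnP i n; first exact: h1.
have := h2 (i - n)%N; rewrite ltn_subLR// => /(_ inm).
by rewrite -!iterD subnK.
Qed.

(** The chain rule: each further letter of the itinerary of [X] adds at most the entropy of [X]
    given [Y], since conditioning on the whole itinerary of [Y] is finer than conditioning on the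
    simultaneous letter. *)
Lemma fin_entropy_itinerary_cond (A B : finType) (X : T -> A) (Y : T -> B) n :
  labelling X -> labelling Y ->
  fin_entropy mu (joint (itinerary X n) (itinerary Y n)) <=
  fin_entropy mu (itinerary Y n) +
  n%:R * (fin_entropy mu (joint X Y) - fin_entropy mu Y).
Proof.
move=> mX mY; set c := _ - _; have mI := labelling_itinerary.
elim: n => [|n IH].
  rewrite mul0r addr0; apply: fin_entropy_function.
  - by apply: labelling_joint; exact: mI.
  - exact: mI.
  - by move=> s t _; rewrite /joint; congr pair; apply/itineraryP.
set Z := itinerary Y n.+1; have mZ : labelling Z by exact: mI.
pose Xn := X \o iter n S; have mXn : labelling Xn by exact: labelling_iter.
have h1 : fin_entropy mu (joint (itinerary X n.+1) Z) <=
    fin_entropy mu (joint (joint (itinerary X n) Xn) Z).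
  apply: fin_entropy_function.
  - by apply: labelling_joint => //; exact: mI.
  - by apply: labelling_joint => //; apply: labelling_joint => //; exact: mI.
  - move=> s t [/itineraryP h1 h2 h3]; rewrite /joint; congr pair; last exact: h3.
    apply/itineraryP => i.
    by rewrite ltnS leq_eqVlt => /orP[/eqP ->//|]; exact: h1.
have h2 := fin_entropy_ssa mu (mI _ X n mX) mXn mZ.
have h3 : fin_entropy mu (joint (itinerary X n) Z) - fin_entropy mu Z <=
    fin_entropy mu (joint (itinerary X n) (itinerary Y n)) - fin_entropy mu (itinerary Y n).
  apply: fin_entropy_cond_le => //; try exact: mI.
  by move=> s t /itineraryP h; apply/itineraryP => i ni; apply: h; rewrite ltnW.
have h4 : fin_entropy mu (joint Xn Z) - fin_entropy mu Z <= c.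
  have := @fin_entropy_cond_le _ _ _ mu _ _ _ Xn Z (Y \o iter n S) mXn mZ
    (labelling_iter n mY).
  rewrite (fin_entropy_iter n mY) -(_ : joint X Y \o iter n S = joint Xn (Y \o iter n S))//.
  rewrite (fin_entropy_iter n (labelling_joint mX mY)); apply.
  by move=> s t /itineraryP h; apply: h.
by rewrite -natr1 mulrDl mul1r; lra.
Qed.

Lemma join_entropyE k (xi : T -> 'I_k) n :
  join_entropy mu S xi n = fin_entropy mu (itinerary xi n).
Proof.
rewrite /join_entropy /fin_entropy -sumrN; apply: eq_bigr => w _.
rewrite (_ : join_cell S xi w = itinerary xi n @^-1` [set w])//.
apply/seteqP; split => t /=; first by move=> h; apply/ffunP => i; rewrite ffunE h.
by move=> <- i; rewrite ffunE.
Qed.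

Lemma fin_entropy_ge0 (A : finType) (X : T -> A) : labelling X -> 0 <= fin_entropy mu X.
Proof. by move=> mX; apply: sumr_ge0 => a _; rewrite nxln_ge0 ?pr_ge0 ?pr_le1. Qed.

Lemma partition_entropy_cvg k (xi : T -> 'I_k) : labelling xi ->
  (n%:R^-1 * fin_entropy mu (itinerary xi n)) @[n --> \oo] -->
    partition_entropy mu S xi /\
  forall n, (0 < n)%N ->
    partition_entropy mu S xi <= n%:R^-1 * fin_entropy mu (itinerary xi n).
Proof.
move=> mxi; have [l cl lle] := @fekete R (fun n => fin_entropy mu (itinerary xi n)) 0
  (fun n m => fin_entropy_itineraryD n m mxi)
  (fun n => ltac:(rewrite mulr0 oppr0; apply: fin_entropy_ge0; exact: labelling_itinerary)).
suff -> : partition_entropy mu S xi = l by [].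
apply/cvg_lim => //; apply: cvg_trans cl; apply: near_eq_cvg.
by apply: nearW => n; rewrite join_entropyE.
Qed.

(** The increment is the entropy of [xi] given the first [r] letters of [zeta]. Reading [n]
    successive blocks of [r] letters amounts to reading at most [n + r] letters, and the surplus
    [Hr] disappears after division by [n]. *)
Lemma partition_entropy_cond k l (xi : T -> 'I_k) (zeta : T -> 'I_l) r :
  labelling xi -> labelling zeta ->
  partition_entropy mu S xi <= partition_entropy mu S zeta +
    (fin_entropy mu (joint xi (itinerary zeta r)) - fin_entropy mu (itinerary zeta r)).
Proof.
move=> mxi mz; set c := _ - _; have mI := labelling_itinerary.
have mzr : labelling (itinerary zeta r) by exact: mI.
have [cxi _] := partition_entropy_cvg mxi; have [cz _] := partition_entropy_cvg mz.
set Hr := fin_entropy mu (itinerary zeta r).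
have key n : (0 < n)%N -> n%:R^-1 * fin_entropy mu (itinerary xi n) <=
    n%:R^-1 * fin_entropy mu (itinerary zeta n) + (n%:R^-1 * Hr + c).
  move=> n0.
  have h1 : fin_entropy mu (itinerary xi n) <=
      fin_entropy mu (joint (itinerary xi n) (itinerary (itinerary zeta r) n)).
    by apply: fin_entropy_joint_le; exact: mI.
  have h2 := fin_entropy_itinerary_cond n mxi mzr.
  have h3 : fin_entropy mu (itinerary (itinerary zeta r) n) <=
      fin_entropy mu (itinerary zeta (n + r)).
    apply: fin_entropy_function; [exact: mI|exact: mI|].
    move=> s t /itineraryP h; apply/itineraryP => i ni; apply/itineraryP => j jr.
    by rewrite -!iterD; apply: h; lia.
  have h4 := fin_entropy_itineraryD n r mz.
  have h5 : fin_entropy mu (itinerary xi n) <=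
      fin_entropy mu (itinerary zeta n) + Hr + n%:R * c.
    by apply: (le_trans h1); apply: (le_trans h2); rewrite /Hr /c; lra.
  rewrite [leRHS](_ : _ = n%:R^-1 * (fin_entropy mu (itinerary zeta n) + Hr + n%:R * c)).
    by rewrite ler_wpM2l.
  by field; rewrite pnatr_eq0 -lt0n.
have c0 : (n%:R^-1 * Hr + c) @[n --> \oo] --> c.
  rewrite -[X in _ --> X]add0r -(mul0r Hr); apply: cvgD; last exact: cvg_cst.
  by apply: cvgMl; exact: cvg_natr_inv.
have czc : (n%:R^-1 * fin_entropy mu (itinerary zeta n) + (n%:R^-1 * Hr + c))
    @[n --> \oo] --> partition_entropy mu S zeta + c by exact: cvgD cz c0.
apply: (ler_cvg_to cxi czc); near=> n; apply: key; near: n; exact: nbhs_infty_gt.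
Unshelve. all: by end_near. Qed.

(** Each off-diagonal cell contributes at most [2 * Num.sqrt e]. On the diagonal, replacing the mass
    of a cell of [Y] by its diagonal part costs at most the off-diagonal mass, hence one more
    [e <= Num.sqrt e] per cell. *)
Lemma fin_entropy_close (A : finType) (X Y : T -> A) (e : R) :
  labelling X -> labelling Y -> 0 <= e -> e <= 1 ->
  (forall a b, a != b -> pr mu (X @^-1` [set a] `&` Y @^-1` [set b]) <= e) ->
  fin_entropy mu (joint X Y) - fin_entropy mu Y <= 3 * #|A|%:R ^+ 2 * Num.sqrt e.
Proof.
move=> mX mY e0 e1 XYe; rewrite fin_entropy_jointE exchange_big/=.
pose P a b := pr mu (X @^-1` [set a] `&` Y @^-1` [set b]).
have mP a b : measurable (X @^-1` [set a] `&` Y @^-1` [set b]) by exact: measurableI.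
have P0 a b : 0 <= P a b by exact: pr_ge0.
have P1 a b : P a b <= 1 by exact: pr_le1.
have se : e <= Num.sqrt e.
  have s1 : Num.sqrt e <= 1 by rewrite -sqrtr1 ler_wsqrtr.
  by rewrite -{1}(sqr_sqrtr e0) expr2 ler_piMl// sqrtr_ge0.
have off a b : a != b -> nxln (P a b) <= 2 * Num.sqrt e.
  move=> ab; rewrite (le_trans (nxln_le_sqrt (P0 a b) (P1 a b)))//.
  by rewrite ler_pM2l// ler_wsqrtr// XYe.
rewrite /fin_entropy -sumrB.
have row b : \sum_a nxln (P a b) - nxln (pr mu (Y @^-1` [set b])) <=
    \sum_(a : A) 3 * Num.sqrt e.
  have Yb : pr mu (Y @^-1` [set b]) = \sum_a P a b.
    by rewrite (pr_marginal mu (mY b) mX); apply: eq_bigr => a _; rewrite setIC.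
  have Y1 : \sum_a P a b <= 1 by rewrite -Yb pr_le1.
  rewrite Yb (bigD1 b)//= [leRHS](bigD1 b)//=.
  have h1 : nxln (P b b) - nxln (\sum_a P a b) <= \sum_a P a b - P b b.
    by apply: nxln_sub_le => //; rewrite (bigD1 b)//= lerDl sumr_ge0.
  have h2 : \sum_a P a b - P b b = \sum_(a | a != b) P a b.
    by rewrite (bigD1 b)//= addrAC subrr add0r.
  have h3 : \sum_(a | a != b) (nxln (P a b) + P a b) <= \sum_(a | a != b) 3 * Num.sqrt e.
    apply: ler_sum => a ab; have := off _ _ ab; have := XYe _ _ ab; rewrite -/(P a b).
    by lra.
  rewrite big_split/= in h3; have := sqrtr_ge0 e; lra.
apply: (le_trans (ler_sum _ (fun b _ => row b))).
by rewrite !sumr_const -mulrnA -[leLHS]mulr_natr natrM expr2 mulrAC.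
Qed.

End MeasurePreserving.

(** * Gibbs measures *)

Lemma iter_left_shiftE n (x : sequences) i : iter n left_shift x i = x (n + i)%N.
Proof.
elim: n i => [//|n IH] i.
by rewrite iterS /left_shift IH addnS.
Qed.

Lemma cylinderE (X : set sequences) w : cylinder X w = X `&` cyl w.
Proof. by []. Qed.

Lemma words_of_sizeP (X : set sequences) n w :
  words_of_size X n w <-> size w = n /\ cylinder X w !=set0.
Proof.
split => [[x Xx <-]|[<- [x [Xx xw]]]]; last by exists x.
by rewrite size_mkseq; split => //; exists x; split => //; exact: cyl_mkseq.
Qed.

Lemma wordsP (X : set sequences) w : words X w <-> cylinder X w !=set0.
Proof.
split => [[n _ /words_of_sizeP[_ ?]]//|w0].
by exists (size w) => //; apply/words_of_sizeP.
Qed.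

Lemma subshift_iter (X : set sequences) n x : subshift X -> X x ->
  X (iter n left_shift x).
Proof. by move=> [_ sX] Xx; elim: n => //= n IH; apply: sX; exists (iter n left_shift x). Qed.

Lemma measure_open_null {R : realType} (mu : {measure set sequences -> \bar R}) U :
  open U -> (forall w, cyl w `<=` U -> mu (cyl w) = 0%E) -> mu U = 0%E.
Proof.
move=> oU U0; apply/(@negligibleP _ _ _ mu); first exact: measurable_open.
pose F n := if @unpickle (seq nat) n is Some w then
  (if w \in [set w | cyl w `<=` U] then cyl w else set0) else set0.
have UF : U `<=` \bigcup_n F n.
  rewrite {1}(open_bigcup_cyl oU) => x [w wU xw].
  by exists (pickle w) => //; rewrite /F pickleK mem_set.
apply: (negligibleS UF); apply: negligible_bigcup => n; rewrite /F.
case: unpickle => [w|]; last exact: negligible_set0.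
case: ifPn => [/set_mem wU|_]; last exact: negligible_set0.
by apply/negligibleP; [exact: measurable_cyl|exact: U0].
Qed.

(** * Weights of words *)

Section WordWeights.
Context {R : realType}.
Variables (X : set sequences) (f : nat -> sequences -> R).
Hypothesis X_shift : subshift X.
Hypothesis X_neq0 : X !=set0.
Hypothesis f_pos : positive_continuous X f.
Hypothesis f_bowen : bowen X f.

(** The empty word gets 1 because [f 0] is unconstrained. On an empty cylinder the supremum is
    [-oo], which [fine] sends to 0, so weights vanish outside the language of [X]. *)
Definition wt (w : seq nat) : R :=
  if w is [::] then 1 else fine (sup_cyl X f (size w) w).

Arguments wt : simpl never.

Lemma wt_nil : wt [::] = 1. Proof. by []. Qed.

Lemma bowen_wt : exists2 M : R, 1 <= M & forall w x, w != [::] -> cylinder X w x ->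
  [/\ sup_cyl X f (size w) w = (wt w)%:E, 0 < f (size w) x,
      f (size w) x <= wt w & wt w <= M * f (size w) x].
Proof.
have [M M0 fM] := f_bowen.
have sz (w : seq nat) : w != [::] -> (0 < size w)%N by case: w.
exists M => [|w x w0 [Xx xw]].
  have [x Xx] := X_neq0; have := fM 1%N x x erefl Xx Xx (fun _ _ => erefl).
  by rewrite divff// gt_eqF//; have [_] := f_pos (ltn0Sn 0); exact.
have wE : wt w = fine (sup_cyl X f (size w) w) by case: (w) w0.
have [_ fp] := f_pos (sz w w0); have fx := fp x Xx.
have ub : (sup_cyl X f (size w) w <= (M * f (size w) x)%:E)%E.
  apply: ge_ereal_sup => _ [y [Xy yw] <-]; rewrite lee_fin -ler_pdivrMr//.
  apply: fM => //; first exact: sz.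
  by move=> i iw; move/cylP: yw => ->//; move/cylP: xw => ->.
have lb : ((f (size w) x)%:E <= sup_cyl X f (size w) w)%E.
  by apply: ereal_sup_ubound; exists x.
have fin : sup_cyl X f (size w) w \is a fin_num.
  by rewrite fin_numE; apply/andP; split; apply/eqP => E;
    move: lb ub; rewrite E ?leeNy_eq ?leye_eq.
split => //; first by rewrite wE fineK.
- by rewrite -lee_fin wE fineK.
- by rewrite -lee_fin wE fineK.
Qed.

Lemma wt_empty w : w != [::] -> ~ (cylinder X w !=set0) -> wt w = 0.
Proof.
move=> w0 cw; have -> : wt w = fine (sup_cyl X f (size w) w) by case: (w) w0.
rewrite /sup_cyl (_ : cylinder X w = set0) ?image_set0 ?ereal_sup0//.
by apply/seteqP; split => // x xw; apply: cw; exists x.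
Qed.

Lemma wt_ge0 w : 0 <= wt w.
Proof.
have [->|w0] := eqVneq w [::]; first exact: ler01.
have [[x xw]|cw] := pselect (cylinder X w !=set0); last by rewrite wt_empty.
have [M _ /(_ w x w0 xw) [_ fx fw _]] := bowen_wt.
exact: ltW (lt_le_trans fx fw).
Qed.

Lemma wt_le w c : w != [::] -> 0 <= c ->
  (forall x, cylinder X w x -> f (size w) x <= c) -> wt w <= c.
Proof.
move=> w0 c0 fc; have [[x xw]|cw] := pselect (cylinder X w !=set0); last by rewrite wt_empty.
have [M _ /(_ w x w0 xw) [supE _ _ _]] := bowen_wt.
by rewrite -lee_fin -supE; apply: ge_ereal_sup => _ [y yw <-]; rewrite lee_fin fc.
Qed.

Lemma wt_ge w x : w != [::] -> cylinder X w x -> f (size w) x <= wt w.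
Proof. by move=> w0 xw; have [M _ /(_ w x w0 xw) []] := bowen_wt. Qed.

Lemma cylinder_cat u v x : cylinder X (u ++ v) x ->
  cylinder X u x /\ cylinder X v (iter (size u) left_shift x).
Proof.
by move=> [Xx /cyl_catE [xu xv]]; split; split => //; exact: subshift_iter.
Qed.

Lemma wt_submul : subadditive_upto_constant X f ->
  exists2 K : R, 1 <= K & forall u v, wt (u ++ v) <= K * (wt u * wt v).
Proof.
move=> [C C0 fC]; have K1 : 1 <= expR C by rewrite -expR0 ler_expR.
exists (expR C) => // u v.
have [->|u0] := eqVneq u [::].
  by rewrite wt_nil mul1r ler_peMl ?wt_ge0.
have [->|v0] := eqVneq v [::].
  by rewrite cats0 wt_nil mulr1 ler_peMl ?wt_ge0.
apply: wt_le => [||x /cylinder_cat [xu xv]]; first by case: (u) u0.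
  by rewrite !mulr_ge0 ?wt_ge0 ?expR_ge0.
have su : (0 < size u)%N by case: (u) u0.
have sv : (0 < size v)%N by case: (v) v0.
have Xx : X x by case: xu.
rewrite size_cat (le_trans (fC _ _ _ su sv Xx))// -mulrA ler_wpM2l ?expR_ge0//.
have [_ fu] := f_pos su; have [_ fv] := f_pos sv.
by rewrite ler_pM ?wt_ge// ltW ?fu ?fv//; case: xv.
Qed.

(** The gap word depends on [u] and [v]; since weights are nonnegative, it may be replaced by the
    sum over all candidates. *)
Lemma wt_quasimul : finitely_quasi_multiplicative X f ->
  exists (D : R) (W : seq (seq nat)), 0 < D /\ forall u v, u != [::] -> v != [::] ->
    D * (wt u * wt v) <= \sum_(w <- W) wt (u ++ w ++ v).
Proof.
move=> [p [D [W [p0 D0 finW WX fW]]]].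
have [s sW] : exists s : seq (seq nat), W = [set` s] by exact/finite_seqP.
exists D, s; split => // u v u0 v0.
have S0 : 0 <= \sum_(w <- s) wt (u ++ w ++ v) by apply: sumr_ge0 => w _; exact: wt_ge0.
have [[x xu]|cu] := pselect (cylinder X u !=set0); last by rewrite wt_empty// mul0r mulr0.
have [[y yv]|cv] := pselect (cylinder X v !=set0); last by rewrite [wt v]wt_empty// !mulr0.
have su : (0 < size u)%N by case: (u) u0.
have sv : (0 < size v)%N by case: (v) v0.
have [||w [Ww wX]] := fW (size u) (size v) u v su sv.
- by apply/words_of_sizeP; split => //; exists x.
- by apply/words_of_sizeP; split => //; exists y.
have ws : w \in s by move: Ww; rewrite sW.
have uwv0 : u ++ w ++ v != [::] by case: (u) u0.
have /wordsP [z zw] := wX.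
have [M _ MW] := bowen_wt.
have [-> _ _ _] := MW u x u0 xu; have [-> _ _ _] := MW v y v0 yv.
have [suwv _ _ _] := MW _ z uwv0 zw.
rewrite (_ : size u + size v + size w = size (u ++ w ++ v))%N; last first.
  by rewrite !size_cat addnAC addnA.
rewrite suwv -!EFinM lee_fin -mulrA => /le_trans; apply.
by rewrite (big_rem w ws)/= lerDl sumr_ge0// => ? _; exact: wt_ge0.
Qed.

Lemma wt_summable : (Z1 X f < +oo)%E -> (\sum_(i <oo) (wt [:: i])%:E < +oo)%E.
Proof.
rewrite /Z1 eseries_mkcond; apply: le_lt_trans; apply: lee_nneseries => i _.
  by rewrite lee_fin wt_ge0.
case: ifPn => [/set_mem [x xi]|ni].
  by have [M _ /(_ [:: i] x erefl xi) [-> _ _ _]] := bowen_wt.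
by rewrite wt_empty//; move/negP: ni; apply: contra_not => /mem_set.
Qed.

Lemma wt_nontrivial : exists i, 0 < wt [:: i].
Proof.
have [x Xx] := X_neq0; exists (x 0%N).
have xx : cylinder X [:: x 0%N] x by split.
by have [M _ /(_ _ _ _ xx) []// _ fx fw _] := bowen_wt; exact: lt_le_trans fw.
Qed.

End WordWeights.
Arguments wt : simpl never.

Section GibbsMeasures.
Context {R : realType}.
Variables (X : set sequences) (f : nat -> sequences -> R).
Hypothesis X_shift : subshift X.
Hypothesis X_neq0 : X !=set0.
Hypothesis f_pos : positive_continuous X f.
Hypothesis f_bowen : bowen X f.

Let X_closed : closed X. Proof. by case: X_shift. Qed.
Let mX : measurable X. Proof. exact: measurable_closed. Qed.
Hint Resolve mX : core.

Implicit Types (mu nu : probability sequences R) (C P : R).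

Lemma pr_cylinder mu w : mu X = 1%E -> pr mu (cylinder X w) = pr mu (cyl w).
Proof.
move=> muX; rewrite cylinderE [RHS]/pr.
have muXC : mu (~` X) = 0%E by rewrite probability_setC// muX subee.
have mw := measurable_cyl w.
suff -> : mu (cyl w) = mu (X `&` cyl w) by [].
rewrite -[in LHS](setIT (cyl w)) -(setUv X) setIUr measureU0.
- by rewrite setIC.
- exact: measurableI.
- by apply: measurableI => //; exact: measurableC.
- by apply: (subset_measure0 _ _ _ muXC);
    [apply: measurableI => //; exact: measurableC|exact: measurableC|apply: subIsetr].
Qed.

Lemma prob1_setC mu A : measurable A -> mu A = 1%E -> mu (~` A) = 0%E.
Proof. by move=> mA mu1; rewrite probability_setC// mu1 subee. Qed.

Lemma probability_lty mu A : measurable A -> (mu A < +oo)%E.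
Proof. by move=> mA; apply: (le_lt_trans (probability_le1 mu mA)); rewrite ltry. Qed.

Definition gibbs_bound mu C P := forall w, w != [::] ->
  C^-1 * (expR (- ((size w)%:R * P)) * wt X f w) <= pr mu (cyl w) <=
  C * (expR (- ((size w)%:R * P)) * wt X f w).

Let wt0 w : 0 <= wt X f w. Proof. exact: wt_ge0. Qed.

Lemma gibbs_of_weights P (p : seq nat -> R) : p [::] = 1 ->
  (forall u, (\sum_(i <oo) (p (rcons u i))%:E = (p u)%:E)%E) ->
  (forall u, (\sum_(i <oo) (p (i :: u))%:E = (p u)%:E)%E) ->
  (exists2 C, 0 < C & forall u,
        C^-1 * (expR (- ((size u)%:R * P)) * wt X f u) <= p u <=
        C * (expR (- ((size u)%:R * P)) * wt X f u)) ->
  exists mu, gibbs X f mu.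
Proof.
move=> p1 pr_ pl_ [C C0 pC].
have e0 n : 0 <= expR (- (n%:R * P)) by exact: expR_ge0.
have p0 w : 0 <= p w.
  by have /andP[h _] := pC w; rewrite (le_trans _ h)// !mulr_ge0// invr_ge0 ltW.
have [mu muE] := measure_from_weights p0 p1 pr_.
have muX : mu X = 1%E.
  (* The complement of [X] is a countable union of cylinders disjoint from [X], all of weight 0. *)
  have : mu (~` X) = 0%E.
    apply: measure_open_null; first exact: closed_openC.
    move=> w wX; rewrite /= muE.
    have [w0|w0] := eqVneq w [::].
      by exfalso; have [x Xx] := X_neq0; apply: (wX x) => //; rewrite w0.
    have /andP[_] := pC w; rewrite wt_empty//; last first.
      by move=> [x [Xx xw]]; exact: (wX x).
    by rewrite !mulr0 => h; congr EFin; apply/le_anti; rewrite h p0.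
  move=> muXC; rewrite -[X]setCK probability_setC; last exact: measurableC.
  by rewrite [X in (1 - X)%E]muXC sube0.
have muS A : measurable A -> mu (left_shift @^-1` A) = mu A.
  have [m mE] := measure_pushforward mu measurable_shift.
  (* Additivity of the weights under extension on the left is exactly invariance on cylinders. *)
  have mcyl w : m (cyl w) = mu (cyl w).
    rewrite mE (measure_wsum mu 1); last first.
      by rewrite -[X in measurable X]setTI; apply: measurable_shift => //; exact: measurable_cyl.
    rewrite /= muE -pl_; apply: eq_eseriesr => i _; rewrite -muE; congr (mu _).
    apply/seteqP; split => x.
      by move=> [xw xi]; rewrite -cat1s; apply/cyl_catE.
    by rewrite -cat1s => /cyl_catE [].
  have muT : (mu setT < +oo)%E by exact: probability_lty.
  have mT : (m setT < +oo)%E by rewrite mE preimage_setT.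
  move=> mA; rewrite -mE; apply/le_anti/andP.
  by split; apply: le_measure_cyl => // w; have := mcyl w; rewrite /= => ->.
exists mu; split => //.
have [M M1 MW] := bowen_wt X_neq0 f_pos f_bowen.
have M0 : 0 < M by lra.
exists (C * M), P; split; first exact: mulr_gt0.
move=> n w x n0 /words_of_sizeP [sw _] xw.
have w0 : w != [::] by rewrite -size_eq0 sw -lt0n.
have [_ fx fw wM] := MW w x w0 xw; rewrite sw in fx fw wM.
rewrite -/(pr _ _) pr_cylinder// /pr muE/=.
have /andP[lo hi] := pC w; rewrite sw in lo hi.
have en : 0 < expR (- (n%:R * P)) by exact: expR_gt0.
have ef : 0 < expR (- (n%:R * P)) * f n x by exact: mulr_gt0.
apply/andP; split.
- rewrite ler_pdivlMr// (le_trans _ lo)// invfM -mulrA ler_wpM2l//.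
    by rewrite invr_ge0 ltW.
  by rewrite mulrCA ler_wpM2l// ler_pdivrMl// (le_trans fw)// ler_peMl.
- rewrite ler_pdivrMr// (le_trans hi)// -mulrA ler_wpM2l//; first exact: ltW.
  by rewrite mulrCA ler_wpM2l.
Qed.

Lemma gibbs_exists : subadditive_upto_constant X f ->
  finitely_quasi_multiplicative X f -> (Z1 X f < +oo)%E ->
  exists mu, gibbs X f mu.
Proof.
move=> fsub fq fZ.
have [K K1 Kwt] := wt_submul X_shift X_neq0 f_pos f_bowen fsub.
have [D [W [D0 DW]]] := wt_quasimul X_neq0 f_pos f_bowen fq.
have [P [p [p1 pr_ pl_ pC]]] := gibbs_weights_exist erefl wt0 K1 Kwt D0 DW
  (wt_summable X_neq0 f_pos f_bowen fZ) (wt_nontrivial X_neq0 f_pos f_bowen).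
exact: gibbs_of_weights pr_ pl_ pC.
Qed.

Lemma gibbs_boundP mu : gibbs X f mu -> exists C P, 1 <= C /\ gibbs_bound mu C P.
Proof.
move=> [[muX muS] [C0 [P [C0_gt0 muC]]]].
have [M M1 MW] := bowen_wt X_neq0 f_pos f_bowen.
have M0 : 0 < M by lra.
(* [M] passes from values of [f] to suprema over cylinders; the [+ 1] ensures [1 <= C]. *)
pose C := C0 * M + 1.
have CM : 0 < C0 * M by exact: mulr_gt0.
have C_gt0 : 0 < C by rewrite /C; lra.
exists C, P; split; first by rewrite /C; lra.
move=> w w0; rewrite -pr_cylinder//.
have [[x xw]|cw] := pselect (cylinder X w !=set0); last first.
  rewrite wt_empty// !mulr0 /pr (_ : cylinder X w = set0) ?measure0 ?lexx//.
  by apply/seteqP; split => // x xw; apply: cw; exists x.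
have [_ fx fw wM] := MW w x w0 xw.
have sw : (0 < size w)%N by case: (w) w0.
have /(_ w x sw _ xw) /andP[|lo hi] := muC (size w).
  by apply/words_of_sizeP; split => //; exists x.
have en : 0 < expR (- ((size w)%:R * P)) by exact: expR_gt0.
have ef : 0 < expR (- ((size w)%:R * P)) * f (size w) x by exact: mulr_gt0.
rewrite -/(pr _ _) ler_pdivlMr// in lo; rewrite -/(pr _ _) ler_pdivrMr// in hi.
apply/andP; split.
- apply: le_trans lo.
  apply: (@le_trans _ _ ((C0 * M)^-1 * (expR (- ((size w)%:R * P)) * wt X f w))).
    rewrite ler_wpM2r ?mulr_ge0 ?(ltW en)// lef_pV2 ?posrE// /C; lra.
  rewrite invfM -mulrA ler_wpM2l ?invr_ge0 ?(ltW C0_gt0)//.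
  by rewrite mulrCA ler_wpM2l ?(ltW en)// ler_pdivrMl.
- apply: (le_trans hi).
  apply: (@le_trans _ _ (C0 * (expR (- ((size w)%:R * P)) * wt X f w))).
    by rewrite ler_wpM2l ?(ltW C0_gt0)// ler_wpM2l ?(ltW en).
  rewrite ler_wpM2r ?mulr_ge0 ?(ltW en)// /C.
  have : C0 * 1 <= C0 * M by rewrite ler_pM2l.
  lra.
Qed.

(** Cylinder masses of a given length add up to 1, so summing the Gibbs bounds pins the partition
    sum between [expR (n * P) / C] and [C * expR (n * P)]. The exponent of a Gibbs measure is thus
    determined by [f]. *)
Lemma gibbs_bound_pressure mu C P : mu X = 1%E -> 0 < C -> gibbs_bound mu C P ->
  pressure X f = P%:E.
Proof.
move=> muX C0 muC.
have [M M1 MW] := bowen_wt X_neq0 f_pos f_bowen.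
pose Z n := wsum n (fun w => (wt X f w)%:E).
have en n : 0 < expR (- (n%:R * P)) by exact: expR_gt0.
have ZE n : (0 < n)%N -> (\esum_(w in words_of_size X n) sup_cyl X f n w = Z n)%E.
  move=> n0; rewrite /Z wsumE; last by move=> w; rewrite lee_fin.
  rewrite esum_mkcond [RHS]esum_mkcond; apply: eq_esum => w _.
  case: ifPn => [/set_mem /words_of_sizeP [sw [x xw]]|nw].
    rewrite mem_set//.
    have w0 : w != [::] by rewrite -size_eq0 sw -lt0n.
    by have [<- _ _ _] := MW w x w0 xw; rewrite sw.
  case: ifPn => // /set_mem /= sw; rewrite wt_empty//.
    by rewrite -size_eq0 sw -lt0n.
  by move/negP: nw; apply: contra_not => cw; apply/mem_set/words_of_sizeP.
have mu1 n : wsum n (fun w => (pr mu (cyl w))%:E) = 1%E.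
  rewrite -(probability_setT mu) (measure_wsum mu n measurableT).
  by apply: eq_wsum => w _; rewrite setTI prE//; exact: measurable_cyl.
have Zlo n : (0 < n)%N -> ((C^-1 * expR (- (n%:R * P)))%:E * Z n <= 1)%E.
  move=> n0; rewrite -(mu1 n) /Z -wsumZl; last by move=> w; rewrite lee_fin.
  apply: le_wsum => [w|w sw].
    by rewrite -EFinM lee_fin !mulr_ge0 ?invr_ge0 ?(ltW C0) ?(ltW (en n)).
  have w0 : w != [::] by rewrite -size_eq0 sw -lt0n.
  by rewrite -EFinM lee_fin -sw -mulrA; case/andP: (muC w w0).
have Zhi n : (0 < n)%N -> (1 <= (C * expR (- (n%:R * P)))%:E * Z n)%E.
  move=> n0; rewrite -(mu1 n) /Z -wsumZl; last by move=> w; rewrite lee_fin.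
  apply: le_wsum => [w|w sw]; first by rewrite lee_fin pr_ge0.
  have w0 : w != [::] by rewrite -size_eq0 sw -lt0n.
  by rewrite -EFinM lee_fin -sw -mulrA; case/andP: (muC w w0).
have Zfin n : (0 < n)%N -> exists2 z, Z n = z%:E &
    [/\ 0 < z, ln z <= n%:R * P + ln C & n%:R * P - ln C <= ln z].
  move=> n0; have := Zlo n n0; have := Zhi n n0.
  have : (0 <= Z n)%E by apply: wsum_ge0 => w; rewrite lee_fin.
  case: (Z n) => [z|_ _|//].
    rewrite lee_fin => z0; rewrite -!EFinM !lee_fin => hi lo.
    have z_gt0 : 0 < z.
      rewrite lt_neqAle z0 andbT; apply/eqP => z00.
      by move: hi; rewrite -z00 mulr0 ler10.
    exists z => //; split => //.
      have : ln (C^-1 * expR (- (n%:R * P)) * z) <= 0 by exact: ln_le0.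
      by rewrite !lnM ?posrE ?mulr_gt0 ?invr_gt0// lnV ?posrE// expRK; lra.
    have : 0 <= ln (C * expR (- (n%:R * P)) * z) by exact: ln_ge0.
    by rewrite !lnM ?posrE ?mulr_gt0 ?invr_gt0// expRK; lra.
  by rewrite gt0_muley// lte_fin mulr_gt0 ?invr_gt0.
rewrite /pressure.
suff cv : (fun n => (n%:R^-1)%:E *
    lne (\esum_(w in words_of_size X n) sup_cyl X f n w))%E @ \oo --> P%:E.
  rewrite is_cvg_limn_esupE; first by apply/cvg_lim.
  by apply/cvg_ex; exists P%:E.
have lim1 (s : R) : (P%:E + (s * n%:R^-1)%:E)%E @[n --> \oo] --> P%:E.
  rewrite -[X in _ --> X]adde0; apply: cvgeD => //; first exact: cvg_cst.
  apply: cvg_EFin; first exact: nearW.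
  rewrite -(mulr0 s); apply: cvgMr; exact: cvg_natr_inv.
apply: (squeeze_cvge _ (lim1 (- ln C)) (lim1 (ln C))).
near=> n.
have n0 : (0 < n)%N by near: n; exact: nbhs_infty_gt.
have nR : 0 < n%:R :> R by rewrite ltr0n.
have [z zE [z0 hi lo]] := Zfin n n0.
rewrite ZE// zE lne_EFin// -EFinM -!EFinD !lee_fin; apply/andP; split.
- by rewrite ler_pdivlMl// mulrDr mulrCA divff ?gt_eqF// mulr1; lra.
- by rewrite ler_pdivrMl// mulrDr mulrCA divff ?gt_eqF// mulr1; lra.
Unshelve. all: by end_near. Qed.

End GibbsMeasures.

(** * Ergodicity and uniqueness *)

Section ErgodicMeasures.
Context {R : realType}.
Implicit Types (mu nu : probability sequences R) (A : set sequences).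

Lemma pr_setC mu A : measurable A -> pr mu (~` A) = 1 - pr mu A.
Proof.
move=> mA; apply: EFin_inj; rewrite EFinB !prE//; last exact: measurableC.
by rewrite probability_setC.
Qed.

Lemma pr_setDI mu A B : measurable A -> measurable B ->
  pr mu A = pr mu (A `\` B) + pr mu (A `&` B).
Proof.
move=> mA mB; apply: EFin_inj; rewrite EFinD !prE//.
- exact: measureDI.
- exact: measurableI.
- exact: measurableD.
Qed.

(** The positive and negative parts of [nu - mu] are returned as genuine measures, so that countable
    unions of null sets are available for them. *)
Lemma hahn_probability mu nu :
  exists (P : set sequences) (jp jn : {measure set sequences -> \bar R}),
  [/\ measurable P,
  forall A, measurable A -> jp A = (pr nu (A `&` P) - pr mu (A `&` P))%:E &
  forall A, measurable A -> jn A = (pr mu (A `\` P) - pr nu (A `\` P))%:E].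
Proof.
pose s := cadd (charge_of_finite_measure nu) (copp (charge_of_finite_measure mu)).
have [P [N PN]] := Hahn_decomposition s.
have [[mP _] [mN _] PNT PN0] := PN.
have sE A : measurable A -> s A = (pr nu A - pr mu A)%:E.
  by move=> mA; rewrite EFinB !prE.
have NE : N = ~` P.
  apply/seteqP; split => x.
    by move=> Nx Px; have : (P `&` N) x by []; rewrite PN0.
  by move=> nPx; have [|//] : (P `|` N) x by rewrite PNT.
exists P, (jordan_pos PN), (jordan_neg PN); split => // A mA.
  suff : jordan_pos PN A = s (A `&` P) by move=> h; apply: (etrans h); rewrite sE//; exact: measurableI.
  by rewrite jordan_posE cjordan_posE /crestr0 mem_set.
suff : jordan_neg PN A = (- s (A `&` N))%E.
  move=> h; apply: (etrans h); rewrite sE; last exact: measurableI.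
  by rewrite NE -EFinN opprB setDE.
by rewrite jordan_negE cjordan_negE /crestr0 mem_set.
Qed.

(** A Hahn set [P] maximizes [q = nu - mu]. By invariance its preimages under the shift maximize [q]
    as well, hence agree with [P] up to null sets, and so does their upper limit, which is
    invariant. Ergodicity and absolute continuity make [q] vanish there, so the maximum of [q] is
    0. *)
Lemma ergodic_absolutely_continuous_unique (X : set sequences) mu nu :
  subshift X -> invariant_measure X mu -> ergodic X mu -> invariant_measure X nu ->
  (forall A, measurable A -> mu A = 0%E -> nu A = 0%E) ->
  forall A, measurable A -> nu A = mu A.
Proof.
move=> X_shift [muX muS] ergo [nuX nuS] numu.
have mX : measurable X by case: X_shift => cX _; exact: measurable_closed.
have [P [jp [jn [mP jpE jnE]]]] := hahn_probability mu nu.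
pose q A := pr nu A - pr mu A.
pose E n : set sequences := iter n left_shift @^-1` P.
have mE n : measurable (E n) by exact: measurable_preimage_iter measurable_shift _ _ _.
have qE n : q (E n) = q P by rewrite /q /pr !(mu_preimage_iter measurable_shift).
have qD A B : measurable A -> measurable B -> q A = q (A `\` B) + q (A `&` B).
  by move=> mA mB; rewrite /q (pr_setDI nu mA mB) (pr_setDI mu mA mB); lra.
have q_jp A : measurable A -> jp A = (q (A `&` P))%:E by move=> mA; rewrite jpE.
have q_jn A : measurable A -> jn A = (- q (A `\` P))%:E by move=> mA; rewrite jnE// opprB.
have qP_ge0 A : measurable A -> A `<=` P -> 0 <= q A.
  by move=> mA AP; rewrite -lee_fin -[A](setIidl AP) -q_jp.
have qN_le0 A : measurable A -> A `<=` ~` P -> q A <= 0.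
  move=> mA AP; have : A `\` P = A by rewrite setDE; exact/setIidPl.
  by move=> <-; rewrite -oppr_ge0 -lee_fin -q_jn.
(* As [E n] and [P] have the same [q], so do the two differences; one value is nonnegative and the
   other nonpositive. *)
have jpE0 n : jp (P `\` E n) = 0%E /\ jn (E n `\` P) = 0%E.
  have mPE : measurable (P `\` E n) by exact: measurableD.
  have mEP : measurable (E n `\` P) by exact: measurableD.
  have h1 := qD _ _ mP (mE n); have h2 := qD _ _ (mE n) mP.
  have h3 : 0 <= q (P `\` E n) by apply: qP_ge0 => // x [].
  have h4 : q (E n `\` P) <= 0 by apply: qN_le0 => // x [].
  rewrite setIC -(qE n) in h1.
  rewrite q_jp// q_jn// (setIidl (_ : P `\` E n `<=` P)); last by move=> x [].
  rewrite (_ : (E n `\` P) `\` P = E n `\` P); last first.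
    by rewrite !setDE -setIA setIid.
  by split; congr EFin; lra.
(* A0 is invariant, whereas P is so only up to null sets. *)
pose F m := \bigcup_(n in [set n | (m <= n)%N]) E n.
pose A0 := X `&` \bigcap_m F m.
have mF m : measurable (F m) by apply: bigcup_measurable.
have mA0 : measurable A0 by apply: measurableI => //; exact: bigcapT_measurable.
have A0_inv : X `&` left_shift @^-1` A0 = A0.
  apply/seteqP; split => x.
    move=> [Xx [_ Fx]]; split => // m _; have [n /= mn Pn] := Fx m I.
    by exists n.+1; [exact: leqW|rewrite /E /preimage /= -iterS iterSr].
  move=> [Xx Fx]; split => //; split.
    by case: X_shift => _; apply; exists x.
  move=> m _; have [[|n] /= mn Pn] := Fx m.+1 I; first by [].
  by exists n => //; move: Pn; rewrite /E /preimage /= -iterS iterSr.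
have jn0 : jn (A0 `\` P) = 0%E.
  apply/(@negligibleP _ _ _ jn); first exact: measurableD.
  have sub : A0 `\` P `<=` \bigcup_n (E n `\` P).
    by move=> x [[_ Fx] nP]; have [n _ En] := Fx 0%N I; exists n.
  apply: (negligibleS sub); apply: negligible_bigcup => n.
  by apply/negligibleP; [exact: measurableD|case: (jpE0 n)].
have jp0 : jp (P `\` A0) = 0%E.
  apply/(@negligibleP _ _ _ jp); first exact: measurableD.
  have sub : P `\` A0 `<=` (\bigcup_n (P `\` E n)) `|` ~` X.
    move=> x [Px nA]; have [Xx|] := pselect (X x); last by right.
    left; apply: contrapT => nE; apply: nA; split => // m _; exists m => //=.
    by apply: contrapT => nEm; apply: nE; exists m.
  apply: (negligibleS sub); apply: negligibleU; last first.
    apply/negligibleP; first exact: measurableC.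
    apply: (etrans (jpE _ (measurableC mX))).
    have XP0 (m : probability sequences R) : m X = 1%E -> pr m (~` X `&` P) = 0.
      move=> mX1; apply/le_anti; rewrite pr_ge0 andbT.
      rewrite (le_trans (pr_le m _ _ (@subIsetl _ _ _)))//.
      - by apply: measurableI => //; exact: measurableC.
      - exact: measurableC.
      - by rewrite pr_setC// /pr mX1 subrr.
    by rewrite (XP0 nu)// (XP0 mu)// subrr.
  apply: negligible_bigcup => n; apply/negligibleP; first exact: measurableD.
  by case: (jpE0 n).
have qA0 : q A0 = q P.
  have h1 := qD _ _ mA0 mP; have h2 := qD _ _ mP mA0.
  have mD1 : measurable (A0 `\` P) by exact: measurableD.
  have mD2 : measurable (P `\` A0) by exact: measurableD.
  have h3 : q (A0 `\` P) = 0.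
    move: jn0; rewrite q_jn// => -[].
    by rewrite !setDE -setIA setIid => /eqP; rewrite oppr_eq0 => /eqP.
  have h4 : q (P `\` A0) = 0.
    by move: jp0; rewrite q_jp// => -[]; rewrite setIidl// => x [].
  by rewrite h1 h2 h3 h4 setIC.
have qP0 : q P = 0.
  have A0X : A0 `<=` X by move=> x [].
  rewrite -qA0 /q /pr; have [mu0|mu1] := ergo A0 mA0 A0X A0_inv.
    by rewrite mu0 numu// subrr.
  rewrite mu1; have : nu (~` A0) = 0%E.
    by apply: numu; [exact: measurableC|exact: prob1_setC].
  move=> nu0; rewrite -[A0]setCK probability_setC; last exact: measurableC.
  by rewrite [X in fine (1 - X)]nu0 sube0 subrr.
have q_le0 A : measurable A -> q A <= 0.
  move=> mA.
  have mAP : measurable (A `&` P) by exact: measurableI.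
  have mAD : measurable (A `\` P) by exact: measurableD.
  have mPA : measurable (P `\` A) by exact: measurableD.
  have h1 := qD _ _ mA mP; have h2 := qD _ _ mP mA.
  have h3 : 0 <= q (P `\` A) by apply: qP_ge0 => // x [].
  have h4 : 0 <= q (A `&` P) by apply: qP_ge0 => // x [].
  have h5 : q (A `\` P) <= 0 by apply: qN_le0 => // x [].
  by rewrite setIC in h2; lra.
move=> A mA; rewrite -!prE//; congr EFin.
have := q_le0 _ mA; have := q_le0 _ (measurableC mA).
by rewrite /q !pr_setC//; lra.
Qed.

End ErgodicMeasures.

Section GibbsErgodic.
Context {R : realType}.
Implicit Types (mu nu : probability sequences R).

(** Gibbs bounds concern nonempty words; the empty one is recovered by summing over the first
    letter. *)
Lemma le_measure_cyl_neq0 (m1 m2 : {measure set sequences -> \bar R}) :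
  (m1 setT < +oo)%E -> (m2 setT < +oo)%E ->
  (forall w, w != [::] -> (m1 (cyl w) <= m2 (cyl w))%E) ->
  forall E, measurable E -> (m1 E <= m2 E)%E.
Proof.
move=> m1T m2T m12; apply: le_measure_cyl => // w.
have [->|/m12//] := eqVneq w [::].
rewrite cyl_nil (measure_wsum m1 1)// (measure_wsum m2 1)//.
by apply: le_wsum => // v v1; rewrite !setTI m12// -size_eq0 v1.
Qed.

Lemma measure_sum_exists (I : Type) (s : seq I) (m : I -> {measure set sequences -> \bar R}) :
  exists m' : {measure set sequences -> \bar R}, forall E, m' E = (\sum_(i <- s) m i E)%E.
Proof.
elim: s => [|i s [m' m'E]].
  by exists mzero => E; rewrite big_nil.
by exists (measure_add (m i) m') => E; rewrite big_cons -m'E; exact: measure_addE.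
Qed.

Lemma measure_scale_exists (c : R) (m : {measure set sequences -> \bar R}) : 0 <= c ->
  exists m' : {measure set sequences -> \bar R}, forall E, m' E = (c%:E * m E)%E.
Proof. by move=> c0; exists (mscale (NngNum c0) m). Qed.

Variables (X : set sequences) (f : nat -> sequences -> R).
Hypothesis X_shift : subshift X.
Hypothesis X_neq0 : X !=set0.
Hypothesis f_pos : positive_continuous X f.
Hypothesis f_bowen : bowen X f.
Hypothesis f_quasi : finitely_quasi_multiplicative X f.

Let mX : measurable X.
Proof. by apply: measurable_closed; case: X_shift. Qed.

Lemma measurable_shift_preimage k (B : set sequences) : measurable B ->
  measurable (iter k left_shift @^-1` B).
Proof. exact: (measurable_preimage_iter measurable_shift). Qed.

(** Both sides are measures in [B], so cylinders suffice. For the cylinder of [v], [c] collects two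
    upper Gibbs bounds for [u] and [v], the constant [D], a lower Gibbs bound for [u ++ w ++ v], and
    the exponential weight of the gap. *)
Lemma gibbs_mixing mu : gibbs X f mu -> exists (c : R) (W : seq (seq nat)), 0 < c /\
  forall u B, u != [::] -> measurable B ->
    c * pr mu (cyl u) * pr mu B <=
    \sum_(w <- W) pr mu (cyl u `&` iter (size u + size w) left_shift @^-1` B).
Proof.
move=> mugibbs; have [[muX muS] _] := mugibbs.
have [C [P [C1 muC]]] := gibbs_boundP X_shift X_neq0 f_pos f_bowen mugibbs.
have [D [W [D0 DW]]] := wt_quasimul X_neq0 f_pos f_bowen f_quasi.
have C0 : 0 < C by lra.
pose l := (\sum_(w <- W) size w)%N.
(* A lower bound for the exponential weights of all gap words, whatever the sign of [P]. *)
pose e0 := expR (- (l%:R * `|P|)).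
have e0_gt0 : 0 < e0 by exact: expR_gt0.
have e0_le w : w \in W -> e0 <= expR (- ((size w)%:R * P)).
  move=> wW; rewrite ler_expR lerN2 (@le_trans _ _ ((size w)%:R * `|P|))//.
    by rewrite ler_wpM2l// ler_norm.
  by rewrite ler_wpM2r// ler_nat /l (big_rem w wW)/= leq_addr.
have wt0 w : 0 <= wt X f w by exact: wt_ge0.
pose c := C^-1 * e0 * D / (C * C).
have Ci : 0 < C^-1 by rewrite invr_gt0.
exists c, W; split; first by rewrite divr_gt0 ?mulr_gt0.
move=> u B u0 mB.
have mu_lty A : measurable A -> (mu A < +oo)%E by exact: probability_lty.
have [m1 m1E] : exists m1 : {measure set sequences -> \bar R}, forall E,
    m1 E = ((c * pr mu (cyl u))%:E * mu E)%E.
  by apply: measure_scale_exists; rewrite mulr_ge0 ?pr_ge0// ltW// divr_gt0 ?mulr_gt0.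
have [mr mrE] := measure_restr mu (measurable_cyl u).
pose mw (w : seq nat) := projT1 (cid (measure_pushforward mr (measurable_iter_shift (size u + size w)))).
have mwE w E : mw w E = mu (cyl u `&` iter (size u + size w) left_shift @^-1` E).
  rewrite /mw; case: cid => m /= ->; rewrite mrE setIC//.
have [m2 m2E] := measure_sum_exists W mw.
have mset w (E : set sequences) : measurable E ->
    measurable (cyl u `&` iter (size u + size w) left_shift @^-1` E).
  by move=> mE; apply: measurableI; [exact: measurable_cyl|exact: measurable_shift_preimage].
have m2pr E : measurable E -> m2 E = (\sum_(w <- W)
    pr mu (cyl u `&` iter (size u + size w) left_shift @^-1` E))%:E.
  by move=> mE; rewrite m2E -sumEFin; apply: eq_bigr => w _; rewrite mwE prE//; exact: mset.
rewrite -lee_fin -m2pr// EFinM prE// -m1E.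
apply: le_measure_cyl_neq0 => //.
- by rewrite m1E -prE// -EFinM ltry.
- by rewrite m2pr// ltry.
move=> v v0; rewrite m1E m2pr; last exact: measurable_cyl.
rewrite -prE; last exact: measurable_cyl.
rewrite -EFinM lee_fin.
apply: (@le_trans _ _ (\sum_(w <- W) pr mu (cyl (u ++ w ++ v)))); last first.
  apply: ler_sum => w _; apply: pr_le => //; first exact: measurable_cyl.
    by apply: mset; exact: measurable_cyl.
  move=> x /cyl_catE [xu /cyl_catE [_ xv]]; split => //=.
  by rewrite addnC iterD.
have /andP[_ hu] := muC u u0; have /andP[_ hv] := muC v v0.
set eu := expR _ in hu; set ev := expR _ in hv.
have eu0 : 0 < eu by exact: expR_gt0.
have ev0 : 0 < ev by exact: expR_gt0.
apply: (@le_trans _ _ (C^-1 * (eu * ev * e0) * \sum_(w <- W) wt X f (u ++ w ++ v))); last first.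
  rewrite mulr_sumr big_seq [leRHS]big_seq; apply: ler_sum => w wW.
  have uwv0 : u ++ w ++ v != [::] by case: (u) u0.
  have /andP[+ _] := muC _ uwv0; apply: le_trans.
  rewrite -mulrA ler_wpM2l ?(ltW Ci)// ler_wpM2r//.
  rewrite !size_cat !natrD !mulrDl !opprD !expRD -/eu -/ev -mulrA.
  rewrite ler_wpM2l ?(ltW eu0)// [leLHS]mulrC ler_wpM2r ?(ltW ev0)//.
  exact: e0_le.
apply: (@le_trans _ _ (C^-1 * (eu * ev * e0) * (D * (wt X f u * wt X f v)))); last first.
  by rewrite ler_wpM2l ?DW// !mulr_ge0 ?(ltW Ci) ?(ltW eu0) ?(ltW ev0) ?(ltW e0_gt0).
have : pr mu (cyl u) * pr mu (cyl v) <= C * (eu * wt X f u) * (C * (ev * wt X f v)).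
  by rewrite ler_pM ?pr_ge0.
move=> h; rewrite -[leLHS]mulrA.
apply: (@le_trans _ _ (c * (C * (eu * wt X f u) * (C * (ev * wt X f v))))).
  by rewrite ler_wpM2l// ltW// divr_gt0 ?mulr_gt0.
rewrite /c le_eqVlt; apply/orP; left; apply/eqP; field.
by rewrite gt_eqF.
Qed.

Lemma shift_invariant_iter (A : set sequences) k :
  X `&` left_shift @^-1` A = A -> X `&` iter k left_shift @^-1` A = A.
Proof.
move=> AE; elim: k => [|k IH].
  by apply/setIidPr; rewrite -AE => x [].
rewrite -[RHS]AE -{2}IH; apply/seteqP; split => x.
  move=> [Xx Ax]; split => //; split; first exact: (@subshift_iter X 1 x X_shift).
  by move: Ax; rewrite /preimage /= -iterS iterSr.
by move=> [Xx [_ Ax]]; split => //; move: Ax; rewrite /preimage /= -iterS iterSr.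
Qed.

(** For an invariant [A], mixing bounds [c * mu A] times [mu] by [size W] times the restriction of
    [mu] to [A], first on cylinders and then on all Borel sets. Evaluated at the complement of [A],
    it gives [c * a * (1 - a) <= 0]. *)
Lemma gibbs_ergodic mu : gibbs X f mu -> ergodic X mu.
Proof.
move=> mugibbs A mA AX AE; have [[muX muS] _] := mugibbs.
have [c [W [c0 mix]]] := gibbs_mixing mugibbs.
have muXC : mu (~` X) = 0%E by exact: prob1_setC.
have mCX : measurable (~` X) by exact: measurableC.
(* Invariance holds inside [X] only; the part of the preimage outside [X] is null. *)
have cA u k : pr mu (cyl u `&` iter k left_shift @^-1` A) = pr mu (cyl u `&` A).
  have mk := measurable_shift_preimage k mA.
  have mw := measurable_cyl u.
  rewrite (pr_setDI mu (measurableI _ _ mw mk) mX).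
  rewrite [X in X + _](_ : _ = 0) ?add0r.
    by rewrite -[in RHS](shift_invariant_iter k AE) -setIA [in LHS](setIC _ X).
  apply/le_anti; rewrite pr_ge0 andbT.
  rewrite (_ : 0 = pr mu (~` X)); last by rewrite /pr muXC.
  apply: pr_le; [|exact: mCX|by move=> x []].
  by apply: measurableD; [exact: measurableI|exact: mX].
pose a := pr mu A.
have a0 : 0 <= a by exact: pr_ge0.
have [m1 m1E] := measure_scale_exists mu (mulr_ge0 (ltW c0) a0).
have [mr mrE] := measure_restr mu mA.
have [m2 m2E] := measure_scale_exists mr (ler0n R (size W)).
have m2fin E : measurable E -> m2 E = ((size W)%:R * pr mu (E `&` A))%:E.
  by move=> mE; rewrite m2E mrE [RHS]EFinM prE//; exact: measurableI.
have m1fin E : measurable E -> m1 E = (c * a * pr mu E)%:E.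
  by move=> mE; rewrite m1E [RHS]EFinM prE.
have dom : (m1 (~` A) <= m2 (~` A))%E.
  apply: le_measure_cyl_neq0 => [|||]; last exact: measurableC.
  - by rewrite m1fin// ltry.
  - by rewrite m2fin// ltry.
  move=> u u0; have mu_ := measurable_cyl u.
  rewrite m1fin// m2fin// lee_fin mulrAC (le_trans (mix u A u0 mA))//.
  under eq_bigr do rewrite cA.
  by rewrite big_const_seq count_predT iter_addr addr0 -[leLHS]mulr_natl.
move: dom; rewrite m1fin ?m2fin; try exact: measurableC.
rewrite setICl pr_set0 mulr0 lee_fin pr_setC// -/a => h.
have a1 : a <= 1 by exact: pr_le1.
have : a * (1 - a) <= 0 by rewrite -(pmulr_rle0 _ c0) mulrA.
have [a00|a_neq0] := eqVneq a 0; first by left; rewrite -prE//; congr EFin.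
move=> h'; right; rewrite -prE//; congr EFin; rewrite -/a; apply/le_anti; rewrite a1/= leNgt.
apply/negP => alt; move: h'; apply/negP; rewrite -ltNge mulr_gt0 ?subr_gt0//.
by rewrite lt_neqAle eq_sym a_neq0.
Qed.

(** Both exponents equal the pressure, so the Gibbs bounds give [nu <= C' * C * mu] on cylinders,
    hence absolute continuity. *)
Lemma gibbs_unique mu nu : gibbs X f mu -> gibbs X f nu ->
  forall A, measurable A -> nu A = mu A.
Proof.
move=> mug nug.
have [C [P [C1 muC]]] := gibbs_boundP X_shift X_neq0 f_pos f_bowen mug.
have [C' [P' [C'1 nuC]]] := gibbs_boundP X_shift X_neq0 f_pos f_bowen nug.
have C0 : 0 < C by lra.
have C'0 : 0 < C' by lra.
have PP : P = P'.
  have := gibbs_bound_pressure X_neq0 f_pos f_bowen (mug.1.1) C0 muC.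
  by rewrite (gibbs_bound_pressure X_neq0 f_pos f_bowen (nug.1.1) C'0 nuC) => -[].
apply: (ergodic_absolutely_continuous_unique X_shift mug.1 (gibbs_ergodic mug) nug.1).
move=> A mA muA.
have [m mE] := measure_scale_exists mu (mulr_ge0 (ltW C'0) (ltW C0)).
suff : (nu A <= m A)%E.
  by rewrite mE /= muA mule0 => h; apply/le_anti; rewrite h measure_ge0.
apply: le_measure_cyl_neq0 => //.
- exact: (probability_lty nu).
- by rewrite mE /= -prE// -EFinM ltry.
move=> w w0; have mw := measurable_cyl w; rewrite mE.
have /andP[lo _] := muC w w0; have /andP[_ hi] := nuC w w0.
rewrite -PP in hi.
suff : ((pr nu (cyl w))%:E <= (C' * C)%:E * (pr mu (cyl w))%:E)%E by rewrite !prE.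
rewrite -EFinM lee_fin (le_trans hi)// -mulrA ler_wpM2l ?(ltW C'0)//.
by rewrite -ler_pdivrMl.
Qed.

End GibbsErgodic.

(** * Truncated alphabets and the variational inequality *)

Section Integrals.
Context {R : realType}.
Implicit Types (nu : probability sequences R) (g h : sequences -> R).

Lemma measurable_fun_within (X : set sequences) g : measurable X ->
  {within X, continuous g} -> measurable_fun X g.
Proof.
move=> mX /continuousP cg; apply: (measurability _ (RGenOpens.measurableE R)).
move=> _ [_ [a [b ->] <-]].
have /open_subspaceP[V oV VE] := cg _ (@interval_open R (BRight a) (BLeft b) isT isT).
by rewrite setIC -VE; apply: measurableI => //; exact: measurable_open.
Qed.

Lemma Rintegral_full nu (X : set sequences) g : measurable X -> nu X = 1%E ->
  nu.-integrable setT (EFin \o g) -> \int[nu]_(x in X) g x = \int[nu]_x g x.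
Proof.
move=> mX nuX ig; congr fine; apply/esym.
rewrite (@negligible_integral _ _ _ nu setT (~` X))//.
- by rewrite setTD setCK.
- exact: measurableC.
- exact: prob1_setC.
Qed.

Lemma le_Rintegral_full nu (X : set sequences) g h : measurable X -> nu X = 1%E ->
  nu.-integrable setT (EFin \o g) -> nu.-integrable setT (EFin \o h) ->
  (forall x, X x -> g x <= h x) -> \int[nu]_x g x <= \int[nu]_x h x.
Proof.
move=> mX nuX ig ih gh; rewrite -(Rintegral_full mX nuX ig) -(Rintegral_full mX nuX ih).
by apply: le_Rintegral => //; apply: integrableS ig || apply: integrableS ih.
Qed.

Lemma integrable_of_bound nu g h (c : R) : measurable_fun setT g -> 0 <= c ->
  nu.-integrable setT (EFin \o h) -> (forall x, `|g x| <= `|h x| + c) ->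
  nu.-integrable setT (EFin \o g).
Proof.
move=> mg c0 ih gh.
have ihc : nu.-integrable setT (EFin \o (fun x => `|h x| + c)).
  apply: (@eq_integrable _ _ _ nu setT measurableT
    ((EFin \o (fun x => `|h x|)) \+ cst c%:E)) => //.
  apply: integrableD => //; first exact: (integrable_norm ih).
  exact: finite_measure_integrable_cst.
apply: le_integrable ihc => //; first exact/measurable_EFinP.
by move=> x _ /=; rewrite lee_fin (le_trans (gh x))// ler_norm.
Qed.

Lemma Rintegral_iter_shift nu n g :
  (forall A, measurable A -> nu (left_shift @^-1` A) = nu A) ->
  measurable_fun setT g -> nu.-integrable setT (EFin \o g) ->
  nu.-integrable setT (EFin \o (fun x => g (iter n left_shift x))) /\
  \int[nu]_x g (iter n left_shift x) = \int[nu]_x g x.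
Proof.
move=> nuS mg ig; have mS := measurable_iter_shift n.
have pushE (k : sequences -> \bar R) :
    (\int[pushforward nu (iter n left_shift)]_y k y = \int[nu]_y k y)%E.
  apply: eq_measure_integral => A mA _.
  exact: (mu_preimage_iter measurable_shift nuS).
have mEg : measurable_fun setT (EFin \o g) by exact/measurable_EFinP.
have ign : nu.-integrable setT (EFin \o (fun x => g (iter n left_shift x))).
  apply/integrableP; split.
    by apply/measurable_EFinP; exact: measurableT_comp.
  have /integrableP[_] := ig; rewrite -(pushE (fun x => `|(EFin \o g) x|%E)).
  rewrite (@ge0_integral_pushforward _ _ _ _ _ _ mS)//.
  exact: measurableT_comp.
split => //; rewrite /Rintegral -(pushE (EFin \o g)); congr fine.
by rewrite (@integral_pushforward _ _ _ _ _ _ mS).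
Qed.

Lemma Rintegral_labelling nu (A : finType) (Y : sequences -> A) (phi : A -> R) :
  labelling Y ->
  nu.-integrable setT (EFin \o (phi \o Y)) /\
  \int[nu]_x phi (Y x) = \sum_a phi a * pr nu (Y @^-1` [set a]).
Proof.
move=> mY; pose h a : sequences -> \bar R := fun x => ((phi a)%:E * (\1_(Y @^-1` [set a]) x)%:E)%E.
have hE x : (phi (Y x))%:E = (\sum_a h a x)%E.
  rewrite (bigD1 (Y x))//= big1 ?adde0.
    by rewrite /h indicE mem_set// mule1.
  move=> a aY; rewrite /h indicE memNset ?mule0// => /= /esym/eqP.
  by rewrite (negbTE aY).
have ih a : nu.-integrable setT (h a).
  apply: integrableZl => //; apply: integrable_indic => //.
split.
  apply: (@eq_integrable _ _ _ nu setT measurableT (fun x => \sum_a h a x)%E) => //.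
    by move=> x _; rewrite /= hE.
  by apply: integrable_sum => // a _.
apply: EFin_inj; rewrite /Rintegral.
rewrite (eq_integral (fun x => \sum_a h a x)%E); last by move=> x _; exact: hE.
rewrite integral_sum//.
have intE a : (\int[nu]_x h a x = (phi a * pr nu (Y @^-1` [set a]))%:E)%E.
  rewrite integralZl//; last exact: integrable_indic.
  by rewrite integral_indic// setIT EFinM prE.
under eq_bigr do rewrite intE.
by rewrite sumEFin.
Qed.

End Integrals.

(** * Integrability and subadditivity of the logarithms *)

Section LogPotential.
Context {R : realType}.
Implicit Types (nu : probability sequences R).
Variables (X : set sequences) (f : nat -> sequences -> R).
Hypothesis X_shift : subshift X.
Hypothesis X_neq0 : X !=set0.
Hypothesis f_pos : positive_continuous X f.
Hypothesis f_bowen : bowen X f.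
Hypothesis f_sub : subadditive_upto_constant X f.
Hypothesis f_Z1 : (Z1 X f < +oo)%E.

Let mX : measurable X.
Proof. by apply: measurable_closed; case: X_shift. Qed.

(** Extension by 0 off [X] lets all integrals run over the whole space. *)
Definition lnf n : sequences -> R := (fun x => ln (f n x)) \_ X.

Lemma lnfE n x : X x -> lnf n x = ln (f n x).
Proof. by move=> Xx; rewrite /lnf patchE mem_set. Qed.

Lemma lnf0 n x : ~ X x -> lnf n x = 0.
Proof. by move=> Xx; rewrite /lnf patchE memNset. Qed.

Lemma measurable_lnf n : (0 < n)%N -> measurable_fun setT (lnf n).
Proof.
move=> n0; apply/(measurable_restrictT (fun x => ln (f n x)) mX).
apply: measurableT_comp; first exact: measurable_ln.
by apply: measurable_fun_within => //; have [] := f_pos n0.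
Qed.

Lemma lnf_subadditive : exists2 C, 0 <= C & forall n m x, (0 < n)%N -> (0 < m)%N ->
  X x -> lnf (n + m) x <= lnf n x + lnf m (iter n left_shift x) + C.
Proof.
have [C C0 fC] := f_sub; exists C => // n m x n0 m0 Xx.
have Xnx : X (iter n left_shift x) by exact: subshift_iter.
have [_ fn] := f_pos n0; have [_ fm] := f_pos m0.
have [_ fnm] := f_pos (leq_trans n0 (leq_addr m n)).
rewrite !lnfE// -[C]expRK -!lnM ?posrE ?mulr_gt0 ?expR_gt0 ?fn ?fm//.
rewrite ler_ln ?posrE ?mulr_gt0 ?expR_gt0 ?fn ?fm ?fnm//.
by rewrite (le_trans (fC _ _ _ n0 m0 Xx))// -mulrA mulrC.
Qed.

(** The sum of the letter weights bounds [f 1], and each further letter costs at most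
    [C + ln (sup f 1)] by subadditivity. *)
Lemma lnf_bound : exists2 T, 0 <= T & forall n x, (0 < n)%N -> X x -> lnf n x <= n%:R * T.
Proof.
have [C C0 fC] := lnf_subadditive.
have fin := wt_summable X_neq0 f_pos f_bowen f_Z1.
pose s := fine (\sum_(i <oo) (wt X f [:: i])%:E)%E.
have wt0 i : (0 <= (wt X f [:: i])%:E)%E by rewrite lee_fin wt_ge0.
have sE : s%:E = (\sum_(i <oo) (wt X f [:: i])%:E)%E.
  by rewrite fineK// ge0_fin_numE//; apply: nneseries_ge0.
have f1 x : X x -> f 1%N x <= s.
  move=> Xx; apply: (@le_trans _ _ (wt X f [:: x 0%N])).
    exact: (@wt_ge _ X f X_neq0 f_pos f_bowen [:: x 0%N]).
  rewrite -lee_fin sE (nneseriesD1 (n := x 0%N))// leeDl// nneseries_ge0//.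
pose T := C + `|ln s|.
have l1 x : X x -> lnf 1 x <= `|ln s|.
  move=> Xx; have [_ fx] := f_pos (ltn0Sn 0); have f1x := fx _ Xx.
  rewrite lnfE// (le_trans _ (ler_norm _))// ler_ln ?posrE//; first exact: f1.
  exact: lt_le_trans (f1 _ Xx).
exists T => [|n x]; first by rewrite addr_ge0.
case: n => // n _; elim: n x => [|n IH] x Xx.
  by rewrite mul1r (le_trans (l1 x Xx))// lerDr.
have Xsx : X (left_shift x) by exact: (@subshift_iter X 1).
have := fC 1%N n.+1 x erefl erefl Xx; rewrite add1n /= => h.
have := IH _ Xsx; have := l1 _ Xx; rewrite /T -[n.+2%:R]natr1 mulrDl mul1r; lra.
Qed.

Lemma integral_lnE nu n : (\int[nu]_(x in X) (ln (f n x))%:E = \int[nu]_x (lnf n x)%:E)%E.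
Proof. by rewrite integral_mkcond restrict_EFin. Qed.

Lemma integrable_lnf_fin nu n : (0 < n)%N ->
  (\int[nu]_(x in X) (ln (f n x))%:E)%E \is a fin_num ->
  nu.-integrable setT (EFin \o lnf n).
Proof.
move=> n0; rewrite integral_lnE.
have mE : measurable_fun setT (EFin \o lnf n) by apply/measurable_EFinP; exact: measurable_lnf.
have [T T0 lT] := lnf_bound.
have pos : (\int[nu]_x ((EFin \o lnf n)^\+ x) < +oo)%E.
  apply: (@le_lt_trans _ _ (\int[nu]_x (cst (n%:R * T)%:E x))%E); last first.
    by rewrite integral_cst//= probability_setT mule1 ltry.
  apply: ge0_le_integral => //.
  - exact: measurable_funepos.
  - move=> x _; rewrite funeposE /= -EFin_max lee_fin ge_max mulr_ge0// andbT.
    have [Xx|nXx] := pselect (X x); first exact: lT.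
    by rewrite lnf0// mulr_ge0.
rewrite integralE => fin.
have neg : (\int[nu]_x ((EFin \o lnf n)^\- x) < +oo)%E.
  rewrite ltey; apply/eqP => E; move: fin; rewrite E.
  by case: (\int[nu]_x _)%E pos => //.
apply/integrableP; split => //.
rewrite (eq_integral (fun x => (EFin \o lnf n)^\+ x + (EFin \o lnf n)^\- x)%E); last first.
  by move=> x _; have := fune_abse (EFin \o lnf n); move/(congr1 (fun h => h x)).
rewrite ge0_integralD//; first exact: lte_add_pinfty.
- exact: measurable_funepos.
- exact: measurable_funeneg.
Qed.

(** Subadditivity bounds [lnf n] below by [lnf m] minus a constant, because [lnf (m - n)] is bounded
    above. *)
Lemma integrable_lnf_le nu n m : (0 < n)%N -> (n <= m)%N ->
  nu.-integrable setT (EFin \o lnf m) -> nu.-integrable setT (EFin \o lnf n).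
Proof.
move=> n0; rewrite leq_eqVlt => /orP[/eqP -> //|nm] im.
have [T T0 lT] := lnf_bound; have [C C0 fC] := lnf_subadditive.
pose k := (m - n)%N; have k0 : (0 < k)%N by rewrite subn_gt0.
have mE : m = (n + k)%N by rewrite subnKC// ltnW.
apply: (integrable_of_bound (c := C + k%:R * T + n%:R * T) _ _ im).
- exact: measurable_lnf.
- by rewrite !addr_ge0// mulr_ge0.
move=> x; have [Xx|nXx] := pselect (X x); last first.
  by rewrite !lnf0// normr0 add0r !addr_ge0// mulr_ge0.
have := fC n k x n0 k0 Xx; rewrite -mE => h.
have h1 := lT k (iter n left_shift x) k0 (subshift_iter n X_shift Xx).
have h2 := lT n x n0 Xx.
have kT : 0 <= k%:R * T by rewrite mulr_ge0.
have nT : 0 <= n%:R * T by rewrite mulr_ge0.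
have h3 := ler_norm (- lnf m x); rewrite normrN in h3.
by rewrite ler_norml; apply/andP; split; have := normr_ge0 (lnf m x); lra.
Qed.

Lemma Rintegral_lnf_subadditive nu : invariant_measure X nu ->
  (forall n, (0 < n)%N -> nu.-integrable setT (EFin \o lnf n)) ->
  exists2 C, 0 <= C & forall n m, (0 < n)%N -> (0 < m)%N ->
    \int[nu]_x lnf (n + m) x <= \int[nu]_x lnf n x + \int[nu]_x lnf m x + C.
Proof.
move=> [nuX nuS] il; have [C C0 fC] := lnf_subadditive; exists C => // n m n0 m0.
have nm0 : (0 < n + m)%N by rewrite addn_gt0 n0.
have [im imE] := Rintegral_iter_shift n nuS (measurable_lnf m0) (il m m0).
have iC : nu.-integrable setT (EFin \o (fun=> C)) by exact: finite_measure_integrable_cst.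
have inm : nu.-integrable setT (EFin \o (fun x => lnf n x + lnf m (iter n left_shift x))).
  by apply: (integrableD _ (il n n0) im).
have inmC : nu.-integrable setT (EFin \o (fun x => lnf n x + lnf m (iter n left_shift x) + C)).
  by apply: (integrableD _ inm iC).
apply: (le_trans (le_Rintegral_full mX nuX (il _ nm0) inmC (fun x => fC n m x n0 m0))).
rewrite RintegralD// RintegralD//; last exact: il.
rewrite imE lerD2l Rintegral_cst//= probability_setT/= mulr1.
exact: lexx.
Qed.

End LogPotential.

Definition truncate K (x : sequences) : 'I_K.+1 := inord (minn (x 0%N) K).

Notation trunc_word K n := (itinerary left_shift (truncate K) n).

Lemma trunc_wordP K n (x y : sequences) : trunc_word K n x = trunc_word K n y <->
  forall i, (i < n)%N -> minn (x i) K = minn (y i) K.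
Proof.
have tE i z : truncate K (iter i left_shift z) = minn (z i) K :> nat.
  by rewrite /truncate inordK ?iter_left_shiftE ?addn0// ltnS geq_minr.
split => [/itineraryP h i /h ih|h]; first by rewrite -!tE ih.
by apply/itineraryP => i /h ih; apply: val_inj; rewrite /= !tE.
Qed.

Lemma labelling_truncate K : labelling (truncate K).
Proof.
move=> a; apply: (@prefix_determined_measurable 1) => x y xy /= <-.
by rewrite /truncate xy.
Qed.

Lemma labelling_trunc_word K n : labelling (trunc_word K n).
Proof. by apply: labelling_itinerary; [exact: measurable_shift|exact: labelling_truncate]. Qed.

(** * Entropy of the truncated partitions *)

Section TruncatedEntropy.
Context {R : realType}.
Variables (nu : probability sequences R).
Hypothesis nuS : forall A, measurable A -> nu (left_shift @^-1` A) = nu A.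

Let H K n := fin_entropy nu (trunc_word K n).
Let h K := partition_entropy nu left_shift (truncate K).

Lemma trunc_entropy_cvg K : (n%:R^-1 * H K n) @[n --> \oo] --> h K /\
  forall n, (0 < n)%N -> h K <= n%:R^-1 * H K n.
Proof.
exact: (partition_entropy_cvg measurable_shift nuS (@labelling_truncate K)).
Qed.

(** Truncations generate: [xi] is close to a labelling [zeta] that is a function of finitely many
    truncated coordinates, so the entropy of [xi] given these coordinates is at most [e]. *)
Lemma partition_entropy_le_trunc k (xi : sequences -> 'I_k) (e : R) :
  labelling xi -> 0 < e ->
  exists K0, forall K, (K0 <= K)%N -> partition_entropy nu left_shift xi <= h K + e.
Proof.
move=> mxi e0.
have k0 : 0 < (k%:R : R) by rewrite ltr0n; case: (k) (xi point) => // -[].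
have k30 : 0 < 3 * (k%:R : R) ^+ 2 by rewrite mulr_gt0// exprn_gt0.
(* Chosen so that closeness [s ^+ 2], half of it for each of two cells, costs an entropy
   [3 * k ^+ 2 * s <= e]; closeness must be at most 1. *)
pose s : R := Num.min 1 (e / (3 * k%:R ^+ 2)).
have s0 : 0 < s by rewrite lt_min ltr01 divr_gt0.
have s1 : s <= 1 by rewrite ge_min lexx.
have se : 3 * k%:R ^+ 2 * s <= e.
  by rewrite -ler_pdivlMl// mulrC ge_min lexx orbT.
have ss0 : 0 < s ^+ 2 / 2 by rewrite divr_gt0// exprn_gt0.
have nuT : (nu setT < +oo)%E by exact: probability_lty.
have apx i := truncation_determined_approx nuT (mxi i) ss0.
pose r i := projT1 (cid (apx i)).
pose Ki i := projT1 (cid (projT2 (cid (apx i)))).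
pose E i := projT1 (cid (projT2 (cid (projT2 (cid (apx i)))))).
have EP i : truncation_determined (r i) (Ki i) (E i) /\
    (nu (symdiff (xi @^-1` [set i]) (E i)) < (s ^+ 2 / 2)%:E)%E.
  exact: (projT2 (cid (projT2 (cid (projT2 (cid (apx i))))))).
pose r0 := (\max_i r i)%N; pose K0 := (\max_i Ki i)%N.
exists K0 => K K0K.
have dE i : truncation_determined r0 K (E i).
  apply: truncation_determinedW (EP i).1; first exact: leq_bigmax.
  by apply: leq_trans K0K; exact: leq_bigmax.
have mE i : measurable (E i).
  exact: prefix_determined_measurable (truncation_determined_prefix (dE i)).
(* Where [xi] and [zeta] differ, either [x] lies in the chosen [E b] but not in the cell [b], or in
   no [E i], in particular not in the approximation of its own cell. The label of [point] is a mere
   default. *)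
pose zeta x : 'I_k := odflt (xi point) [pick i | `[< E i x >]].
have zetaP x y : trunc_word K r0 x = trunc_word K r0 y -> zeta x = zeta y.
  move=> /trunc_wordP xy; rewrite /zeta; congr odflt; apply: eq_pick => i.
  apply/asbool_equiv_eq; split; apply: dE => j jr; rewrite xy//.
have mzeta : labelling zeta.
  move=> i; apply: (@prefix_determined_measurable r0) => x y xy /= <-.
  by apply/esym/zetaP/trunc_wordP => j jr; rewrite xy.
have msd i : measurable (symdiff (xi @^-1` [set i]) (E i)) by exact: measurable_symdiff.
have close a b : a != b ->
    pr nu (xi @^-1` [set a] `&` zeta @^-1` [set b]) <= s ^+ 2.
  move=> ab; rewrite -lee_fin prE; last exact: measurableI.
  apply: (@le_trans _ _ (nu (symdiff (xi @^-1` [set a]) (E a) `|`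
      symdiff (xi @^-1` [set b]) (E b)))).
    apply: le_measure; rewrite ?inE; first exact: measurableI.
      exact: measurableU.
    move=> x [/= xa]; rewrite /zeta; case: pickP => /= [i /asboolP Ei ib|nE _].
      right; right; rewrite -ib; split => //= xi_i.
      by rewrite -xa -ib xi_i eqxx in ab.
    by left; left; split => //= Ea; have /asboolP := nE a; apply.
  apply: (le_trans (measureU2 nu (msd a) (msd b))).
  have -> : (s ^+ 2)%:E = ((s ^+ 2 / 2)%:E + (s ^+ 2 / 2)%:E)%E.
    by rewrite -EFinD; congr EFin; field.
  by apply: leeD; apply: ltW; [case: (EP a)|case: (EP b)].
have mtw := labelling_trunc_word.
have h1 := partition_entropy_cond measurable_shift nuS r0 mxi (@labelling_truncate K).
have h2 := fin_entropy_cond_le nu mxi (mtw K r0) mzeta zetaP.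
have h3 : fin_entropy nu (joint xi zeta) - fin_entropy nu zeta <=
    3 * #|'I_k|%:R ^+ 2 * Num.sqrt (s ^+ 2).
  apply: fin_entropy_close => //; first by rewrite exprn_ge0// ltW.
  by rewrite exprn_ile1// ltW.
rewrite card_ord sqrtr_sqr ger0_norm ?(ltW s0)// in h3.
rewrite /h; lra.
Qed.

Lemma trunc_entropy_mono K K' n : (K <= K')%N -> H K n <= H K' n.
Proof.
move=> KK; apply: fin_entropy_function; try exact: labelling_trunc_word.
move=> x y /trunc_wordP xy; apply/trunc_wordP => i /xy; lia.
Qed.

(** [truncate K] is a function of [truncate K'], so the entropy of the latter given the former is
    the difference of their entropies. The error per coordinate is therefore independent of [n]. *)
Lemma trunc_entropy_cond K K' n : (K <= K')%N ->
  H K' n <= H K n + n%:R * (fin_entropy nu (truncate K') - fin_entropy nu (truncate K)).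
Proof.
move=> KK.
have mt := labelling_truncate.
have h1 := fin_entropy_itinerary_cond measurable_shift nuS n (mt K') (mt K).
have h2 : H K' n <= fin_entropy nu (joint (trunc_word K' n) (trunc_word K n)).
  by apply: fin_entropy_joint_le; exact: labelling_trunc_word.
have h3 : fin_entropy nu (joint (truncate K') (truncate K)) <= fin_entropy nu (truncate K').
  apply: fin_entropy_function => //; first exact: labelling_joint.
  move=> x y xy; rewrite /joint xy; congr pair; apply: val_inj.
  have := congr1 val xy; rewrite /truncate /= !inordK ?ltnS ?geq_minr//.
  by lia.
have : n%:R * (fin_entropy nu (joint (truncate K') (truncate K)) - fin_entropy nu (truncate K))
  <= n%:R * (fin_entropy nu (truncate K') - fin_entropy nu (truncate K)).
  by rewrite ler_wpM2l// lerD2r.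
rewrite /H in h2 *; lra.
Qed.

End TruncatedEntropy.

Section Variational.
Context {R : realType}.
Variables (X : set sequences) (f : nat -> sequences -> R).
Hypothesis X_shift : subshift X.
Hypothesis f_pos : positive_continuous X f.
Variables (mu nu : probability sequences R) (C P : R).
Hypothesis C_gt0 : 0 < C.
Hypothesis mu_lb : forall n x, (0 < n)%N -> X x ->
  C^-1 * (expR (- (n%:R * P)) * f n x) <= pr mu (cyl (mkseq x n)).
Hypothesis nu_X : nu X = 1%E.

Let mX : measurable X.
Proof. by apply: measurable_closed; case: X_shift. Qed.

(* Gibbs' inequality against the weights mu(c) exp(L) on the cells c of E and
   mu(c) on the others, whose total mass is at most 1 + mu(E) exp(L). *)
Lemma variational_inequality K n E (L : R) : (0 < n)%N -> 0 <= L ->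
  truncation_determined n K E -> nu.-integrable setT (EFin \o lnf X f n) ->
  fin_entropy nu (trunc_word K n) + L * pr nu E <=
  n%:R * P - \int[nu]_x lnf X f n x + ln C + pr mu E * expR L.
Proof.
move=> n0 L0 dE iln.
set Y := trunc_word K n.
have mY : labelling Y by exact: labelling_trunc_word.
have mE := prefix_determined_measurable (truncation_determined_prefix dE).
pose p a := pr nu (Y @^-1` [set a]); pose q a := pr mu (Y @^-1` [set a]).
pose s a : bool := `[< exists x, Y x = a /\ E x >].
have sE a : s a -> E `&` Y @^-1` [set a] = Y @^-1` [set a].
  move=> /asboolP [x [Yx Ex]]; apply/setIidPr => y /= Yy.
  by apply: dE Ex; apply/trunc_wordP; rewrite -/Y Yx Yy.
have nsE a : ~~ s a -> E `&` Y @^-1` [set a] = set0.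
  move=> /asboolPn nx; apply/seteqP; split => // x [Ex Yx]; apply: nx.
  by exists x.
have prEE (m : probability sequences R) :
    pr m E = \sum_a (s a)%:R * pr m (Y @^-1` [set a]).
  rewrite (pr_marginal m mE mY); apply: eq_bigr => a _.
  by case: (boolP (s a)) => [/sE ->|/nsE ->]; rewrite ?mul1r ?mul0r ?pr_set0.
have p0 a : 0 <= p a by exact: pr_ge0.
have q0 a : 0 <= q a by exact: pr_ge0.
(* The truncated cell of [x] contains its cylinder, so it inherits the lower Gibbs bound. *)
have q_lb x : X x -> - (n%:R * P) + lnf X f n x - ln C <= ln (q (Y x)) /\ 0 < q (Y x).
  move=> Xx; have [_ fn] := f_pos n0; have fx := fn _ Xx.
  have w0 : 0 < C^-1 * (expR (- (n%:R * P)) * f n x).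
    by rewrite !mulr_gt0 ?invr_gt0 ?expR_gt0.
  have qx : C^-1 * (expR (- (n%:R * P)) * f n x) <= q (Y x).
    apply: (le_trans (mu_lb n0 Xx)); apply: pr_le; first exact: measurable_cyl.
      exact: mY.
    move=> y /cylP yx /=; apply/trunc_wordP => i ni.
    by rewrite yx ?size_mkseq// nth_mkseq.
  have q_gt0 : 0 < q (Y x) by exact: lt_le_trans qx.
  split => //; move: qx; rewrite -ler_ln ?posrE// => /(le_trans _); apply.
  rewrite !lnM ?posrE ?mulr_gt0 ?invr_gt0 ?expR_gt0// lnV ?posrE// expRK lnfE//.
  by lra.
(* A cell that misses [X] has no mass for [nu]. *)
have q_gt0 a : 0 < p a -> 0 < q a.
  move=> pa; have [[x [Xx Yx]]|nx] := pselect (exists x, X x /\ Y x = a).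
    by rewrite -Yx; case: (q_lb x Xx).
  move: pa; rewrite (_ : p a = 0) ?ltxx//; apply/le_anti; rewrite p0 andbT.
  rewrite (_ : 0 = pr nu (~` X)); last by rewrite pr_setC// /pr nu_X subrr.
  apply: pr_le; [exact: mY|exact: measurableC|].
  by move=> x Yx Xx; apply: nx; exists x.
have [iq qE] := Rintegral_labelling nu (fun a => ln (q a)) mY.
have int_q : \sum_a p a * ln (q a) >= - (n%:R * P) + \int[nu]_x lnf X f n x - ln C.
  have -> : \sum_a p a * ln (q a) = \int[nu]_x ln (q (Y x)).
    by rewrite qE; apply: eq_bigr => a _; rewrite mulrC.
  pose c := - (n%:R * P) - ln C.
  have ic : nu.-integrable setT (EFin \o (fun=> c)) by exact: finite_measure_integrable_cst.
  have ilc : nu.-integrable setT (EFin \o (fun x => lnf X f n x + c)).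
    by apply: (integrableD _ iln ic).
  apply: (@le_trans _ _ (\int[nu]_x (lnf X f n x + c))).
    rewrite RintegralD// Rintegral_cst//= probability_setT/= mulr1 /c; lra.
  apply: (le_Rintegral_full mX nu_X ilc iq) => x Xx.
  by have [] := q_lb x Xx; rewrite /c /=; lra.
have term a : nxln (p a) + L * ((s a)%:R * p a) + p a * ln (q a) <=
    q a - p a + (s a)%:R * q a * expR L.
  have sq : 0 <= (s a)%:R * q a * expR L by rewrite !mulr_ge0 ?expR_ge0.
  have [pa|pa] := ltP 0 (p a); last first.
    have -> : p a = 0 by have := p0 a; lra.
    by rewrite nxln0 !mulr0 !mul0r; have := q0 a; lra.
  have qa := q_gt0 a pa; case: (s a) sq => sq; last first.
    by rewrite !mul0r mulr0; have := mul_ln_div_le pa qa; rewrite /nxln; lra.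
  have qe : 0 < q a * expR L by rewrite mulr_gt0 ?expR_gt0.
  have := mul_ln_div_le pa qe; rewrite lnM ?posrE ?expR_gt0// expRK /nxln !mul1r => ?.
  by have := q0 a; lra.
have tot : \sum_a (nxln (p a) + L * ((s a)%:R * p a) + p a * ln (q a)) <=
    \sum_a (q a - p a + (s a)%:R * q a * expR L) by exact: ler_sum.
have q1 : \sum_a q a = 1 by exact: pr_labelling_sum.
have p1 : \sum_a p a = 1 by exact: pr_labelling_sum.
have e1 : \sum_a (q a - p a + (s a)%:R * q a * expR L) = pr mu E * expR L.
  by rewrite big_split/= sumrB q1 p1 subrr add0r -mulr_suml -prEE.
have e2 : \sum_a (nxln (p a) + L * ((s a)%:R * p a) + p a * ln (q a)) =
    fin_entropy nu Y + L * pr nu E + \sum_a p a * ln (q a).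
  by rewrite !big_split/= -mulr_sumr -prEE.
by rewrite e1 e2 in tot; lra.
Qed.

End Variational.

(** * Equilibrium measures *)

Section Equilibrium.
Context {R : realType}.
Variables (X : set sequences) (f : nat -> sequences -> R).
Hypothesis X_shift : subshift X.
Hypothesis X_neq0 : X !=set0.
Hypothesis f_pos : positive_continuous X f.
Hypothesis f_bowen : bowen X f.
Hypothesis f_sub : subadditive_upto_constant X f.
Hypothesis f_Z1 : (Z1 X f < +oo)%E.

Let mX : measurable X.
Proof. by apply: measurable_closed; case: X_shift. Qed.

Lemma gibbs_pointwise (mu : probability sequences R) : gibbs X f mu ->
  exists C P, [/\ 1 <= C, pressure X f = P%:E,
    gibbs_bound X f mu C P &
    forall n x, (0 < n)%N -> X x ->
      C^-1 * (expR (- (n%:R * P)) * f n x) <= pr mu (cyl (mkseq x n)) <=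
      C * (expR (- (n%:R * P)) * f n x)].
Proof.
move=> mug; have [C [P [C1 muC]]] := gibbs_boundP X_shift X_neq0 f_pos f_bowen mug.
have C0 : 0 < C by lra.
have [M M1 MW] := bowen_wt X_neq0 f_pos f_bowen.
have CM1 : C <= C * M by rewrite ler_peMr// ltW.
have CM0 : 0 < C * M by lra.
have e0 n : 0 <= expR (- (n%:R * P)) by exact: expR_ge0.
have lo w : 0 <= expR (- ((size w)%:R * P)) * wt X f w.
  by rewrite mulr_ge0// wt_ge0.
exists (C * M), P; split; first by lra.
- exact: (gibbs_bound_pressure X_neq0 f_pos f_bowen mug.1.1 C0 muC).
- move=> w w0; have /andP[h1 h2] := muC w w0; apply/andP; split.
    by rewrite (le_trans _ h1)// ler_wpM2r// lef_pV2 ?posrE.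
  by rewrite (le_trans h2)// ler_wpM2r.
move=> n x n0 Xx; set w := mkseq x n.
have sw : size w = n by rewrite size_mkseq.
have w0 : w != [::] by rewrite -size_eq0 sw -lt0n.
have xw : cylinder X w x by split => //; exact: cyl_mkseq.
have [_ fx fw wM] := MW w x w0 xw; have /andP[h1 h2] := muC w w0.
rewrite sw in fx fw wM h1 h2; apply/andP; split.
- apply: le_trans h1.
  apply: (@le_trans _ _ (C^-1 * (expR (- (n%:R * P)) * f n x))).
    by rewrite ler_wpM2r ?lef_pV2 ?posrE// mulr_ge0// ltW.
  by rewrite ler_wpM2l ?invr_ge0 ?(ltW C0)// ler_wpM2l.
- by rewrite (le_trans h2)// -mulrA ler_wpM2l ?(ltW C0)// mulrCA ler_wpM2l.
Qed.

Lemma nxln_le1 (t : R) : 0 <= t -> nxln t <= 1.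
Proof.
move=> t0; have [t_gt0|t_le0] := ltP 0 t; last first.
  by have -> : t = 0 by [lra]; rewrite nxln0.
by have := mul_ln_div_le t_gt0 ltr01; rewrite ln1 /nxln; lra.
Qed.

(** The terms of the series may have both signs. Measuring from an upper bound [T] of [ln (f 1)]
    gives the nonnegative terms [wt * (T - q i)], whose partial sums increase; were they unbounded,
    the original series would be [-oo]. *)
Lemma summable_log_weights :
  (-oo < \sum_(i <oo | i \in alphabet X)
     (ereal_sup [set (ln (f 1%N x))%:E | x in cylinder X [:: i]]
      * sup_cyl X f 1 [:: i]))%E ->
  exists (T : R) (q : nat -> R) (B : R),
  [/\ forall i, q i <= T,
      forall i x, cylinder X [:: i] x -> ln (f 1%N x) <= q i,
      forall i c, alphabet X i ->
        (forall x, cylinder X [:: i] x -> ln (f 1%N x) <= c) -> q i <= c &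
      forall n, \sum_(0 <= i < n) wt X f [:: i] * (T - q i) <= B].
Proof.
have [T T0 lT] := lnf_bound X_shift X_neq0 f_pos f_bowen f_sub f_Z1.
have [_ fp] := f_pos (ltn0Sn 0).
have lT1 i x : cylinder X [:: i] x -> ln (f 1%N x) <= T.
  by move=> [Xx _]; have := lT 1%N x erefl Xx; rewrite lnfE// mul1r.
pose Q i := ereal_sup [set (ln (f 1%N x))%:E | x in cylinder X [:: i]].
(* The default [T] makes [T - q i] vanish for letters outside the alphabet. *)
pose q i := if i \in alphabet X then fine (Q i) else T.
have QT i : (Q i <= T%:E)%E.
  by apply: ge_ereal_sup => _ [x xi <-]; rewrite lee_fin (lT1 i).
have Qx i x : cylinder X [:: i] x -> ((ln (f 1%N x))%:E <= Q i)%E.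
  by move=> xi; apply: ereal_sup_ubound; exists x.
have Qfin i : alphabet X i -> Q i = (q i)%:E.
  move=> ai; rewrite /q mem_set// fineK// fin_numE; case: (ai) => x xi.
  have := Qx i x xi; have := QT i.
  by case: (Q i).
have qT i : q i <= T.
  rewrite /q; case: ifPn => [/set_mem ai|//].
  by rewrite -lee_fin; have := QT i; rewrite {1}(Qfin i ai) /q mem_set.
have wt0 i : 0 <= wt X f [:: i] by exact: wt_ge0.
have wtfin := wt_summable X_neq0 f_pos f_bowen f_Z1.
pose S := fine (\sum_(i <oo) (wt X f [:: i])%:E)%E.
have S_ub n : \sum_(0 <= i < n) wt X f [:: i] <= S.
  have SE : S%:E = (\sum_(i <oo) (wt X f [:: i])%:E)%E.
    by rewrite fineK// ge0_fin_numE//; apply: nneseries_ge0 => i _ _; rewrite lee_fin.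
  rewrite -lee_fin SE -sumEFin.
  by apply: nneseries_lim_ge => i _ _; rewrite lee_fin.
pose t i := if i \in alphabet X then q i * wt X f [:: i] else 0.
rewrite eseries_mkcond (eq_eseriesr (g := fun i => (t i)%:E)); last first.
  move=> i _; rewrite /t; case: ifPn => // /set_mem ai.
  rewrite -/(Q i) (Qfin i ai) EFinM; congr (_ * _)%E.
  case: ai => x xi; have [M _ MW] := bowen_wt X_neq0 f_pos f_bowen.
  by have [-> _ _ _] := MW [:: i] x erefl xi.
move=> limt.
pose D n := \sum_(0 <= i < n) wt X f [:: i] * (T - q i).
have D_nd : {homo D : n m / (n <= m)%N >-> n <= m}.
  apply/nondecreasing_seqP => n; rewrite /D big_nat_recr//= lerDl.
  by rewrite mulr_ge0 ?subr_ge0.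
have tD n : \sum_(0 <= i < n) t i <= T * S - D n.
  rewrite lerBrDr /D -big_split/= (le_trans _ (ler_wpM2l T0 (S_ub n)))// mulr_sumr.
  apply: ler_sum => i _; rewrite /t; case: ifPn => ai.
    by rewrite le_eqVlt; apply/orP; left; apply/eqP; ring.
  by rewrite /q (negbTE ai) subrr mulr0 addr0 mulr_ge0.
have [B DB] : exists B, forall n, D n <= B.
  apply: contrapT => /forallNP nB; move: limt.
  suff -> : (\sum_(i <oo) (t i)%:E = -oo)%E by rewrite ltxx.
  apply/cvg_lim => //; apply/cvgeNyPle => A.
  have /existsNP [n /negP] := nB (T * S - A); rewrite -ltNge => Dn.
  exists n => // m /= nm; rewrite sumEFin lee_fin (le_trans (tD m))//.
  by have := D_nd _ _ nm; move: Dn; lra.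
exists T, q, B; split => // [i x xi|i c ai xc].
  have ai : alphabet X i by exists x.
  by rewrite -lee_fin -Qfin// Qx.
by rewrite -lee_fin -Qfin//; apply: ge_ereal_sup => _ [x xi <-]; rewrite lee_fin xc.
Qed.

Section GibbsEquilibrium.
Variables (mu : probability sequences R) (C P : R).
Hypothesis C_ge1 : 1 <= C.
Hypothesis mu_wt : gibbs_bound X f mu C P.
Hypothesis mu_pt : forall n x, (0 < n)%N -> X x ->
  C^-1 * (expR (- (n%:R * P)) * f n x) <= pr mu (cyl (mkseq x n)) <=
  C * (expR (- (n%:R * P)) * f n x).

Let C_gt0 : 0 < C. Proof. by move: C_ge1; lra. Qed.

Let e n := fin_entropy mu (truncate n).

(** The lower Gibbs bound gives [- ln (m i) <= c + (T - q i)] and the upper one [m i <= c' * wt]. In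
    the total, [c] is weighted by a mass at most 1, [T - q i] by the letter weights, and the last
    cell of the truncation adds at most 1. *)
Lemma truncate_entropy_bounded :
  (-oo < \sum_(i <oo | i \in alphabet X)
     (ereal_sup [set (ln (f 1%N x))%:E | x in cylinder X [:: i]]
      * sup_cyl X f 1 [:: i]))%E ->
  exists B, forall K, e K <= B.
Proof.
move=> /summable_log_weights [T [q [B [qT q_ub q_lub sumB]]]].
pose c := P + ln C - T; pose c' := C * expR (- P).
have c'0 : 0 < c' by rewrite mulr_gt0 ?expR_gt0.
exists (`|c| + c' * B + 1) => K.
have wt0 i : 0 <= wt X f [:: i] by exact: wt_ge0.
pose m i := pr mu (cyl [:: i]).
have m0 i : 0 <= m i by exact: pr_ge0.
have term i : nxln (m i) <= `|c| * m i + c' * (wt X f [:: i] * (T - q i)).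
  have b0 : 0 <= c' * (wt X f [:: i] * (T - q i)).
    by apply: mulr_ge0; [exact: ltW|rewrite mulr_ge0 ?subr_ge0].
  have [mi|mi] := ltP 0 (m i); last first.
    by have -> : m i = 0 by [have := m0 i; lra]; rewrite nxln0 mulr0 add0r.
  have ai : alphabet X i.
    apply: contrapT => nai; move: mi; have := mu_wt (w := [:: i]) erefl.
    by rewrite -/(m i) wt_empty// !mulr0 => /andP[_]; lra.
  have hq : q i <= P + ln C + ln (m i).
    apply: q_lub => // x [Xx xi].
    have /andP[h _] := mu_pt (n := 1) erefl Xx.
    have [_ fp] := f_pos (ltn0Sn 0); have fx := fp _ Xx.
    have w0 : 0 < C^-1 * (expR (- (1%:R * P)) * f 1%N x).
      by rewrite !mulr_gt0 ?invr_gt0 ?expR_gt0.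
    have xE : mkseq x 1 = [:: i] by [].
    rewrite xE -/(m i) -ler_ln ?posrE// in h.
    move: h; rewrite !lnM ?posrE ?mulr_gt0 ?invr_gt0 ?expR_gt0// lnV ?posrE// expRK.
    by rewrite mul1r; lra.
  have hm : m i <= c' * wt X f [:: i].
    have := mu_wt (w := [:: i]) erefl; rewrite -/(m i) => /andP[_] /=.
    by rewrite mul1r mulrA.
  have h1 : m i * (T - q i) <= c' * (wt X f [:: i] * (T - q i)).
    by rewrite mulrA ler_wpM2r ?subr_ge0.
  have h2 : m i * - ln (m i) <= m i * (P + ln C - q i).
    by rewrite ler_pM2l//; lra.
  have h3 : c * m i <= `|c| * m i by rewrite ler_wpM2r// ler_norm.
  by rewrite /nxln; move: h1 h2 h3; rewrite /c; lra.
have preE (i : 'I_K) : truncate K @^-1` [set widen_ord (leqnSn K) i] = cyl [:: val i].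
  apply/seteqP; split => x /=.
    move=> /(congr1 val); rewrite /truncate /= inordK ?ltnS ?geq_minr// => xi.
    have x0 : x 0%N = i by have := ltn_ord i; move: xi; clear; lia.
    by rewrite /cyl /= /mkseq /= x0.
  move=> [xi]; apply: val_inj; rewrite /truncate /= inordK ?ltnS ?geq_minr//.
  by rewrite xi; have := ltn_ord i; clear; lia.
rewrite /e /fin_entropy big_ord_recr/=.
have last1 : nxln (pr mu (truncate K @^-1` [set ord_max])) <= 1.
  by apply: nxln_le1; exact: pr_ge0.
have sum1 : \sum_(i < K) m i <= 1.
  have := pr_labelling_sum mu (@labelling_truncate K); rewrite big_ord_recr/= => <-.
  under [in leRHS]eq_bigr do rewrite preE.
  by rewrite lerDl pr_ge0.
under eq_bigr do rewrite preE.
apply: lerD => //.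
apply: (le_trans (ler_sum _ (fun (i : 'I_K) _ => term i))).
rewrite big_split/= -!mulr_sumr lerD//.
  by rewrite ler_piMr.
rewrite ler_wpM2l ?(ltW c'0)//; have := sumB K; rewrite big_mkord; exact.
Qed.

End GibbsEquilibrium.
End Equilibrium.

Section GibbsEquilibrium.
Context {R : realType}.
Variables (X : set sequences) (f : nat -> sequences -> R).
Hypothesis X_shift : subshift X.
Hypothesis X_neq0 : X !=set0.
Hypothesis f_pos : positive_continuous X f.
Hypothesis f_bowen : bowen X f.
Hypothesis f_sub : subadditive_upto_constant X f.
Hypothesis f_Z1 : (Z1 X f < +oo)%E.
Variables (mu : probability sequences R) (C P : R).
Hypothesis mu_inv : invariant_measure X mu.
Hypothesis C_ge1 : 1 <= C.
Hypothesis pressureP : pressure X f = P%:E.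
Hypothesis mu_pt : forall n x, (0 < n)%N -> X x ->
  C^-1 * (expR (- (n%:R * P)) * f n x) <= pr mu (cyl (mkseq x n)) <=
  C * (expR (- (n%:R * P)) * f n x).

Let mX : measurable X.
Proof. by apply: measurable_closed; case: X_shift. Qed.

Let C_gt0 : 0 < C. Proof. by move: C_ge1; lra. Qed.

Let mu_lb n x : (0 < n)%N -> X x ->
  C^-1 * (expR (- (n%:R * P)) * f n x) <= pr mu (cyl (mkseq x n)).
Proof. by move=> n0 Xx; case/andP: (mu_pt n0 Xx). Qed.

Let H (nu : probability sequences R) K n := fin_entropy nu (trunc_word K n).
Let I (nu : probability sequences R) n := \int[nu]_x lnf X f n x.

Lemma trunc_entropy_le (nu : probability sequences R) K n : nu X = 1%E -> (0 < n)%N ->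
  nu.-integrable setT (EFin \o lnf X f n) ->
  H nu K n <= n%:R * P - I nu n + ln C.
Proof.
move=> nuX n0 il.
have d0 : truncation_determined n K set0 by [].
have := variational_inequality X_shift f_pos C_gt0 mu_lb nuX n0 (lexx 0) d0 il.
by rewrite !pr_set0 !mul0r !addr0.
Qed.

(* The information functions of the truncated partitions increase to that of the
   partition into cylinders. *)
Lemma cylinder_information_le n (B : R) : (0 < n)%N -> (forall K, H mu K n <= B) ->
  mu.-integrable setT (EFin \o lnf X f n) /\ n%:R * P - ln C - I mu n <= B.
Proof.
move=> n0 HB; have [muX muS] := mu_inv.
pose q K x := pr mu (trunc_word K n @^-1` [set trunc_word K n x]).
pose v (x : sequences) := - ln (pr mu (cyl (mkseq x n))).
pose psi K x := - ln (q K x).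
have mtw K a : measurable (trunc_word K n @^-1` [set a]) by exact: labelling_trunc_word.
have q_pt x K : X x -> pr mu (cyl (mkseq x n)) <= q K x /\ 0 < pr mu (cyl (mkseq x n)).
  move=> Xx; split.
    apply: pr_le => //; first exact: measurable_cyl.
    move=> y /cylP yx /=; apply/trunc_wordP => i ni.
    by rewrite yx ?size_mkseq// nth_mkseq.
  apply: lt_le_trans (mu_lb n0 Xx).
  by have [_ fp] := f_pos n0; rewrite !mulr_gt0 ?invr_gt0 ?expR_gt0 ?fp.
have psi0 K x : 0 <= psi K x by rewrite oppr_ge0 ln_le0// pr_le1.
have v0 x : 0 <= v x by rewrite oppr_ge0 ln_le0// pr_le1//; exact: measurable_cyl.
have psi_int K : mu.-integrable setT (EFin \o psi K) /\ \int[mu]_x psi K x = H mu K n.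
  have [h1 h2] := Rintegral_labelling mu
    (fun a => - ln (pr mu (trunc_word K n @^-1` [set a]))) (@labelling_trunc_word K n).
  split; first exact: h1.
  rewrite [LHS]h2; apply: eq_bigr => a _; rewrite /nxln; ring.
have psiS K K' x : X x -> (K <= K')%N -> psi K x <= psi K' x.
  move=> Xx KK; have [q1 p0] := q_pt x K' Xx; have [q2 _] := q_pt x K Xx.
  rewrite lerN2 ler_ln ?posrE ?(lt_le_trans p0)//.
  apply: pr_le => // y /= /trunc_wordP yx; apply/trunc_wordP => i /yx; lia.
(* The sequence is eventually constant: once [K] exceeds the first [n] letters of [x], its truncated
   cell is its cylinder. *)
have psi_lim x : X x -> (psi K x)%:E @[K --> \oo] --> (v x)%:E.
  move=> Xx; apply: cvg_near_cst; exists (\max_(i < n) x i).+1 => // K /= hK.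
  congr EFin; rewrite /psi /v /q; congr (- ln (pr _ _)).
  apply/seteqP; split => y /=.
    move=> /trunc_wordP yx; apply/cylP => i; rewrite size_mkseq => ni.
    rewrite nth_mkseq//; have := yx i ni.
    have : (x i < K)%N by apply: leq_ltn_trans hK; exact: (leq_bigmax (Ordinal ni)).
    by clear; lia.
  move=> /cylP yx; apply/trunc_wordP => i ni.
  by rewrite yx ?size_mkseq// nth_mkseq.
have mpsi K : measurable_fun setT (psi K).
  by have /integrableP[/measurable_EFinP] := (psi_int K).1.
have mv : measurable_fun setT v.
  move=> _ A mA; rewrite setTI; apply: (@prefix_determined_measurable n) => x y xy.
  rewrite /preimage /= /v (_ : mkseq y n = mkseq x n)//.
  by apply: (@eq_from_nth _ 0%N); rewrite !size_mkseq// => i ni; rewrite !nth_mkseq// xy.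
have int_v : (\int[mu]_(x in X) (v x)%:E <= B%:E)%E.
  rewrite (eq_integral (fun x => limn (fun K => (psi K x)%:E))); last first.
    by move=> x /set_mem Xx; apply/esym/cvg_lim => //; exact: psi_lim.
  rewrite monotone_convergence//.
  - apply: lime_le.
      apply: ereal_nondecreasing_is_cvgn => K K' KK; apply: ge0_le_integral => //.
      + by move=> x _; rewrite lee_fin.
      + by apply/measurable_EFinP; exact: measurable_funTS.
      + by apply/measurable_EFinP; exact: measurable_funTS.
      + by move=> x Xx; rewrite lee_fin; exact: psiS.
    apply: nearW => K; have [ip ipE] := psi_int K.
    rewrite -[X in (X <= _)%E]fineK; last first.
      by apply: integrable_fin_num => //; apply: integrableS ip.
    rewrite lee_fin -/(Rintegral mu X (psi K)) Rintegral_full// ipE.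
    exact: HB.
  - by move=> K; apply/measurable_EFinP; exact: measurable_funTS.
  - by move=> K x _; rewrite lee_fin.
  - by move=> x Xx K K' KK; rewrite lee_fin; exact: psiS.
pose v' : sequences -> R := v \_ X.
have v'E x : X x -> v' x = v x by move=> Xx; rewrite /v' patchE mem_set.
have iv' : mu.-integrable setT (EFin \o v').
  rewrite /v' -restrict_EFin; apply/(integrable_mkcond _ mX)/integrableP; split.
    by apply/measurable_EFinP; exact: measurable_funTS.
  under eq_integral do rewrite /= ger0_norm//.
  by apply: le_lt_trans int_v _; rewrite ltry.
(* The upper Gibbs bound. With [v] integrable it bounds [lnf] below, and [lnf_bound] bounds it
   above, which yields integrability. *)
have v_lb x : X x -> n%:R * P - ln C - lnf X f n x <= v x.
  move=> Xx; have /andP[_ hi] := mu_pt n0 Xx; have [_ p0] := q_pt x 0%N Xx.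
  have [_ fp] := f_pos n0; have fx := fp _ Xx.
  move: hi; rewrite -ler_ln ?posrE ?mulr_gt0 ?expR_gt0//.
  by rewrite !lnM ?posrE ?mulr_gt0 ?expR_gt0// expRK /v lnfE//; lra.
have [T T0 lT] := lnf_bound X_shift X_neq0 f_pos f_bowen f_sub f_Z1.
have iln : mu.-integrable setT (EFin \o lnf X f n).
  have c0 : 0 <= `|n%:R * P| + `|ln C| + n%:R * T by rewrite !addr_ge0// mulr_ge0.
  apply: (integrable_of_bound _ c0 iv'); first exact: measurable_lnf.
  move=> x; have [Xx|nXx] := pselect (X x); last by rewrite lnf0// normr0 addr_ge0.
  have h1 := v_lb x Xx; have h2 := lT n x n0 Xx.
  have h3 := ler_norm (- (n%:R * P)); rewrite normrN in h3.
  have h4 := ler_norm (ln C); have h5 := normr_ge0 (n%:R * P).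
  have h6 := normr_ge0 (ln C); have h7 : 0 <= n%:R * T by rewrite mulr_ge0.
  rewrite v'E// (ger0_norm (v0 x)) ler_norml; apply/andP; split; have := v0 x; lra.
split => //.
pose k := n%:R * P - ln C.
have ik : mu.-integrable setT (EFin \o (fun=> k)) by exact: finite_measure_integrable_cst.
have ikl : mu.-integrable setT (EFin \o (fun x => k - lnf X f n x)).
  by apply: (integrableB _ ik iln).
have -> : n%:R * P - ln C - I mu n = \int[mu]_x (k - lnf X f n x).
  by rewrite RintegralB// Rintegral_cst//= probability_setT/= mulr1.
apply: (@le_trans _ _ (\int[mu]_x v' x)).
  by apply: (le_Rintegral_full mX muX ikl iv') => x Xx; rewrite v'E// v_lb.
rewrite -lee_fin fineK; last exact: integrable_fin_num.
by apply: le_trans int_v; rewrite [leRHS]integral_mkcond restrict_EFin.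
Qed.

(** Let [s] be the supremum of the entropies [e K] of the truncations and [l] the limit of the
    averages of [I mu]. Dividing the finite-length inequalities by [n] gives
    [h K <= P - l <= h K + (s - e K)], and [s - e K] can be made arbitrarily small. *)
Lemma gibbs_equilibrium (B : R) : (forall K, fin_entropy mu (truncate K) <= B) ->
  equilibrium X f mu.
Proof.
move=> eB; have [muX muS] := mu_inv.
pose e K := fin_entropy mu (truncate K).
have e_sup : has_sup (range e).
  by split; [exists (e 0%N), 0%N|exists B => _ [K _ <-]; exact: eB].
pose s := sup (range e).
have es K : e K <= s by apply: ub_le_sup; [case: e_sup|exists K].
have HB K n K' : H mu K' n <= H mu K n + n%:R * (s - e K).
  have [KK|KK] := leqP K K'.
    rewrite (le_trans (trunc_entropy_cond muS n KK))// lerD2l ler_wpM2l// lerD2r.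
    exact: es.
  rewrite (le_trans (trunc_entropy_mono mu n (ltnW KK)))// lerDl mulr_ge0// subr_ge0.
  exact: es.
have il n : (0 < n)%N -> mu.-integrable setT (EFin \o lnf X f n).
  by move=> n0; have [] := cylinder_information_le n0 (HB 0%N n).
have info K n : (0 < n)%N ->
    n%:R * P - ln C - I mu n <= H mu K n + n%:R * (s - e K).
  by move=> n0; have [] := cylinder_information_le n0 (HB K n).
have lnC0 : 0 <= ln C by exact: ln_ge0.
have [l lI] : exists l : R, (n%:R^-1 * I mu n) @[n --> \oo] --> l.
  have [C1 C10 I_sub] := Rintegral_lnf_subadditive X_shift f_pos f_sub mu_inv il.
  (* Adding [C1] turns subadditivity up to a constant into plain subadditivity; index 0 is set apart
     because [f 0] is unconstrained. *)
  pose a n := if n is 0%N then 0 else I mu n + C1.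
  have a_sub n m : a (n + m)%N <= a n + a m.
    case: n => [|n]; first by rewrite add0n add0r.
    case: m => [|m]; first by rewrite addn0 addr0.
    by rewrite /a addSn -addSn; have := I_sub n.+1 m.+1 erefl erefl; rewrite /I; lra.
  have a_lb n : - (n%:R * (`|P| + ln C + (s - e 0%N))) <= a n.
    case: n => [|n]; first by rewrite mul0r oppr0.
    have := info 0%N n.+1 erefl.
    (* At level 0 all letters are identified, so the truncated entropy is 0. *)
    rewrite /H (@fin_entropy_cst _ _ _ mu _ (trunc_word 0 n.+1)); last first.
      by move=> x y; apply/trunc_wordP => i _; rewrite !minn0.
    have h1 : ln C <= n.+1%:R * ln C by rewrite ler_peMl// ler1n.
    have h2 : - (n.+1%:R * `|P|) <= n.+1%:R * P.
      by rewrite -mulrN ler_wpM2l// lerNl -normrN ler_norm.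
    by rewrite /a; lra.
  have [l al _] := fekete a_sub a_lb; exists l.
  rewrite -[l]subr0 -[X in l - X](mulr0 C1).
  have c2 : (n%:R^-1 * a n - C1 * n%:R^-1) @[n --> \oo] --> l - C1 * 0.
    by apply: cvgB => //; apply: cvgMr; exact: cvg_natr_inv.
  apply: cvg_trans c2; apply: near_eq_cvg; exists 1%N => // -[//|n] _ /=.
  by rewrite mulrDr [C1 * _]mulrC addrK.
pose h K := partition_entropy mu left_shift (truncate K).
have cC : (n%:R^-1 * ln C) @[n --> \oo] --> 0.
  by rewrite -[0](mul0r (ln C)); apply: cvgMl; exact: cvg_natr_inv.
have hle K : h K <= P - l.
  have [hc _] := trunc_entropy_cvg muS K.
  have c2 : (P - n%:R^-1 * I mu n + n%:R^-1 * ln C) @[n --> \oo] --> P - l + 0.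
    by apply: cvgD => //; apply: cvgB => //; exact: cvg_cst.
  rewrite -[leRHS]addr0; apply: (ler_cvg_to hc c2).
  exists 1%N => // n /= n0; have nN : n%:R != 0 :> R by rewrite pnatr_eq0 -lt0n.
  have := trunc_entropy_le K muX n0 (il n n0).
  have n_inv : 0 <= n%:R^-1 :> R by rewrite invr_ge0.
  move=> /(ler_wpM2l n_inv); rewrite mulrDr mulrBr mulKf//.
have hge K : P - l <= h K + (s - e K).
  have [hc _] := trunc_entropy_cvg muS K.
  have c1 : (P - n%:R^-1 * ln C - n%:R^-1 * I mu n) @[n --> \oo] --> P - 0 - l.
    by apply: cvgB => //; apply: cvgB => //; exact: cvg_cst.
  have c2 : (n%:R^-1 * H mu K n + (s - e K)) @[n --> \oo] --> h K + (s - e K).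
    by apply: cvgD => //; exact: cvg_cst.
  rewrite -[P]subr0; apply: (ler_cvg_to c1 c2).
  exists 1%N => // n /= n0; have nN : n%:R != 0 :> R by rewrite pnatr_eq0 -lt0n.
  have n_inv : 0 <= n%:R^-1 :> R by rewrite invr_ge0.
  have := ler_wpM2l n_inv (info K n n0).
  by rewrite 2!mulrBr mulrDr !mulKf.
have entE : entropy mu left_shift = (P - l)%:E.
  apply/le_anti/andP; split.
    apply: ge_ereal_sup => _ [k [xi [mxi ->]]]; rewrite lee_fin.
    apply/ler_addgt0Pr => d d0.
    have [K0 K0P] := partition_entropy_le_trunc muS mxi d0.
    by apply: (le_trans (K0P K0 (leqnn _))); rewrite lerD2r; exact: hle.
  apply/lee_addgt0Pr => d d0.
  have [_ [K _ <-] sK] := sup_adherent d0 e_sup.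
  apply: (@le_trans _ _ ((h K)%:E + d%:E)%E).
    by rewrite -EFinD lee_fin; have := hge K; move: sK; rewrite -/s; lra.
  rewrite leeD2r//; apply: ereal_sup_ubound; exists K.+1, (truncate K).
  by split => //; exact: labelling_truncate.
split => //; exists l%:E; split.
- have cE : (n%:R^-1 * I mu n)%:E @[n --> \oo] --> l%:E.
    by apply: cvg_EFin => //; exact: nearW.
  apply: cvg_trans cE; apply: near_eq_cvg; exists 1%N => // n /= n0.
  rewrite integral_lnE EFinM /I fineK//.
  by apply: integrable_fin_num => //; exact: il.
- by rewrite entE.
- by rewrite entE pressureP -EFinD subrK.
Qed.

(** A defined sum equal to the real number [P] has finite terms, so the integrals are finite for
    large [n], hence for all [n] by [integrable_lnf_le]. As [I nu n + c] is subadditive, its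
    averages lie above their limit [l]. *)
Lemma equilibrium_asymptotics (nu : probability sequences R) : equilibrium X f nu ->
  exists h l c, [/\ entropy nu left_shift = h%:E, P = h + l &
    forall n, (0 < n)%N -> nu.-integrable setT (EFin \o lnf X f n) /\
      n%:R * l - c <= I nu n].
Proof.
move=> [nuI [l [lcvg ldef]]]; rewrite pressureP.
have fin (x y : \bar R) : adde_def x y -> P%:E = (x + y)%E ->
    exists h l', [/\ x = h%:E, y = l'%:E & P = h + l'].
  by case: x y => [h||] [l'||]//= _ [->]; exists h, l'.
move=> /(fin _ _ ldef) [h [l' [hE lE PE]]]; rewrite lE in lcvg.
have [N0 _ fin_near] : \forall n \near \oo,
    (n%:R^-1%:E * \int[nu]_(x in X) (ln (f n x))%:E)%E \is a fin_num.
  by have [] := (fine_cvgP _ _).1 lcvg.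
have il n : (0 < n)%N -> nu.-integrable setT (EFin \o lnf X f n).
  move=> n0; pose m := maxn n N0.
  have m0 : (0 < m)%N by rewrite (leq_trans n0)// leq_maxl.
  have mi : (0 < (m%:R^-1)%:E :> \bar R)%E by rewrite lte_fin invr_gt0 ltr0n.
  apply: (integrable_lnf_le X_shift X_neq0 f_pos f_bowen f_sub f_Z1 n0 (leq_maxl n N0)).
  apply: integrable_lnf_fin => //; move: (fin_near m (leq_maxr n N0)).
  by case: (\int[nu]_(x in X) _)%E => [//||]; rewrite ?gt0_muley ?gt0_muleNy.
have lI : (n%:R^-1 * I nu n) @[n --> \oo] --> l'.
  have [_ c1] := (fine_cvgP _ _).1 lcvg.
  apply: cvg_trans c1; apply: near_eq_cvg; exists 1%N => // n /= n0.
  by rewrite integral_lnE fineM// ?integrable_fin_num//; exact: il.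
have [c c0 I_sub] := Rintegral_lnf_subadditive X_shift f_pos f_sub nuI il.
exists h, l', c; split => // n n0; split; first exact: il.
have I_mul k : I nu (k.+1 * n)%N <= k.+1%:R * (I nu n + c).
  elim: k => [|k IH]; first by rewrite mul1n mul1r lerDl.
  have := I_sub n (k.+1 * n)%N n0; rewrite muln_gt0 n0 => /(_ isT).
  by rewrite -mulSn -/(I nu _) -/(I nu _) -/(I nu _) -[k.+2%:R]natr1 mulrDl mul1r; lra.
have nN : n%:R != 0 :> R by rewrite pnatr_eq0 -lt0n.
(* The limit is taken along the multiples of [n], where [I_mul] applies. *)
have sub_lim : ((k.+1 * n)%:R^-1 * I nu (k.+1 * n)%N) @[k --> \oo] --> l'.
  apply: (cvg_comp _ _ _ lI) => A [N1 _ NA]; exists N1 => // k /= Nk.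
  by apply: NA => /=; rewrite (leq_trans Nk)// (leq_trans (leqnSn k))// leq_pmulr.
have : l' <= n%:R^-1 * (I nu n + c).
  apply: (ler_cvg_to sub_lim (cvg_cst _)); apply: nearW => k.
  rewrite natrM invfM -mulrA ler_pdivrMl ?ltr0n// mulrCA.
  by rewrite ler_wpM2l ?invr_ge0.
by rewrite ler_pdivlMl ?ltr0n//; lra.
Qed.

Lemma equilibrium_unique (nu : probability sequences R) : ergodic X mu ->
  equilibrium X f nu -> forall A, measurable A -> nu A = mu A.
Proof.
move=> mu_erg nu_eq; have [[nuX nuS] _] := nu_eq.
have [h [l [c [hE PE nuP]]]] := equilibrium_asymptotics nu_eq.
apply: (ergodic_absolutely_continuous_unique X_shift mu_inv mu_erg nu_eq.1) => A mA muA.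
(* Of the 4, two units come from entropy errors of [1 / n] each, made [n] times, one from
   [pr mu E * expR L] and one from [L * expR (- L)]. *)
pose B := c + ln C + 4.
have key (L : R) : 0 < L -> L * pr nu A <= B.
  move=> L0; have eL : 0 < expR (- L) by exact: expR_gt0.
  pose m : {measure set sequences -> \bar R} := measure_add mu nu.
  have m_add F : m F = (mu F + nu F)%E by exact: measure_addE.
  have mfin : (m setT < +oo)%E.
    by rewrite m_add; apply: lte_add_pinfty; exact: probability_lty.
  have [r [K1 [E [dE]]]] := truncation_determined_approx mfin mA eL.
  rewrite m_add => AE.
  have mE := prefix_determined_measurable (truncation_determined_prefix dE).
  have mAE := measurable_symdiff mA mE.
  (* A positive length covering the coordinates that determine [E]; the precision asked of the
     entropies below is adapted to it. *)
  pose n := r.+1; have n0 : 0 < (n%:R : R) by rewrite ltr0n.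
  have ni : 0 < (n%:R^-1 : R) by rewrite invr_gt0.
  have [k [xi [mxi xih]]] : exists k (xi : sequences -> 'I_k),
      labelling xi /\ h - n%:R^-1 <= partition_entropy nu left_shift xi.
    have : ((h - n%:R^-1)%:E < entropy nu left_shift)%E.
      by rewrite hE lte_fin ltrBlDr ltrDl.
    by move=> /ereal_sup_gt [_ [k [xi [mxi ->]]]] /ltW; exists k, xi.
  have [K0 K0P] := partition_entropy_le_trunc nuS mxi ni.
  pose K := maxn K0 K1.
  have {}dE : truncation_determined n K E.
    by apply: truncation_determinedW dE; [exact: leqnSn|exact: leq_maxr].
  have [iln I_lb] := nuP n (ltn0Sn r).
  have := variational_inequality X_shift f_pos C_gt0 mu_lb nuX (ltn0Sn r) (ltW L0) dE iln.
  have := K0P K (leq_maxl _ _).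
  have [_ /(_ n (ltn0Sn r))] := trunc_entropy_cvg nuS K.
  rewrite ler_pdivlMl// => hK1 hK2 var.
  have hK3 : n%:R * (h - 2 * n%:R^-1) <= H nu K n.
    by apply: le_trans hK1; rewrite ler_pM2l//; lra.
  have hK4 : n%:R * (h - 2 * n%:R^-1) = n%:R * h - 2.
    by rewrite mulrBr mulrCA divff ?gt_eqF// mulr1.
  have AE_small : pr mu (symdiff A E) + pr nu (symdiff A E) <= expR (- L).
    by rewrite -lee_fin EFinD !prE// ltW.
  have pr_sub (m' : probability sequences R) F G : measurable F -> measurable G ->
      F `<=` G `|` symdiff A E -> pr m' F <= pr m' G + pr m' (symdiff A E).
    move=> mF mG FG; rewrite -lee_fin EFinD !prE//.
    apply: le_trans (measureU2 m' mG mAE).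
    by apply: le_measure; rewrite ?inE//; exact: measurableU.
  have muE : pr mu E <= pr mu (symdiff A E).
    have := pr_sub mu E A mE mA; rewrite {2}/pr muA add0r; apply.
    by move=> x Ex; have [Ax|nAx] := pselect (A x); [left|right; right].
  have nuA : pr nu A <= pr nu E + pr nu (symdiff A E).
    apply: pr_sub => // x Ax.
    by have [Ex|nEx] := pselect (E x); [left|right; left].
  have s1 := pr_ge0 mu (symdiff A E); have s2 := pr_ge0 nu (symdiff A E).
  have e1 : pr mu E * expR L <= 1.
    by rewrite -ler_pdivlMr ?expR_gt0// mul1r -expRN; lra.
  have e2 : L * expR (- L) <= 1.
    rewrite expRN ler_pdivrMr ?expR_gt0// mul1r.
    by have := expR_ge1Dx L; lra.
  have e3 : L * pr nu A <= L * pr nu E + L * expR (- L).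
    by rewrite -mulrDr ler_pM2l//; lra.
  have {}var : H nu K n + L * pr nu E <=
    n%:R * (h + l) - I nu n + ln C + pr mu E * expR L by rewrite -[h + l]PE; exact: var.
  by rewrite mulrDr in var; rewrite hK4 in hK3; rewrite /B; lra.
have pA := pr_ge0 nu A.
rewrite -prE//; congr EFin; apply/le_anti; rewrite pA andbT leNgt; apply/negP => p0.
have B0 : 0 <= B by apply: le_trans (key 1 ltr01); rewrite mul1r.
have : 0 < (B + 1) / pr nu A by rewrite divr_gt0//; lra.
by move=> /key; rewrite divfK ?gt_eqF//; lra.
Qed.

End GibbsEquilibrium.

Theorem theorem5p1 (R : realType) (X : set sequences)
    (f : nat -> sequences -> R)
    (X_sofic : finitely_irreducible_countable_sofic X)
    (f_pos_cont : positive_continuous X f)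
    (f_bowen : bowen X f)
    (f_subadd : subadditive_upto_constant X f)
    (f_qmult : finitely_quasi_multiplicative X f)
    (f_Z1 : (Z1 X f < +oo)%E) :
  exists mu : probability sequences R,
    [/\ gibbs X f mu /\ ergodic X mu,
        (forall nu : probability sequences R,
           gibbs X f nu -> ergodic X nu ->
           forall A, measurable A -> nu A = mu A) &
        ((-oo < \sum_(i <oo | i \in alphabet X)
             (ereal_sup [set (ln (f 1%N x))%:E | x in cylinder X [:: i]]
              * sup_cyl X f 1 [:: i]))%E ->
         equilibrium X f mu /\
         (forall nu : probability sequences R,
            equilibrium X f nu ->
            forall A, measurable A -> nu A = mu A))].
Proof.
have [X_shift X_infinite _ _] := X_sofic.
(* An empty [X] would lie in the full shift on the empty alphabet. *)
have X_neq0 : X !=set0.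
  by apply: contrapT => nX; apply: (X_infinite set0) => // x Xx; case: nX; exists x.
have [mu mu_gibbs] := gibbs_exists X_shift X_neq0 f_pos_cont f_bowen f_subadd f_qmult f_Z1.
have mu_erg := gibbs_ergodic X_shift X_neq0 f_pos_cont f_bowen f_qmult mu_gibbs.
exists mu; split => // [nu nu_gibbs _|log_sum].
  exact: (gibbs_unique X_shift X_neq0 f_pos_cont f_bowen f_qmult mu_gibbs nu_gibbs).
have [C [P [C1 pP mu_bound mu_pt]]] :=
  gibbs_pointwise X_shift X_neq0 f_pos_cont f_bowen mu_gibbs.
have mu_inv := mu_gibbs.1; split.
  have [B eB] := truncate_entropy_bounded X_shift X_neq0 f_pos_cont f_bowen f_subadd
    f_Z1 C1 mu_bound mu_pt log_sum.
  exact: (gibbs_equilibrium X_shift X_neq0 f_pos_cont f_bowen f_subadd f_Z1 mu_inv C1 pP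
    mu_pt eB).
move=> nu; exact: (equilibrium_unique X_shift X_neq0 f_pos_cont f_bowen f_subadd f_Z1 mu_inv C1
  pP mu_pt mu_erg).
Qed.
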